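(* Let $I, K\subseteq A=\Bbbk[x_1,\ldots,x_d]$ and $J, L\subseteq B=\Bbbk[y_1,\ldots,y_e]$ be homogeneous ideals with $I$ and $J$ nonzero and proper, and let $R=A\otimes_{\Bbbk}B$. Assume that either of the following conditions holds: (i) $\operatorname{char}\Bbbk=0$; (ii) $I, K, J, L$ are monomial ideals. Then, for all integers $s\ge 1$, there are equalities $$\operatorname{depth} \frac{R}{(I+J)^{(s)}_{KL}} =\min_{1\le i\le s} \left\{\operatorname{depth} \frac{A}{I^{(i)}_K}+\operatorname{depth} \frac{B}{J^{(s-i)}_L}+1,\ \operatorname{depth} \frac{A}{I^{(i)}_K}+\operatorname{depth} \frac{B}{J^{(s+1-i)}_L}\right\},$$ $$\operatorname{reg} \frac{R}{(I+J)^{(s)}_{KL}} =\max_{1\le i\le s} \left\{\operatorname{reg} \frac{A}{I^{(i)}_K}+\operatorname{reg} \frac{B}{J^{(s-i)}_L}+1,\ \operatorname{reg} \frac{A}{I^{(i)}_K}+\operatorname{reg} \frac{B}{J^{(s+1-i)}_L}\right\}.$$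
   Context: $\Bbbk$ is a field, $A=\Bbbk[x_1,\ldots,x_d]$ and $B=\Bbbk[y_1,\ldots,y_e]$ are standard graded polynomial rings over $\Bbbk$, and $R=A\otimes_{\Bbbk}B=\Bbbk[x_1,\ldots,x_d,y_1,\ldots,y_e]$ with its standard grading. Ideals of $A$ and $B$ are identified with their extensions to $R$: $I+J$ means $IR+JR$ and $KL$ means $(KR)(LR)$. For ideals $\mathfrak{a},\mathfrak{c}$ in a commutative ring $S$ and an integer $s\ge 0$, the $s$-th saturated power of $\mathfrak{a}$ with respect to $\mathfrak{c}$ is $\mathfrak{a}^{(s)}_{\mathfrak{c}} := \mathfrak{a}^s : \mathfrak{c}^\infty = \bigcup_{t\ge 1} (\mathfrak{a}^s :_S \mathfrak{c}^t)$, where $\mathfrak{a}^0=S$; in particular $\mathfrak{a}^{(0)}_{\mathfrak{c}}=S$. Here $\operatorname{depth}$ is the depth of a finitely generated graded module with respect to the homogeneous maximal ideal, and $\operatorname{reg}$ is Castelnuovo–Mumford regularity, with the conventions $\operatorname{depth} 0=+\infty$ and $\operatorname{reg} 0=-\infty$. *)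

(* Defs.v *)
From HB Require Import structures.
From mathcomp Require Import all_boot all_order all_algebra.
From mathcomp Require Import boolp classical_sets.
(* The notations of constructive_ereal and those of mpoly cannot be loaded
   together, hence [extended int] for the extended integers. *)
From mathcomp Require Import -(notations) constructive_ereal.
From mathcomp Require Import mpoly.

Set Implicit Arguments.
Unset Strict Implicit.
Unset Printing Implicit Defensive.

Import Order.TTheory GRing.Theory Num.Theory.
Local Open Scope classical_set_scope.
Local Open Scope ring_scope.

Section Ideals.
Variable R : comNzRingType.
Implicit Types (I J C E m : set R).

Definition is_ideal I : Prop :=
  [/\ I 0, forall f g, I f -> I g -> I (f + g) & forall r f, I f -> I (r * f)].

Definition ideal_gen E : set R := smallest is_ideal E.

Definition ideal_add I J : set R := [set f + g | f in I & g in J].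

Definition ideal_mul I J : set R := ideal_gen [set f * g | f in I & g in J].

Definition ideal_exp I (s : nat) : set R := iter s (ideal_mul I) setT.

Definition ideal_colon I J : set R := [set f | forall g, J g -> I (f * g)].

Definition sat_power I C (s : nat) : set R :=
  \bigcup_(t in [set t | (1 <= t)%N])
    ideal_colon (ideal_exp I s) (ideal_exp C t).

(* [rs] is an (R/I)-regular sequence of elements of [m]. *)
Definition regular_seq m I (rs : seq R) : Prop :=
  [/\ forall j, (j < size rs)%N -> m rs`_j,
      forall j, (j < size rs)%N ->
        forall g, ideal_gen (I `|` [set` take j rs]) (rs`_j * g) ->
          ideal_gen (I `|` [set` take j rs]) g
    & ~ ideal_gen (I `|` [set` rs]) 1].

End Ideals.

Section ExtendIdeal.
Variables (R S : comNzRingType) (phi : R -> S).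

Definition ideal_ext (I : set R) : set S := ideal_gen (phi @` I).

End ExtendIdeal.

Section PolynomialRing.
Variables (k : fieldType) (n : nat).
Implicit Type I : set {mpoly k[n]}.

Definition homogeneous_ideal I : Prop :=
  is_ideal I /\ forall f j, I f -> I (pihomog mdeg j f).

Definition monomial_ideal I : Prop :=
  exists G : set 'X_{1..n}, I = ideal_gen [set 'X_[m] | m in G].

Definition irrelevant_ideal : set {mpoly k[n]} := [set f | f@_0%MM = 0].

(* The depth of S/I with respect to the irrelevant ideal, S = k[x_1, ..., x_n],
   for I an ideal. *)
Definition depth_quot I : extended int :=
  if `[< I 1 >] then EPInf int
  else supremum (ENInf int)
    [set EFin (size rs)%:Z | rs in regular_seq irrelevant_ideal I].

(* A minimal graded free resolution of S/I. Its i-th module is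
   F_i = \bigoplus_r S(- mfr_shift i r), whose elements are row vectors; the
   differential F_{i+1} -> F_i is right multiplication by [mfr_diff i], and the
   augmentation F_0 -> S/I is lifted to right multiplication by [mfr_aug].
   The degree conditions hold vacuously for zero entries. *)
Record min_free_resolution I := MinFreeResolution {
  mfr_rank : nat -> nat;
  mfr_shift : forall i, 'I_(mfr_rank i) -> nat;
  mfr_diff : forall i, 'M[{mpoly k[n]}]_(mfr_rank i.+1, mfr_rank i);
  mfr_aug : 'cV[{mpoly k[n]}]_(mfr_rank 0);
  mfr_diff_homog : forall i r c, {in msupp (mfr_diff i r c),
    forall m, (mfr_shift c + mdeg m)%N = mfr_shift r};
  mfr_aug_homog : forall r, {in msupp (mfr_aug r 0),
    forall m, mdeg m = mfr_shift r};
  mfr_aug_surj : exists v : 'rV_(mfr_rank 0), I ((v *m mfr_aug) 0 0 - 1);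
  mfr_exact0 : forall v : 'rV_(mfr_rank 0),
    I ((v *m mfr_aug) 0 0) <-> exists w, v = w *m mfr_diff 0;
  mfr_exact : forall i (v : 'rV_(mfr_rank i.+1)),
    v *m mfr_diff i = 0 <-> exists w, v = w *m mfr_diff i.+1;
  mfr_minimal : forall i r c, irrelevant_ideal (mfr_diff i r c)
}.

(* The pairs (i, j) for which S(-j) is a summand of the i-th module of the
   minimal graded free resolution of S/I. *)
Definition betti_support I : set (nat * nat) :=
  [set ij | exists (F : min_free_resolution I) (r : 'I_(mfr_rank F ij.1)),
    mfr_shift r = ij.2].

Definition reg_quot I : extended int :=
  supremum (ENInf int)
    [set EFin (ij.2%:Z - ij.1%:Z) | ij in betti_support I].

End PolynomialRing.

Definition incl_left (k : fieldType) (d e : nat) (p : {mpoly k[d]}) :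
    {mpoly k[d + e]} :=
  p \mPo [tuple 'X_(lshift e i) | i < d].

Definition incl_right (k : fieldType) (d e : nat) (p : {mpoly k[e]}) :
    {mpoly k[d + e]} :=
  p \mPo [tuple 'X_(rshift d i) | i < e].

Definition ext_left (k : fieldType) (d e : nat) (I : set {mpoly k[d]}) :
    set {mpoly k[d + e]} :=
  ideal_ext (@incl_left k d e) I.

Definition ext_right (k : fieldType) (d e : nat) (J : set {mpoly k[e]}) :
    set {mpoly k[d + e]} :=
  ideal_ext (@incl_right k d e) J.

Arguments ext_left {k d} e I.
Arguments ext_right {k} d {e} J.

(* Main.v *)
(* Depth and regularity of S/N are read off the nonvanishing bidegrees of the
   Koszul homology H(x; S/N): the depth is n minus the top homological degree
   (a regular sequence of maximal length exists by prime avoidance), and the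
   minimal graded free resolution has its shifts in those bidegrees (dimension
   shifting).

   Over any field (I+J)^(s) is the sum of the I^(i) J^(s-i). Its Koszul complex
   is filtered by the powers of J, with graded pieces tensor products, so the
   Kuenneth formula bounds its homology from above by that of A/I^(i) and of
   J^(l)/J^(l+1), and the latter by that of B/J^(l+1) and B/J^(l).

   The bounds are attained as soon as the Koszul complex has a contracting
   homotopy mapping I^(i+1) to I^(i). In characteristic 0 it is the de Rham
   differential divided by the total degree, since the derivatives of elements
   of I^(i+1) lie in I^(i); for monomial ideals it is the division by the first
   variable of a monomial. Such homotopies turn pairs of classes of A/I^(i) and
   B/J^(l) into classes for s = i + l - 1 and, through a connecting map, for
   s = i + l, which linear functionals detect. *)
From HB Require Import structures.
From mathcomp Require Import all_boot all_order all_algebra.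
From mathcomp Require Import boolp classical_sets.
From mathcomp Require Import -(notations) constructive_ereal.
From mathcomp Require Import mpoly ssrcomplements.
From mathcomp Require Import zify ring.
Require Import Defs.

Set Implicit Arguments.
Unset Strict Implicit.
Unset Printing Implicit Defensive.
Import Order.TTheory GRing.Theory Num.Theory.
Local Open Scope classical_set_scope.
Local Open Scope ring_scope.

(** Quotients and exact sequences are never formed. A chain of S/N is a chain over S taken modulo
    coefficients in N; splittings and connecting maps become explicit projectors, functionals and
    chains. The obstacle for the lower bound: the product of arbitrary cycles of A/I^(i) and B/J^(l)
    is no cycle for s = i + l - 1. The homotopy supplies representatives with coefficients in
    I^(i-1) and J^(l-1), for which it is one. The constants come from bidegrees. Classes in
    bidegrees (p, a) and (q, b) give a product in (p + q, a + b) for s = i + l - 1. The connecting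
    map lowers only the homological degree, so s = i + l receives (p + q - 1, a + b), which accounts
    for the +1 both in the depth and in the regularity. The class of 1 in H_0 escapes every
    homotopy, so only positive homological degrees can be multiplied. Nothing is lost: a nonzero
    proper ideal has nonzero H_1, and H_0 sits in bidegree (0, 0) alone, so both extrema are
    attained in positive degree. *)

Section LinearAlgebra.
Variable k : fieldType.

Definition is_subspace (V : lmodType k) (W : set V) : Prop :=
  [/\ W 0, forall u v, W u -> W v -> W (u + v) & forall c u, W u -> W (c *: u)].

Definition span_of (V : lmodType k) (E : set V) : set V :=
  smallest (@is_subspace V) E.

Section Subspaces.
Variable V : lmodType k.
Implicit Types (W E : set V).

Lemma subspaceB W u v : is_subspace W -> W u -> W v -> W (u - v).
Proof. by case=> _ WD WZ Wu Wv; apply: WD => //; rewrite -scaleN1r; apply: WZ. Qed.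

Lemma subspaceN W u : is_subspace W -> W u -> W (- u).
Proof. by case=> _ _ WZ Wu; rewrite -scaleN1r; apply: WZ. Qed.

Lemma subspace_sum W (T : Type) (r : seq T) (P : pred T) (F : T -> V) :
  is_subspace W -> (forall i, P i -> W (F i)) -> W (\sum_(i <- r | P i) F i).
Proof. by case=> W0 WD _ WF; elim/big_ind: _ => //; apply: WD. Qed.

Lemma subspace_sum_seq W (T : eqType) (r : seq T) (F : T -> V) :
  is_subspace W -> (forall i, i \in r -> W (F i)) -> W (\sum_(i <- r) F i).
Proof.
by move=> sW WF; rewrite big_seq; apply: subspace_sum => // i; apply: WF.
Qed.

Lemma subspaceT : is_subspace [set: V].
Proof. by []. Qed.

Lemma span_is_subspace E : is_subspace (span_of E).
Proof.
split=> [|u v su sv|c u su] W [sW EW]; have [W0 WD WZ] := sW => //.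
- by apply: WD; [apply: su|apply: sv].
- by apply: WZ; apply: su.
Qed.

Lemma sub_span E : E `<=` span_of E.
Proof. exact: sub_gen_smallest. Qed.

Lemma span_min W E : is_subspace W -> E `<=` W -> span_of E `<=` W.
Proof. exact: smallest_sub. Qed.

Lemma span_mono E1 E2 : E1 `<=` E2 -> span_of E1 `<=` span_of E2.
Proof.
move=> sE; apply: span_min; first exact: span_is_subspace.
by apply: subset_trans sE _; apply: sub_span.
Qed.

Definition sum_set W E : set V := [set u + v | u in W & v in E].

Lemma sum_set_subspace W E :
  is_subspace W -> is_subspace E -> is_subspace (sum_set W E).
Proof.
move=> [W0 WD WZ] [E0 ED EZ]; split.
- by exists 0 => //; exists 0 => //; rewrite addr0.
- move=> _ _ [a Wa [b Eb <-]] [c Wc [d' Ed <-]].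
  by exists (a + c); [apply: WD|exists (b + d'); [apply: ED|rewrite addrACA]].
- move=> c _ [a Wa [b Eb <-]].
  by exists (c *: a); [apply: WZ|exists (c *: b); [apply: EZ|rewrite scalerDr]].
Qed.

Lemma sum_setl W E : E 0 -> W `<=` sum_set W E.
Proof. by move=> E0 u Wu; exists u => //; exists 0 => //; rewrite addr0. Qed.

Lemma sum_setr W E : W 0 -> E `<=` sum_set W E.
Proof. by move=> W0 u Eu; exists 0 => //; exists u => //; rewrite add0r. Qed.

End Subspaces.

Lemma preim_subspace (V V' : lmodType k) (f : {linear V -> V'}) (W : set V') :
  is_subspace W -> is_subspace (f @^-1` W).
Proof.
move=> [W0 WD WZ]; split=> [|u v Wu Wv|c u Wu] /=.
- by rewrite linear0.
- by rewrite linearD; apply: WD.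
- by rewrite linearZ; apply: WZ.
Qed.

Lemma image_subspace (V V' : lmodType k) (f : {linear V -> V'}) (W : set V) :
  is_subspace W -> is_subspace (f @` W).
Proof.
move=> [W0 WD WZ]; split=> [|_ _ [u Wu <-] [v Wv <-]|c _ [u Wu <-]].
- by exists 0 => //; rewrite linear0.
- by exists (u + v); [apply: WD|rewrite linearD].
- by exists (c *: u); [apply: WZ|rewrite linearZ].
Qed.

(** * Linear choice functions, projectors and functionals *)

Section Selection.
Variables (V W : lmodType k) (G H : set (V * W)%type).
Hypotheses (sG : is_subspace G) (sH : is_subspace H) (HG : H `<=` G).
Hypothesis Hfun : forall w, H (0, w) -> w = 0.
Hypothesis Gtot : forall v, exists w, G (v, w).

(* Zorn's lemma yields a maximal linear graph between H and G; adjoining a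
   line to it shows that it is total. *)
Lemma linear_selection : exists f : {linear V -> W},
  (forall v, G (v, f v)) /\ (forall p, H p -> f p.1 = p.2).
Proof.
pose P X := [/\ is_subspace (H `|` X), H `|` X `<=` G &
                forall w, (H `|` X) (0, w) -> w = 0].
have [F FP totF|M [[sM MG Mfun] Mmax]] := @Zorn_bigcup _ P.
  have key X : F X -> H `|` X `<=` H `|` \bigcup_(X in F) X.
    by move=> FX p [Hp|Xp]; [left|right; exists X].
  split.
  - split; first by left; case: sH.
    + move=> u v [Hu|[X FX Xu]] [Hv|[X' FX' Xv]].
      * by left; case: sH => _ HD _; apply: HD.
      * apply: (key _ FX'); have [[_ XD _] _ _] := FP _ FX'.
        by apply: XD; [left|right].
      * apply: (key _ FX); have [[_ XD _] _ _] := FP _ FX.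
        by apply: XD; [right|left].
      * have [sX|sX] := totF _ _ FX FX'.
          apply: (key _ FX'); have [[_ XD _] _ _] := FP _ FX'.
          by apply: XD; right => //; apply: sX.
        apply: (key _ FX); have [[_ XD _] _ _] := FP _ FX.
        by apply: XD; right => //; apply: sX.
    + move=> c u [Hu|[X FX Xu]]; first by left; case: sH => _ _; apply.
      apply: (key _ FX); have [[_ _ XZ] _ _] := FP _ FX.
      by apply: XZ; right.
  - move=> u [/HG //|[X FX Xu]]; have [_ XG _] := FP _ FX.
    by apply: XG; right.
  - move=> w [/Hfun //|[X FX Xu]]; have [_ _] := FP _ FX.
    by apply; right.
set U := H `|` M in sM MG Mfun.
have [U0 UD UZ] := sM.
(* If v were outside the domain, adjoining the line through a pair (v, w) of [G] would enlarge [M]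
   and keep it single-valued: a pair (0, w') with c nonzero would put v into the domain already. *)
have Utot v : exists w, U (v, w).
  apply: contrapT => nU; have [w Gvw] := Gtot v.
  pose X := [set p | exists u c, U u /\ p = u + c *: (v, w)].
  have UX : U `<=` X by move=> u Uu; exists u, 0; rewrite scale0r addr0.
  have HX : H `|` X = X.
    by apply/seteqP; split=> [u [Hu|//]|u]; [apply: UX; left|right].
  have Xvw : X (v, w) by exists 0, 1; rewrite scale1r add0r.
  apply: (Mmax X); first split.
  - by move=> u Mu; apply: UX; right.
  - by move=> /(_ _ Xvw) Mvw; apply: nU; exists w; right.
  split; rewrite HX.
  - split; first exact: UX.
    + move=> _ _ [u [c [Uu ->]]] [u' [c' [Uu' ->]]].
      by exists (u + u'), (c + c'); split; [apply: UD|rewrite scalerDl addrACA].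
    + move=> a _ [u [c [Uu ->]]].
      by exists (a *: u), (a * c); split; [apply: UZ|rewrite scalerDr scalerA].
  - move=> _ [u [c [Uu ->]]]; have [_ GD GZ] := sG.
    by apply: GD; [apply: MG|apply: GZ].
  - move=> w' [[u1 u2] [c [Uu [/esym/eqP uv ->]]]].
    have [c0|c0] := eqVneq c 0.
      move: uv Uu; rewrite c0 !scale0r !addr0 => /eqP -> Uu.
      exact: Mfun.
    case: nU; exists (- c^-1 *: u2).
    suff -> : (v, - c^-1 *: u2) = - c^-1 *: (u1, u2) by apply: UZ.
    congr (_, _); rewrite /= addr_eq0 in uv.
    by rewrite (eqP uv) scalerN scaleNr opprK scalerA mulVf // scale1r.
pose f v := projT1 (cid (Utot v)).
have Uf v : U (v, f v) by rewrite /f; case: cid.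
have Uinj v w1 w2 : U (v, w1) -> U (v, w2) -> w1 = w2.
  move=> U1 U2; apply/subr0_eq/Mfun.
  have -> : (0, w1 - w2) = (v, w1) - (v, w2) by congr (_, _); rewrite /= subrr.
  exact: subspaceB.
have flin : linear f.
  move=> c u v; apply: (Uinj (c *: u + v)) => //.
  by apply: (UD (c *: (u, f u)) (v, f v)) => //; apply: UZ.
pose lf := GRing.isLinear.Build k V W _ f flin.
pose f' : {linear V -> W} := HB.pack f lf.
exists f'; split=> [v|[v w] Hp]; first by apply: MG; apply: Uf.
by apply: (Uinj v) => //; left.
Qed.

End Selection.

(** Linear selection from the relation that only asks the value to lie in [W], with the diagonal of
    [W] prescribed. *)
Lemma exists_projector (V : lmodType k) (W : set V) : is_subspace W ->
  exists q : {linear V -> V}, (forall v, W (q v)) /\ (forall v, W v -> q v = v).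
Proof.
move=> sW; have [W0 WD WZ] := sW.
have [||||//|q [Gq Hq]] := @linear_selection V V [set p | W p.2]
  [set p | W p.1 /\ p.1 = p.2].
- by split=> [|? ?|? ?] //=; [apply: WD|apply: WZ].
- split=> [//|u v [Wu eu] [Wv ev]|c u [Wu eu]] /=; split.
  + exact: WD.
  + by rewrite eu ev.
  + exact: WZ.
  + by rewrite eu.
- by case=> u v [Wu] /= <-.
- by move=> w [_] /= <-.
- by move=> v; exists 0.
- by exists q; split=> // v Wv; apply: (Hq (v, v)).
Qed.

(** The prescribed graph, the pairs (u, c) with u - c v in [W], is the functional on W + k v that
    vanishes on [W] and is 1 at v. *)
Lemma exists_functional (V : lmodType k) (W : set V) (v : V) :
  is_subspace W -> ~ W v ->
  exists phi : {linear V -> k^o}, (forall w, W w -> phi w = 0) /\ phi v = 1.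
Proof.
move=> sW nWv; have [W0 WD WZ] := sW.
have [||||//|q [_ Hq]] := @linear_selection V k^o setT
  [set p | W (p.1 - p.2 *: v)].
- by [].
- split=> [|[u1 c1] [u2 c2] /= h1 h2|c [u1 c1] /= h1].
  + by rewrite /= scale0r subr0.
  + by rewrite scalerDl opprD addrACA; apply: WD.
  + by rewrite -scalerA -scalerBr; apply: WZ.
- by [].
- move=> c /=; rewrite sub0r => /(subspaceN sW); rewrite opprK => Wcv.
  apply: contrapT => /eqP c0; apply: nWv.
  by rewrite -[v]scale1r -(mulVf c0) -scalerA; apply: WZ.
- by move=> u; exists 0.
- exists q; split=> [w Ww|].
    by apply: (Hq (w, 0)); rewrite /= scale0r subr0.
  by apply: (Hq (v, 1)); rewrite /= scale1r subrr.
Qed.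

End LinearAlgebra.

(** * Koszul complexes *)

(* A family indexed by {set 'I_n} stands for the element \sum_T f(T) e_T of
   V (x) Lambda; [ann i] is the contraction with the i-th dual basis vector and
   [cre i] is the exterior multiplication by e_i. *)
Section Clifford.
Local Open Scope set_scope.
Variables (n : nat) (V : zmodType).
Implicit Types (i j : 'I_n) (T : {set 'I_n}) (f g : {ffun {set 'I_n} -> V}).

(** A boolean sign instead of a scalar, since [V] is only an additive group here. *)
Definition csign (b : bool) (v : V) : V := if b then - v else v.

Lemma csignA b c v : csign b (csign c v) = csign (b (+) c) v.
Proof. by case: b; case: c; rewrite /= ?opprK. Qed.

Lemma csignB b u v : csign b (u - v) = csign b u - csign b v.
Proof. by case: b; rewrite /= ?opprB ?opprK 1?addrC. Qed.

Lemma csign0 b : csign b 0 = 0.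
Proof. by case: b; rewrite /= ?oppr0. Qed.

Lemma csignN b v : csign (~~ b) v = - csign b v.
Proof. by case: b; rewrite /= ?opprK. Qed.

Lemma csign_mem (M : set V) b v : (forall u, M u -> M (- u)) -> M v -> M (csign b v).
Proof. by move=> MN Mv; case: b => //=; apply: MN. Qed.

(** The parity of the number of basis vectors that e_i passes on the way to its place in the
    increasing product e_T. *)
Definition osign i T : bool := odd #|[set j in T | (j < i)%N]|.

Lemma osignU i j T : j \notin T -> osign i (j |: T) = osign i T (+) (j < i)%N.
Proof.
move=> jT; rewrite /osign; case: (boolP (j < i)%N) => ji.
  have -> : [set l in j |: T | (l < i)%N] = j |: [set l in T | (l < i)%N].
    apply/setP=> l; rewrite !inE; case: (eqVneq l j) => [->|//]; by rewrite ji.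
  by rewrite cardsU1 !inE (negbTE jT) /= addbT.
have -> : [set l in j |: T | (l < i)%N] = [set l in T | (l < i)%N].
  by apply/setP=> l; rewrite !inE; case: (eqVneq l j) => [->|//]; rewrite (negbTE ji) !andbF.
by rewrite addbF.
Qed.

Lemma osignD i j T : j \in T -> osign i (T :\ j) = osign i T (+) (j < i)%N.
Proof.
by move=> jT; rewrite -[in RHS](finset.setD1K jT) osignU ?addbK // !inE eqxx.
Qed.

Lemma osign_swap i j : i != j -> (i < j)%N = ~~ (j < i)%N.
Proof. by rewrite -leqNgt [RHS]leq_eqVlt => /negbTE; rewrite -val_eqE => ->. Qed.

Definition ann i f : {ffun {set 'I_n} -> V} :=
  [ffun T : {set 'I_n} => if i \in T then 0 else csign (osign i T) (f (i |: T))].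

Definition cre i f : {ffun {set 'I_n} -> V} :=
  [ffun T : {set 'I_n} => if i \in T then csign (osign i T) (f (T :\ i)) else 0].

Definition kmap (g : V -> V) f : {ffun {set 'I_n} -> V} := [ffun T => g (f T)].

(** The grading involution, which carries the sign of the Leibniz rule on tensor products. *)
Definition kpar f : {ffun {set 'I_n} -> V} := [ffun T : {set 'I_n} => csign (odd #|T|) (f T)].

Definition kpr (p : nat) f : {ffun {set 'I_n} -> V} :=
  [ffun T : {set 'I_n} => if #|T| == p then f T else 0].

Lemma ann_additive i : additive (ann i).
Proof.
move=> f g; apply/ffunP=> T; rewrite !ffunE; case: ifP; rewrite ?subrr //.
by rewrite csignB.
Qed.
HB.instance Definition _ i := GRing.isAdditive.Build _ _ (ann i) (ann_additive i).

Lemma cre_additive i : additive (cre i).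
Proof.
move=> f g; apply/ffunP=> T; rewrite !ffunE; case: ifP; rewrite ?subrr //.
by rewrite csignB.
Qed.
HB.instance Definition _ i := GRing.isAdditive.Build _ _ (cre i) (cre_additive i).

Lemma kmap_additive (g : {additive V -> V}) : additive (kmap g).
Proof. by move=> f f'; apply/ffunP=> T; rewrite !ffunE raddfB. Qed.
HB.instance Definition _ (g : {additive V -> V}) :=
  GRing.isAdditive.Build _ _ (kmap g) (kmap_additive g).

Lemma kpar_additive : additive kpar.
Proof. by move=> f f'; apply/ffunP=> T; rewrite !ffunE csignB. Qed.
HB.instance Definition _ := GRing.isAdditive.Build _ _ kpar kpar_additive.

Lemma kpr_additive p : additive (kpr p).
Proof.
by move=> f f'; apply/ffunP=> T; rewrite !ffunE; case: ifP => //; rewrite subrr.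
Qed.
HB.instance Definition _ p := GRing.isAdditive.Build _ _ (kpr p) (kpr_additive p).

Lemma ann_ann i j f : ann i (ann j f) = - ann j (ann i f).
Proof.
apply/ffunP=> T; rewrite !ffunE !inE.
case: (boolP (i \in T)) => iT; first by rewrite orbT csign0 if_same oppr0.
case: (boolP (j \in T)) => jT; first by rewrite orbT csign0 oppr0.
rewrite !orbF [j == i]eq_sym; case: (eqVneq i j) => [_|ij].
  by rewrite !csign0 oppr0.
rewrite !csignA finset.setUCA !osignU // (osign_swap ij) -csignN.
by case: (osign i T); case: (osign j T); case: ltnP.
Qed.

(** Together with [ann_ann], the Clifford relations: the square of the differential, the homotopies
    and Cartan's formula are computed from them without returning to subsets. *)
Lemma cre_ann i j f :
  cre i (ann j f) + ann j (cre i f) = if i == j then f else 0.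
Proof.
apply/ffunP=> T; rewrite !ffunE !inE.
case: (eqVneq i j) => [<-|ij].
  case: (boolP (i \in T)) => iT.
    by rewrite addr0 csignA osignD // ltnn addbF addbb finset.setD1K.
  by rewrite add0r csignA osignU // ltnn addbF addbb finset.setU1K.
rewrite eq_sym in ij; rewrite ffunE.
case: (boolP (j \in T)) => jT.
  by rewrite /= csign0 if_same addr0.
rewrite andbF /=; case: (boolP (i \in T)) => iT; last by rewrite csign0 addr0.
rewrite !csignA osignD // osignU // (osign_swap ij).
have -> : (j |: T) :\ i = j |: (T :\ i).
  by apply/setP=> l; rewrite !inE; case: (eqVneq l j) => [->|//]; rewrite ij.
by case: (osign i T); case: (osign j T); case: ltnP; rewrite /= ?addNr ?subrr.
Qed.

Lemma ann_creE i f T : ann i (cre i f) T = if i \in T then 0 else f T.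
Proof.
rewrite !ffunE !inE eqxx; case: (boolP (i \in T)) => iT //=.
by rewrite csignA osignU // ltnn addbF addbb finset.setU1K.
Qed.

Lemma cre_annE i f T : cre i (ann i f) T = if i \in T then f T else 0.
Proof.
rewrite !ffunE !inE eqxx; case: (boolP (i \in T)) => iT //=.
by rewrite csignA osignD // ltnn addbF addbb finset.setD1K.
Qed.

Lemma ann_kmap i (g : {additive V -> V}) f : ann i (kmap g f) = kmap g (ann i f).
Proof.
by apply/ffunP=> T; rewrite !ffunE; case: ifP; rewrite ?raddf0 //; case: osign; rewrite //= raddfN.
Qed.

Lemma cre_kmap i (g : {additive V -> V}) f : cre i (kmap g f) = kmap g (cre i f).
Proof.
by apply/ffunP=> T; rewrite !ffunE; case: ifP; rewrite ?raddf0 //; case: osign; rewrite //= raddfN.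
Qed.

Lemma ann_kpar i f : ann i (kpar f) = - kpar (ann i f).
Proof.
apply/ffunP=> T; rewrite !ffunE; case: ifP => iT; first by rewrite csign0 oppr0.
rewrite !csignA cardsU1 iT add1n /= -csignN.
by case: (odd _); case: (osign i T).
Qed.

Lemma kpar_id f : kpar (kpar f) = f.
Proof. by apply/ffunP=> T; rewrite !ffunE csignA addbb. Qed.

Lemma ann_kprS i p f : ann i (kpr p.+1 f) = kpr p (ann i f).
Proof.
apply/ffunP=> T; rewrite !ffunE; case: ifP => iT; first by rewrite if_same.
by rewrite cardsU1 iT add1n eqSS; case: ifP => // _; rewrite csign0.
Qed.

Lemma ann_kpr0 i f : ann i (kpr 0 f) = 0.
Proof.
apply/ffunP=> T; rewrite !ffunE; case: ifP => iT //.
by rewrite cardsU1 iT add1n csign0.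
Qed.

Lemma kpr_id p f : kpr p (kpr p f) = kpr p f.
Proof. by apply/ffunP=> T; rewrite !ffunE; case: (_ == p). Qed.

Lemma kpr_kmap p (g : {additive V -> V}) f : kpr p (kmap g f) = kmap g (kpr p f).
Proof. by apply/ffunP=> T; rewrite !ffunE; case: ifP; rewrite ?raddf0. Qed.

Lemma kpr_cre p i f : kpr p.+1 (cre i f) = cre i (kpr p f).
Proof.
apply/ffunP=> T; rewrite !ffunE; case: (boolP (i \in T)) => iT; last by rewrite if_same.
by rewrite (cardsD1 i T) iT add1n eqSS; case: ifP; rewrite ?csign0.
Qed.

Lemma kpr_sum f : f = \sum_(p < n.+1) kpr p f.
Proof.
apply/ffunP=> T; rewrite sum_ffunE.
have lT : (#|T| < n.+1)%N by rewrite ltnS -[X in (_ <= X)%N](card_ord n) max_card.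
rewrite (bigD1 (Ordinal lT)) //= big1 ?addr0 => [|p]; rewrite ffunE ?eqxx //.
by rewrite -val_eqE eq_sym /= => /negbTE ->.
Qed.

End Clifford.

(* Graded modules over k[x_1, ..., x_n]: [gx i] is the multiplication by x_i and
   [gpi a] the projection onto the component of degree a. *)
Record gmod (n : nat) := GMod {
  gcar :> zmodType;
  gx : 'I_n -> {additive gcar -> gcar};
  gpi : nat -> {additive gcar -> gcar};
  gxC : forall i j v, gx i (gx j v) = gx j (gx i v);
  gpiS : forall a i v, gpi a.+1 (gx i v) = gx i (gpi a v);
  gpi0 : forall i v, gpi 0 (gx i v) = 0;
  gpi_id : forall a v, gpi a (gpi a v) = gpi a v;
  gpi_sum : forall v, exists N, forall N', (N <= N')%N -> v = \sum_(a < N') gpi a v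
}.

Section Koszul.
Variables (n : nat) (V : gmod n).
Implicit Types (i : 'I_n) (T : {set 'I_n}) (f g a b : {ffun {set 'I_n} -> V}).
Implicit Types (M : set V).

Definition koszul f : {ffun {set 'I_n} -> V} := \sum_i kmap (gx V i) (ann i f).

Lemma koszulE f T : koszul f T =
  \sum_i if i \in T then 0 else gx V i (csign (osign i T) (f (i |: T))).
Proof.
rewrite sum_ffunE; apply: eq_bigr => i _; rewrite !ffunE.
by case: ifP; rewrite ?raddf0.
Qed.

Lemma koszul_additive : additive koszul.
Proof.
by move=> f g; rewrite /koszul -sumrB; apply: eq_bigr => i _; rewrite !raddfB.
Qed.
HB.instance Definition _ := GRing.isAdditive.Build _ _ koszul koszul_additive.

Lemma kmapC i j f : kmap (gx V i) (kmap (gx V j) f) = kmap (gx V j) (kmap (gx V i) f).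
Proof. by apply/ffunP=> T; rewrite !ffunE gxC. Qed.

Lemma koszul_koszul f : koszul (koszul f) = 0.
Proof.
pose G i j : {ffun {set 'I_n} -> V} := kmap (gx V i) (kmap (gx V j) (ann i (ann j f))).
have E : koszul (koszul f) = \sum_i \sum_j G i j.
  rewrite /koszul; apply: eq_bigr => i _; rewrite !raddf_sum.
  by apply: eq_bigr => j _; rewrite /= ann_kmap.
have GN i j : G i j = - G j i.
  by rewrite /G kmapC ann_ann !raddfN.
(* Antisymmetry only yields 2 G i i = 0, which says nothing in characteristic 2; the diagonal needs
   its own argument. *)
have Gd i : G i i = 0.
  apply/ffunP=> T; rewrite !ffunE; case: ifP => iT; first by rewrite !raddf0.
  by rewrite finset.setU11 csign0 !raddf0.
rewrite E pair_big /= (bigID (fun p : 'I_n * 'I_n => (p.1 < p.2)%N)) /=.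
rewrite [X in _ + X](bigID (fun p : 'I_n * 'I_n => p.1 == p.2)) /=.
rewrite [X in _ + (X + _)]big1 ?add0r => [|[i j] /= /andP[_ /eqP ->]]; last exact: Gd.
rewrite (reindex (fun p : 'I_n * 'I_n => (p.2, p.1))) /=; last first.
  by exists (fun p : 'I_n * 'I_n => (p.2, p.1)) => -[].
under eq_bigr do rewrite GN.
rewrite sumrN [X in _ + X](eq_bigl (fun p : 'I_n * 'I_n => (p.2 < p.1)%N)) ?addNr //.
by move=> [i j] /=; rewrite -leqNgt -val_eqE /=; lia.
Qed.

Lemma koszul_kprS p f : koszul (kpr p.+1 f) = kpr p (koszul f).
Proof.
rewrite /koszul raddf_sum; apply: eq_bigr => i _ /=.
by rewrite kpr_kmap ann_kprS.
Qed.

Lemma koszul_kpr0 f : koszul (kpr 0 f) = 0.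
Proof. by rewrite /koszul big1 // => i _; rewrite ann_kpr0 raddf0. Qed.

Lemma koszul_kpar f : koszul (kpar f) = - kpar (koszul f).
Proof.
rewrite /koszul raddf_sum -sumrN; apply: eq_bigr => i _ /=; rewrite ann_kpar raddfN.
congr (- _); apply/ffunP=> T; rewrite !ffunE.
by case: (odd _) => //=; case: ifP; rewrite ?raddfN ?raddf0.
Qed.

(** Exterior multiplication by e_i is a homotopy from multiplication by x_i to 0, so the variables
    act as zero on Koszul homology. *)
Lemma koszul_cre i f : koszul (cre i f) + cre i (koszul f) = kmap (gx V i) f.
Proof.
rewrite /koszul raddf_sum -big_split /= (bigD1 i) //= big1.
  by rewrite addr0 cre_kmap -raddfD addrC cre_ann eqxx.
by move=> j ji; rewrite cre_kmap -raddfD addrC cre_ann eq_sym (negbTE ji) raddf0.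
Qed.

(** The vector e_T has degree [#|T|], which makes the differential homogeneous; the guard keeps the
    truncated subtraction from selecting degree 0. *)
Definition kgr (j : nat) f : {ffun {set 'I_n} -> V} :=
  [ffun T : {set 'I_n} => if (#|T| <= j)%N then gpi V (j - #|T|) (f T) else 0].

Lemma kgr_additive j : additive (kgr j).
Proof.
by move=> f f'; apply/ffunP=> T; rewrite !ffunE; case: (_ <= j)%N; rewrite ?raddfB ?subrr.
Qed.
HB.instance Definition _ j := GRing.isAdditive.Build _ _ (kgr j) (kgr_additive j).

Lemma kgr_id j f : kgr j (kgr j f) = kgr j f.
Proof. by apply/ffunP=> T; rewrite !ffunE; case: (_ <= j)%N; rewrite ?gpi_id. Qed.

Lemma kgr_kpr j p f : kgr j (kpr p f) = kpr p (kgr j f).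
Proof.
by apply/ffunP=> T; rewrite !ffunE; case: (_ <= j)%N; case: (_ == p); rewrite ?raddf0.
Qed.

Lemma koszul_kgr j f : koszul (kgr j f) = kgr j (koszul f).
Proof.
rewrite /koszul raddf_sum; apply: eq_bigr => i _; apply/ffunP=> T; rewrite !ffunE.
case: (boolP (i \in T)) => iT; first by rewrite !raddf0 if_same.
rewrite cardsU1 iT add1n; case: ltnP => [Tj|].
  rewrite (ltnW Tj) -[(j - #|T|)%N]prednK ?subn_gt0 // gpiS subnS.
  by case: osign; rewrite //= !raddfN.
rewrite csign0 raddf0 leq_eqVlt => /orP[/eqP->|]; last by rewrite ltnNge => /negbTE ->.
by rewrite leqnn subnn gpi0.
Qed.

Lemma kgr_sum f : exists N, f = \sum_(j < N) kgr j f.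
Proof.
have H1 (T : {set 'I_n}) : exists N, forall N', (N <= N')%N ->
    f T = \sum_(j < N') kgr j f T.
  have [N EN] := gpi_sum (f T); exists (N + #|T|)%N => N' NN'.
  rewrite (EN (N' - #|T|)%N); last by lia.
  have le_tN : (#|T| <= N')%N by lia.
  rewrite -(big_mkord xpredT (fun l => kgr l f T)) (big_cat_nat (leq0n _) le_tN) /=.
  rewrite big_nat [X in X + _]big1 => [|l /andP[_ lT]]; last by rewrite ffunE leqNgt lT.
  rewrite add0r.
  rewrite -[in X in _ = X](add0n #|T|) big_addn big_mkord; apply: eq_bigr => a _.
  by rewrite ffunE leq_addl addnK.
pose N := \max_T projT1 (cid (H1 T)); exists N; apply/ffunP=> T.
rewrite sum_ffunE; move: (leq_bigmax (F := fun T => projT1 (cid (H1 T))) T).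
by case: (cid (H1 T)) => /= m Hm Hle; apply: Hm.
Qed.

End Koszul.

(** * Koszul homology of quotients *)

Section KoszulHomology.
Variable n : nat.
Implicit Types V W : gmod n.

Definition subgmod V (M : set V) : Prop :=
  [/\ M 0, forall u v, M u -> M v -> M (u - v) & forall i u, M u -> M (gx V i u)].

Definition graded_sub V (M : set V) : Prop := forall a u, M u -> M (gpi V a u).

Definition kin (V : zmodType) (M : set V) (a : {ffun {set 'I_n} -> V}) : Prop :=
  forall T, M (a T).

(* The Koszul homology of V/M is nonzero in homological degree p, resp. in
   homological degree p and internal degree j. *)
Definition knz V (M : set V) (p : nat) : Prop :=
  exists a, [/\ kpr p a = a, kin M (koszul a) & ~ exists b, kin M (a - koszul b)].

Definition knzj V (M : set V) (p j : nat) : Prop :=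
  exists a, [/\ kpr p a = a, kgr j a = a, kin M (koszul a) &
                ~ exists b, kin M (a - koszul b)].

Section Basic.
Variables (V : gmod n) (M : set V).
Hypothesis sM : subgmod M.
Implicit Types a b : {ffun {set 'I_n} -> V}.

Lemma subgmodN u : M u -> M (- u).
Proof. by case: sM => M0 MB _ Mu; rewrite -sub0r; apply: MB. Qed.

Lemma subgmodD u v : M u -> M v -> M (u + v).
Proof. by case: sM => M0 MB _ Mu Mv; rewrite -[v]opprK; apply: MB => //; apply: subgmodN. Qed.

Lemma subgmod_sum (I : Type) (r : seq I) (P : pred I) (F : I -> V) :
  (forall i, P i -> M (F i)) -> M (\sum_(i <- r | P i) F i).
Proof. by move=> MF; case: sM => M0 _ _; elim/big_ind: _ => //; apply: subgmodD. Qed.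

Lemma kinB a b : kin M a -> kin M b -> kin M (a - b).
Proof. by case: sM => M0 MB _ Ma Mb T; rewrite !ffunE; apply: MB. Qed.

Lemma kinD a b : kin M a -> kin M b -> kin M (a + b).
Proof. by move=> Ma Mb T; rewrite !ffunE; apply: subgmodD. Qed.

Lemma kinN a : kin M a -> kin M (- a).
Proof. by move=> Ma T; rewrite !ffunE; apply: subgmodN. Qed.

Lemma kin_sum (I : Type) (r : seq I) (P : pred I) (F : I -> {ffun {set 'I_n} -> V}) :
  (forall i, P i -> kin M (F i)) -> kin M (\sum_(i <- r | P i) F i).
Proof. by move=> MF T; rewrite sum_ffunE; apply: subgmod_sum => i Pi; apply: MF. Qed.

Lemma kin0 : kin M 0.
Proof. by move=> T; rewrite ffunE; case: sM. Qed.

Lemma kin_ann i a : kin M a -> kin M (ann i a).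
Proof.
move=> Ma T; rewrite ffunE; case: ifP => _; first by case: sM.
by apply: csign_mem => //; apply: subgmodN.
Qed.

Lemma kin_cre i a : kin M a -> kin M (cre i a).
Proof.
move=> Ma T; rewrite ffunE; case: ifP => _; last by case: sM.
by apply: csign_mem => //; apply: subgmodN.
Qed.

Lemma kin_kpar a : kin M a -> kin M (kpar a).
Proof. by move=> Ma T; rewrite ffunE; apply: csign_mem => //; apply: subgmodN. Qed.

Lemma kin_kpr p a : kin M a -> kin M (kpr p a).
Proof. by move=> Ma T; rewrite ffunE; case: ifP => _ //; case: sM. Qed.

Lemma kin_koszul a : kin M a -> kin M (koszul a).
Proof.
move=> Ma; apply: kin_sum => i _ T; rewrite ffunE.
by case: sM => _ _ Mx; apply: Mx; apply: kin_ann.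
Qed.

Lemma kin_kgr j a : graded_sub M -> kin M a -> kin M (kgr j a).
Proof. by move=> gM Ma T; rewrite ffunE; case: ifP => _; [apply: gM|case: sM]. Qed.

(** If every homogeneous component of a chain bounds modulo [M], so does their finite sum. *)
Lemma knz_knzj p : graded_sub M -> (knz M p <-> exists j, knzj M p j).
Proof.
move=> gM; split=> [[a [pa Ma na]]|[j [a [pa _ Ma na]]]]; last by exists a.
have [N EN] := kgr_sum a.
apply: contrapT => nj; apply: na.
have H (j : 'I_N) : exists b, kin M (kgr j a - koszul b).
  apply: contrapT => nb; apply: nj; exists j, (kgr j a); split=> //.
  - by rewrite -kgr_kpr pa.
  - by rewrite kgr_id.
  - by rewrite koszul_kgr; apply: kin_kgr.
exists (\sum_(j < N) projT1 (cid (H j))).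
rewrite [koszul _]raddf_sum {1}EN -sumrB; apply: kin_sum => j _ /=.
by case: cid.
Qed.

Lemma knz_le p : knz M p -> (p <= n)%N.
Proof.
case=> a [pa _ na]; rewrite leqNgt; apply/negP => np; apply: na; exists 0.
rewrite raddf0 subr0 -pa => T; rewrite ffunE; case: eqP => [Tp|_]; last by case: sM.
by have := max_card (mem T); rewrite card_ord Tp leqNgt np.
Qed.

Lemma knz_full p : M = setT -> ~ knz M p.
Proof. by move=> MT [a [_ _]]; apply; exists 0 => T; rewrite MT. Qed.

End Basic.

Section Morphism.
Variables (V W : gmod n) (phi : {additive V -> W}).
Hypothesis phix : forall i v, phi (gx V i v) = gx W i (phi v).
Hypothesis phipi : forall a v, phi (gpi V a v) = gpi W a (phi v).
Implicit Types (a b : {ffun {set 'I_n} -> V}).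

Definition kmor a : {ffun {set 'I_n} -> W} := [ffun T => phi (a T)].

Lemma kmor_additive : additive kmor.
Proof. by move=> a b; apply/ffunP=> T; rewrite !ffunE raddfB. Qed.
HB.instance Definition _ := GRing.isAdditive.Build _ _ kmor kmor_additive.

Lemma kmor_kpr p a : kmor (kpr p a) = kpr p (kmor a).
Proof. by apply/ffunP=> T; rewrite !ffunE; case: (_ == p); rewrite ?raddf0. Qed.

Lemma kmor_kgr j a : kmor (kgr j a) = kgr j (kmor a).
Proof. by apply/ffunP=> T; rewrite !ffunE; case: (_ <= j)%N; rewrite ?raddf0 ?phipi. Qed.

Lemma kmor_koszul a : kmor (koszul a) = koszul (kmor a).
Proof.
apply/ffunP=> T; rewrite ffunE !koszulE raddf_sum; apply: eq_bigr => i _.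
case: ifP => _; first by rewrite raddf0.
by rewrite phix !ffunE; case: osign; rewrite //= ?raddfN.
Qed.

Lemma kmor_lift (M : set W) (c : {ffun {set 'I_n} -> W}) :
  (forall w, exists v, M (w - phi v)) -> exists a, kin M (c - kmor a).
Proof.
move=> H; exists [ffun T => projT1 (cid (H (c T)))] => T.
by rewrite !ffunE; case: cid.
Qed.

(** Surjectivity modulo [M] makes [phi] an isomorphism from V / phi^-1 M to W / M. *)
Lemma knzj_iso (M : set W) p j : subgmod M -> graded_sub M ->
  (forall w, exists v, M (w - phi v)) ->
  knzj (phi @^-1` M) p j <-> knzj M p j.
Proof.
move=> sM gM sur; have kinE a : kin (phi @^-1` M) a <-> kin M (kmor a).
  by split=> H T; move: (H T); rewrite ffunE.
split=> -[a [pa ja Ma na]].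
- exists (kmor a); split.
  + by rewrite -kmor_kpr pa.
  + by rewrite -kmor_kgr ja.
  + by rewrite -kmor_koszul; apply/kinE.
  + case=> b Mb; apply: na; have [b' Mb'] := kmor_lift b sur.
    exists b'; apply/kinE; rewrite raddfB /= kmor_koszul.
    have -> : kmor a - koszul (kmor b') =
        (kmor a - koszul b) + koszul (b - kmor b').
      by rewrite raddfB /= addrA subrK.
    by apply: kinD => //; apply: kin_koszul.
- have [a' Ma'] := kmor_lift a sur.
  (* An arbitrary lift is cut down to bidegree (p, j); as [M] is graded, it still lifts [a] modulo
     [M]. *)
  have Ma'' : kin M (a - kmor (kpr p (kgr j a'))).
    rewrite kmor_kpr kmor_kgr -{1}pa -{1}ja -!raddfB.
    by apply: kin_kpr => //; apply: kin_kgr.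
  exists (kpr p (kgr j a')); split.
  + by rewrite kpr_id.
  + by rewrite kgr_kpr kgr_id.
  + apply/kinE; rewrite kmor_koszul; set c := kmor _ in Ma'' *.
    have -> : koszul c = koszul a - koszul (a - c) by rewrite raddfB opprB addrC subrK.
    by apply: kinB => //; apply: kin_koszul.
  + case=> b /kinE; rewrite raddfB /= kmor_koszul => Mb; apply: na; exists (kmor b).
    set c := kmor (kpr _ _) in Ma'' Mb.
    have -> : a - koszul (kmor b) = (a - c) + (c - koszul (kmor b)) by rewrite addrA subrK.
    exact: kinD.
Qed.

(* Dimension shifting along 0 -> im phi -> W -> W / im phi -> 0. *)
Lemma knzj_shift p j :
  (forall q (c : {ffun {set 'I_n} -> W}), kpr q.+1 c = c -> koszul c = 0 ->
     exists b : {ffun {set 'I_n} -> W}, c = koszul b) ->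
  (forall v, exists u, phi v = \sum_i gx W i (u i)) ->
  knzj (range phi) p.+1 j <-> knzj [set v | phi v = 0] p j.
Proof.
move=> acyc mini.
have sM : subgmod (range phi).
  split; first by exists 0; rewrite ?raddf0.
  - by move=> _ _ [u _ <-] [v _ <-]; exists (u - v); rewrite ?raddfB.
  - by move=> i _ [u _ <-]; exists (gx V i u); rewrite ?phix.
have rangeP c : kin (range phi) c <-> exists a, c = kmor a.
  split=> [H|[a ->] T]; last by rewrite ffunE; exists (a T).
  have H' T : exists v, phi v = c T by have [v _ <-] := H T; exists v.
  exists [ffun T => projT1 (cid (H' T))]; apply/ffunP=> T.
  by rewrite !ffunE; case: cid.
have kerP a : kin [set v | phi v = 0] a <-> kmor a = 0.
  split=> [H|H T]; first by apply/ffunP=> T; rewrite !ffunE; apply: H.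
  by have := congr1 (fun f : {ffun _ -> _} => f T) H; rewrite !ffunE.
split=> -[a [pa ja Ma na]].
(* The connecting map: the boundary of a cycle modulo the image comes from a chain of [V], which
   [phi] sends to a cycle. *)
- have [a' Ea'] := (rangeP _).1 Ma.
  have Ea : kmor (kpr p (kgr j a')) = koszul a.
    by rewrite kmor_kpr kmor_kgr -Ea' -koszul_kgr ja -koszul_kprS pa.
  exists (kpr p (kgr j a')); split.
  + by rewrite kpr_id.
  + by rewrite kgr_kpr kgr_id.
  + by apply/kerP; rewrite kmor_koszul Ea koszul_koszul.
  + case=> b /kerP; rewrite raddfB /= Ea kmor_koszul => /subr0_eq Eb.
    have [||c Ec] := acyc p (a - kpr p.+1 (kmor b)).
      by rewrite raddfB /= pa kpr_id.
      by rewrite raddfB /= koszul_kprS -Eb -koszul_kprS pa subrr.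
    apply: na; exists c; rewrite -Ec opprB addrC subrK.
    by apply: kin_kpr => //; apply/rangeP; exists b.
- have cyc : koszul (kmor a) = 0 by rewrite -kmor_koszul; apply/kerP.
  have [c0 Ec0] : exists c, kmor a = koszul c.
    (* Acyclicity covers positive degrees only. In degree 0 the image of [phi] consists of sums of
       x_i u_i, and such a sum is the boundary of the sum of the e_i u_i. *)
    case: p pa => [|p] pa; last by apply: (acyc p) => //; rewrite -kmor_kpr pa.
    have [u Eu] := mini (a finset.set0).
    pose e (w : W) : {ffun {set 'I_n} -> W} := [ffun T : {set 'I_n} => if #|T| == 0 then w else 0].
    have e0 w : kpr 0 (e w) = e w.
      by apply/ffunP=> T; rewrite !ffunE; case: (_ == _).
    have ek w : koszul (e w) = 0 by rewrite -e0 koszul_kpr0.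
    exists (\sum_i cre i (e (u i))).
    have -> : kmor a = e (phi (a finset.set0)).
      rewrite -pa kmor_kpr; apply/ffunP=> T; rewrite !ffunE; case: eqP => // /cards0_eq ->.
      by rewrite cards0 eqxx.
    rewrite Eu raddf_sum; apply/ffunP=> T; rewrite ffunE sum_ffunE.
    transitivity (\sum_i kmap (gx W i) (e (u i)) T); last first.
      by apply: eq_bigr => i _ /=; rewrite -koszul_cre ek raddf0 addr0.
    case: ifP => T0; last by rewrite big1 // => i _; rewrite !ffunE T0 raddf0.
    by apply: eq_bigr => i _; rewrite !ffunE T0.
  have Ec : koszul (kpr p.+1 (kgr j c0)) = kmor a.
    by rewrite koszul_kprS koszul_kgr -Ec0 -kmor_kgr ja -kmor_kpr pa.
  exists (kpr p.+1 (kgr j c0)); split.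
  + by rewrite kpr_id.
  + by rewrite kgr_kpr kgr_id.
  + by apply/rangeP; exists a; rewrite Ec.
  + case=> b /rangeP[d' Ed]; apply: na; exists d'; apply/kerP.
    rewrite raddfB /= kmor_koszul -Ed -Ec [X in _ - X]raddfB /= koszul_koszul.
    by rewrite subr0 subrr.
Qed.

End Morphism.

(** As [M] lies in the sum of the x_i V, H_0 of V/M is V modulo that sum and forgets [M]. *)
Lemma knzj0 (V : gmod n) (M : set V) j : subgmod M ->
  (forall v, M v -> exists u, v = \sum_i gx V i (u i)) ->
  knzj M 0 j <-> exists v, gpi V j v = v /\ ~ exists u, v = \sum_i gx V i (u i).
Proof.
move=> sM mini; have M0 : M 0 by case: sM.
have koszul0 b : koszul b finset.set0 = \sum_i gx V i (b [set i]%SET).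
  rewrite koszulE; apply: eq_bigr => i _; rewrite finset.in_set0 finset.setU0.
  rewrite /osign; have -> : [set l in (finset.set0 : {set 'I_n}) | (l < i)%N]%SET = finset.set0.
    by apply/setP=> l; rewrite !inE.
  by rewrite cards0.
have sumD (w1 w2 : V) : (exists u, w1 = \sum_i gx V i (u i)) ->
    (exists u, w2 = \sum_i gx V i (u i)) -> exists u, w1 + w2 = \sum_i gx V i (u i).
  move=> [u1 ->] [u2 ->]; exists (fun i => u1 i + u2 i).
  by rewrite -big_split; apply: eq_bigr => i _; rewrite raddfD.
split=> [[a [pa ja Ma na]]|[v [jv nv]]].
- exists (a finset.set0); split.
    by rewrite -{2}ja ffunE cards0 leq0n subn0.
  case=> u Eu; apply: na.
  pose b : {ffun {set 'I_n} -> V} := [ffun T => if [pick i | T == [set i]%SET] is Some i then u i else 0].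
  exists (kpr 1 b) => T; rewrite !ffunE koszul_kprS -pa !ffunE.
  case: eqP => [/cards0_eq ->|_]; last by rewrite subr0.
  rewrite koszul0 Eu -sumrB big1 // => i _; rewrite ffunE.
  case: pickP => [j' /eqP/set1_inj ->|/(_ i)]; first by rewrite subrr.
  by rewrite eqxx.
- exists [ffun T : {set 'I_n} => if #|T| == 0 then v else 0]; split.
  + by apply/ffunP=> T; rewrite !ffunE; case: (_ == _).
  + apply/ffunP=> T; rewrite !ffunE; case: eqP => [->|_]; first by rewrite subn0.
    by rewrite raddf0 if_same.
  + set a := [ffun _ => _]; suff -> : a = kpr 0 a by rewrite koszul_kpr0; apply: kin0.
    by apply/ffunP=> T; rewrite !ffunE; case: (_ == _).
  + case=> b /(_ finset.set0); rewrite !ffunE cards0 eqxx koszul0 => /mini H; apply: nv.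
    rewrite -[v](subrK (\sum_i gx V i (b [set i]%SET))); apply: sumD => //.
    by exists (fun i => b [set i]%SET).
Qed.

End KoszulHomology.

Section LinearExtension.
Variables (k : fieldType) (n : nat) (W : lmodType k).
Implicit Types (g : 'X_{1..n} -> W) (p : {mpoly k[n]}).

Definition lext g p : W := \sum_(m <- msupp p) p@_m *: g m.

Lemma lextE g p N : (msize p <= N)%N ->
  lext g p = \sum_(m : 'X_{1..n < N}) p@_m *: g m.
Proof.
move=> le_pN; pose I : subFinType _ := 'X_{1..n < N}.
rewrite /lext (big_mksub I) /=; first last.
- by move=> x /msize_mdeg_lt/leq_trans/(_ le_pN).
- by rewrite msupp_uniq.
by rewrite big_rmcond //= => j /memN_msupp_eq0 ->; rewrite scale0r.
Qed.

Lemma lext_linear g : linear (lext g).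
Proof.
move=> c p q; pose N := maxn (msize (c *: p + q)) (maxn (msize p) (msize q)).
rewrite !(@lextE _ _ N) ?leq_max ?leqnn ?orbT // scaler_sumr -big_split /=.
by apply: eq_bigr => m _; rewrite mcoeffD mcoeffZ scalerDl scalerA.
Qed.
HB.instance Definition _ g := GRing.isLinear.Build _ _ _ _ (lext g) (lext_linear g).

Lemma lextX g m : lext g 'X_[m] = g m.
Proof. by rewrite /lext msuppX big_seq1 mcoeffX eqxx scale1r. Qed.

Lemma linear_mpoly_eq (f g : {linear {mpoly k[n]} -> W}) :
  (forall m, f 'X_[m] = g 'X_[m]) -> f =1 g.
Proof.
move=> fg p; rewrite [p]mpolyE !linear_sum; apply: eq_bigr => m _.
by rewrite !linearZ /= fg.
Qed.

End LinearExtension.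

(** * Contracting homotopies of the polynomial Koszul complex *)

Section PolynomialOperators.
Variables (k : fieldType) (n : nat).
Local Notation S := {mpoly k[n]}.
Local Notation KS := {ffun {set 'I_n} -> S}.
Implicit Types (p q : S) (m : 'X_{1..n}) (i j : 'I_n).

Definition mulX i p : S := 'X_i * p.

Lemma mulX_linear i : linear (mulX i).
Proof. by move=> c p q; rewrite /mulX mulrDr scalerAr. Qed.
HB.instance Definition _ i := GRing.isLinear.Build _ _ _ _ (mulX i) (mulX_linear i).

Lemma mcoeff_pihomog a p m :
  (pihomog mdeg a p)@_m = if mdeg m == a then p@_m else 0.
Proof.
have E := congr1 (mcoeff m) (mpolyE p); rewrite raddf_sum /= in E.
rewrite pihomogE raddf_sum /= big_mkcond /= E.
case: ifP => [/eqP mj|mj]; [apply: eq_bigr => m' _|rewrite big1 // => m' _].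
  case: ifP => // m'j; rewrite mcoeffZ mcoeffX.
  case: (eqVneq m' m) => [mm|_]; rewrite ?mulr0 //.
  by rewrite mm mj eqxx in m'j.
case: ifP => // m'j; rewrite mcoeffZ mcoeffX.
case: (eqVneq m' m) => [mm|_]; rewrite ?mulr0 //.
by rewrite -mm m'j in mj.
Qed.

Lemma pihomogXS a i p : pihomog mdeg a.+1 ('X_i * p) = 'X_i * pihomog mdeg a p.
Proof.
have H := @linear_mpoly_eq k n _ (pihomog mdeg a.+1 \o (mulX i))
  ((mulX i) \o pihomog mdeg a).
apply: H => m; rewrite /= /mulX -mpolyXD !pihomogX /= mdegD mdeg1 add1n eqSS.
by case: ifP => _; rewrite ?mpolyXD ?mulr0.
Qed.

Lemma pihomogX0 i p : pihomog mdeg 0 ('X_i * p) = 0.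
Proof.
apply/mpolyP=> m; rewrite mcoeff_pihomog mcoeff0; case: ifP => //.
rewrite mdeg_eq0 => /eqP ->; rewrite mcoeffM big1 // => -[m1 m2] /=.
rewrite eq_sym mnmD_eq0 => /andP[/eqP -> _].
by rewrite mcoeffX mnm1_eq0 mul0r.
Qed.

Lemma pihomog_sumE p N : (msize p <= N)%N -> p = \sum_(a < N) pihomog mdeg a p.
Proof. exact: pihomog_partitionE. Qed.

Lemma mulXC i j p : 'X_i * ('X_j * p) = 'X_j * ('X_i * p) :> S.
Proof. by rewrite mulrCA. Qed.

Definition polg : gmod n.
refine (@GMod n S (fun i => (mulX i)) (fun a => pihomog mdeg a)
  mulXC _ _ _ _).
- exact: pihomogXS.
- exact: pihomogX0.
- by move=> a v; apply: pihomog_id.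
- by move=> v; exists (msize v) => N; apply: pihomog_sumE.
Defined.

(** Typed over polynomials, where the scalar structure forgotten by [gmod] is available. *)
Definition kos (a : KS) : KS := @koszul n polg a.

Lemma kosE a : kos a = \sum_i kmap (mulX i) (ann i a).
Proof. by []. Qed.

Lemma kos_linear : linear kos.
Proof.
move=> c a b; apply/ffunP=> T; rewrite !kosE !ffunE !sum_ffunE scaler_sumr -big_split /=.
apply: eq_bigr => i _; rewrite !ffunE /mulX; case: ifP => _.
  by rewrite mulr0 scaler0 addr0.
by rewrite scalerAr -mulrDr /csign; case: osign; rewrite // scalerN opprD.
Qed.
HB.instance Definition _ := GRing.isLinear.Build _ _ _ _ kos kos_linear.

Definition xdiv i : S -> S := lext (fun m => if (0 < m i)%N then 'X_[m - U_(i)] else 0).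
HB.instance Definition _ i := GRing.Linear.on (xdiv i).

Definition xnil i : S -> S := lext (fun m => if (0 < m i)%N then 0 else 'X_[m]).
HB.instance Definition _ i := GRing.Linear.on (xnil i).

Lemma xdivX i m : xdiv i 'X_[m] = if (0 < m i)%N then 'X_[m - U_(i)] else 0.
Proof. exact: lextX. Qed.

Lemma xnilX i m : xnil i 'X_[m] = if (0 < m i)%N then 0 else 'X_[m].
Proof. exact: lextX. Qed.

Lemma mcoeff_xnil i p m : (xnil i p)@_m = if (0 < m i)%N then 0 else p@_m.
Proof.
rewrite [p]mpolyE [xnil i _]linear_sum !raddf_sum /=; case: ifP => mi.
  rewrite big1 // => m' _; rewrite linearZ /= xnilX mcoeffZ.
  case: ifP => m'i; rewrite ?mcoeff0 ?mulr0 // mcoeffX.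
  by case: eqP m'i => [->|_ _]; rewrite ?mi ?mulr0.
apply: eq_bigr => m' _; rewrite linearZ /= xnilX !mcoeffZ.
case: ifP => m'i; rewrite // mcoeff0 mcoeffX.
by case: eqP m'i => [->|_ _]; rewrite ?mi // mulr0.
Qed.

Lemma mulX_xdiv i p : mulX i (xdiv i p) = p - xnil i p.
Proof.
have H := @linear_mpoly_eq k n _ ((mulX i) \o xdiv i) (idfun \- xnil i).
apply: H => m; rewrite /= /mulX xdivX xnilX; case: ifP => mi; last by rewrite mulr0 subrr.
by rewrite -mpolyXD addmC submK ?subr0 // lep1mP -lt0n.
Qed.

Lemma xdiv_mulX i p : xdiv i (mulX i p) = p.
Proof.
have H := @linear_mpoly_eq k n _ (xdiv i \o (mulX i)) idfun.
apply: H => m; rewrite /= /mulX -mpolyXD xdivX mnmDE mnm1E eqxx add1n /=.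
by rewrite addmC addmK.
Qed.

Lemma xdiv_mulXC i j p : i != j -> xdiv i (mulX j p) = mulX j (xdiv i p).
Proof.
move=> ij; have H := @linear_mpoly_eq k n _ (xdiv i \o (mulX j)) ((mulX j) \o xdiv i).
apply: H => m; rewrite /= /mulX -mpolyXD !xdivX mnmDE mnm1E eq_sym (negbTE ij) add0n.
case: ifP => mi; rewrite ?mulr0 // -mpolyXD addmBA //.
by rewrite lep1mP -lt0n.
Qed.

Lemma kmap_comp (f g : S -> S) (a : KS) : kmap f (kmap g a) = kmap (f \o g) a.
Proof. by apply/ffunP=> T; rewrite !ffunE. Qed.

Lemma eq_kmap (f g : S -> S) (a : KS) : f =1 g -> kmap f a = kmap g a.
Proof. by move=> fg; apply/ffunP=> T; rewrite !ffunE fg. Qed.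

Definition xhom i (a : KS) : KS := kmap (xdiv i) (cre i a).

Definition xproj i (a : KS) : KS :=
  [ffun T : {set 'I_n} => if i \in T then 0 else xnil i (a T)].

Lemma xhom_linear i : linear (xhom i).
Proof.
move=> c a b; apply/ffunP=> T; rewrite !ffunE; case: ifP => _.
  by rewrite -linearP; congr (xdiv i _); rewrite /csign; case: osign; rewrite // opprD scalerN.
by rewrite !raddf0 ?scaler0 ?addr0.
Qed.
HB.instance Definition _ i := GRing.isLinear.Build _ _ _ _ (xhom i) (xhom_linear i).

Lemma xproj_linear i : linear (xproj i).
Proof.
move=> c a b; apply/ffunP=> T; rewrite !ffunE; case: ifP => _.
  by rewrite scaler0 addr0.
by rewrite linearP.
Qed.
HB.instance Definition _ i := GRing.isLinear.Build _ _ _ _ (xproj i) (xproj_linear i).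

(** The Koszul complex is a tensor product of complexes in one variable, and [xhom i] contracts the
    i-th factor onto its constants. The terms with j different from i cancel by anticommutation,
    since division by x_i commutes with multiplication by x_j. *)
Lemma xhomP i a : kos (xhom i a) + xhom i (kos a) = a - xproj i a.
Proof.
rewrite !kosE /xhom (raddf_sum (cre i)) (raddf_sum (kmap (xdiv i))) -big_split /=.
rewrite (bigD1 i) //= big1 ?addr0 => [|j ji]; last first.
  rewrite ann_kmap cre_kmap !kmap_comp.
  rewrite [X in _ + X](eq_kmap (g := (mulX j) \o xdiv i)); last first.
    by move=> p /=; rewrite xdiv_mulXC // eq_sym.
  by rewrite -[LHS](raddfD (kmap (mulX j \o xdiv i))) addrC cre_ann eq_sym (negbTE ji) !raddf0.
rewrite ann_kmap cre_kmap !kmap_comp.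
apply/ffunP=> T; rewrite ffunE [X in X + _]ffunE [X in _ + X]ffunE [RHS]ffunE /=.
rewrite xdiv_mulX mulX_xdiv ann_creE cre_annE !ffunE.
by case: (i \in T); rewrite ?raddf0 ?subr0 ?add0r ?oppr0 ?addr0.
Qed.

(* On a monomial multidegree this homotopy divides by the first variable that
   occurs in it. *)
Fixpoint mhom (s : seq 'I_n) (a : KS) : KS :=
  if s is i :: s' then xhom i a + mhom s' (xproj i a) else 0.

Fixpoint mproj (s : seq 'I_n) (a : KS) : KS :=
  if s is i :: s' then mproj s' (xproj i a) else a.

Lemma mhom_linear s : linear (mhom s).
Proof.
elim: s => [|i s IH] c a b /=; first by rewrite scaler0 addr0.
by rewrite linearP [xproj i _]linearP IH scalerDr addrACA.
Qed.
HB.instance Definition _ s := GRing.isLinear.Build _ _ _ _ (mhom s) (mhom_linear s).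

Lemma kos_xproj i a : kos (xproj i a) = xproj i (kos a).
Proof.
have kk b : kos (kos b) = 0 by exact: (@koszul_koszul n polg b).
have E b : xproj i b = b - (kos (xhom i b) + xhom i (kos b)) by rewrite xhomP opprB addrC subrK.
by rewrite !E raddfB raddfD /= !kk [xhom i 0]raddf0 add0r addr0.
Qed.

(** The contractions of the factors compose because each [xproj i] is a chain map. *)
Lemma mhomP s a : kos (mhom s a) + mhom s (kos a) = a - mproj s a.
Proof.
elim: s a => [|i s IH] a /=; first by rewrite raddf0 addr0 subrr.
by rewrite raddfD /= -kos_xproj addrACA xhomP IH addrA subrK.
Qed.

Lemma mprojE s a T m : (mproj s a T)@_m =
  if has (fun i => (i \in T) || (0 < m i)%N) s then 0 else (a T)@_m.
Proof.
elim: s a => [//|i s IH] a /=; rewrite IH ffunE; case: has; rewrite ?orbT ?orbF //.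
case: (i \in T) => /=; first by rewrite mcoeff0.
by rewrite mcoeff_xnil.
Qed.

(** What no homotopy removes: the constants in exterior degree 0, which are the whole homology of
    the complex. *)
Definition kconst (a : KS) : KS :=
  [ffun T : {set 'I_n} => if #|T| == 0 then (((a finset.set0)@_0%MM)%:MP) else 0].

Lemma kconst_mprojE a : mproj (enum 'I_n) a = kconst a.
Proof.
apply/ffunP=> T; apply/mpolyP=> m; rewrite mprojE ffunE.
case: eqP => [/cards0_eq ->|]; last first.
  move=> /eqP; rewrite cards_eq0 => /finset.set0Pn[i iT]; rewrite mcoeff0.
  by case: hasP => // -[]; exists i; rewrite ?mem_enum ?iT.
rewrite mcoeffC; case: eqP => [->|/eqP m0].
  rewrite mulr1; case: hasP => // -[i _]; by rewrite finset.in_set0 mnm0E.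
rewrite mulr0; case: hasP => // -[].
have [i mi] : exists i, (0 < m i)%N.
  apply: contrapT => nex; case/eqP: m0; apply/mnmP => i; rewrite mnm0E.
  by apply/eqP; rewrite eqn0Ngt; apply/negP => mi; apply: nex; exists i.
by exists i; rewrite ?mem_enum ?mi ?orbT.
Qed.

Lemma kos_acyclic (r : nat) (c : KS) : kpr r.+1 c = c -> kos c = 0 ->
  exists b : KS, c = kos b.
Proof.
move=> pc cc; exists (mhom (enum 'I_n) c).
have := mhomP (enum 'I_n) c; rewrite cc raddf0 addr0 kconst_mprojE => ->.
suff -> : kconst c = 0 by rewrite subr0.
by apply/ffunP=> T; rewrite !ffunE -pc ffunE cards0 /= mcoeff0 mpolyC0 if_same.
Qed.

(** In exterior degree 0 the homotopy formula writes p minus its constant term as a boundary, that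
    is, as a combination of the variables. *)
Lemma const0_sum p : p@_0%MM = 0 -> exists u : 'I_n -> S, p = \sum_i 'X_i * u i.
Proof.
move=> p0; pose c : KS := [ffun T : {set 'I_n} => if #|T| == 0 then p else 0].
have pc : kpr 0 c = c by apply/ffunP=> T; rewrite !ffunE; case: (_ == _).
have := mhomP (enum 'I_n) c.
have -> : kos c = 0 by rewrite -pc; exact: (@koszul_kpr0 n polg c).
rewrite raddf0 addr0 kconst_mprojE => /(congr1 (fun f : KS => f finset.set0)).
rewrite !ffunE !cards0 !eqxx p0 mpolyC0 subr0 => <-.
by rewrite kosE sum_ffunE; eexists => /=; apply: eq_bigr => i _; rewrite ffunE; reflexivity.
Qed.

End PolynomialOperators.

(** * Minimal free resolutions *)

Section Dickson.

(** The next index is always one where [v] is minimal among all later values. *)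
Lemma nat_nondecreasing_subseq (v : nat -> nat) : exists h : nat -> nat,
  (forall i j, (i < j)%N -> (h i < h j)%N) /\
  (forall i j, (i < j)%N -> (v (h i) <= v (h j))%N).
Proof.
have H i : exists j, (i <= j)%N /\ forall l, (i <= l)%N -> (v j <= v l)%N.
  have ex : exists a, `[< exists2 j, (i <= j)%N & v j = a >].
    by exists (v i); apply/asboolP; exists i.
  have [a /asboolP[j ij va] mina] := ex_minnP ex.
  by exists j; split=> // l il; rewrite va; apply: mina; apply/asboolP; exists l.
pose nx i := projT1 (cid (H i)).
have nx1 i : (i <= nx i)%N by rewrite /nx; case: cid => j [].
have nx2 i l : (i <= l)%N -> (v (nx i) <= v l)%N by rewrite /nx; case: cid => j /= [_ jm] il; apply: jm.
pose h := fix h i := if i is i'.+1 then nx (h i').+1 else nx 0.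
have hS i : (h i < h i.+1)%N by apply: nx1.
have hm i j : (i < j)%N -> (h i < h j)%N.
  elim: j => [//|j IH]; rewrite ltnS leq_eqVlt => /orP[/eqP ->|/IH ij]; first exact: hS.
  exact: ltn_trans ij (hS j).
exists h; split=> // i j /hm; case: i => [|i] /= hij; apply: nx2 => //.
exact: leq_trans (nx1 _) (ltnW hij).
Qed.

(** Subsequences are extracted one coordinate at a time; each extraction preserves the monotonicity
    already reached. *)
Lemma dickson n (u : nat -> 'X_{1..n}) : exists i j, (i < j)%N /\ (u i <= u j)%MM.
Proof.
have H (s : seq 'I_n) : exists g : nat -> nat,
    (forall i j, (i < j)%N -> (g i < g j)%N) /\
    (forall c, c \in s -> forall i j, (i < j)%N -> (u (g i) c <= u (g j) c)%N).
  elim: s => [|c s [g [gm gs]]]; first by exists id.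
  have [h [hm hv]] := nat_nondecreasing_subseq (fun i => u (g i) c).
  exists (g \o h); split=> [i j ij|c']; first by apply: gm; apply: hm.
  by rewrite inE => /orP[/eqP ->|cs] i j ij /=; [apply: hv|apply: gs => //; apply: hm].
have [g [gm gs]] := H (enum 'I_n).
exists (g 0), (g 1); split; first exact: gm.
by apply/mnm_lepP => c; apply: gs; rewrite ?mem_enum.
Qed.

End Dickson.

(** * Finite generation of submodules *)

Section LinearCombinations.
Variables (S : comNzRingType) (V : lmodType S).
Implicit Types (s t : seq V) (v w : V).

Definition is_submodule (M : set V) : Prop :=
  [/\ M 0, forall u v, M u -> M v -> M (u + v) & forall c u, M u -> M (c *: u)].

Fixpoint lcomb s : set V :=
  if s is x :: s' then [set v | exists c w, lcomb s' w /\ v = c *: x + w]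
  else [set v | v = 0].

Lemma lcomb_submodule s : is_submodule (lcomb s).
Proof.
elim: s => [|x s [IH0 IHD IHZ]] /=.
  split=> // [u v -> ->|c u ->] /=; rewrite ?addr0 //; exact: scaler0.
split; first by exists 0, 0; rewrite scale0r addr0.
- move=> _ _ [c [w [sw ->]]] [c' [w' [sw' ->]]].
  by exists (c + c'), (w + w'); split; [apply: IHD|rewrite scalerDl addrACA].
- move=> a _ [c [w [sw ->]]].
  by exists (a * c), (a *: w); split; [apply: IHZ|rewrite scalerDr scalerA].
Qed.

Lemma lcomb_mem s v : v \in s -> lcomb s v.
Proof.
elim: s => [//|x s IH]; rewrite inE => /orP[/eqP ->|/IH sv] /=.
  exists 1, 0; rewrite scale1r addr0; split=> //.
  by case: (lcomb_submodule s).
by exists 0, v; rewrite scale0r add0r.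
Qed.

Lemma lcomb_min (M : set V) s : is_submodule M -> (forall v, v \in s -> M v) ->
  lcomb s `<=` M.
Proof.
move=> [M0 MD MZ]; elim: s => [_ v ->//|x s IH Ms v [c [w [sw ->]]]].
apply: MD; first by apply: MZ; apply: Ms; rewrite inE eqxx.
by apply: IH sw => u us; apply: Ms; rewrite inE us orbT.
Qed.

Lemma submodule_sum (M : set V) (I : Type) (r : seq I) (P : pred I) (F : I -> V) :
  is_submodule M -> (forall i, P i -> M (F i)) -> M (\sum_(i <- r | P i) F i).
Proof. by case=> M0 MD _ MF; elim/big_ind: _ => //; apply: MD. Qed.

Lemma lcombP s v : lcomb s v <-> exists c : nat -> S, v = \sum_(i < size s) c i *: s`_i.
Proof.
split.
  elim: s v => [|x s IH] v /=; first by move=> ->; exists (fun=> 0); rewrite big_ord0.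
  case=> c [w [/IH[c' ->] ->]]; exists (fun i => if i is i'.+1 then c' i' else c).
  by rewrite big_ord_recl.
case=> c ->; apply: submodule_sum; first exact: lcomb_submodule.
move=> i _; have [_ _ LZ] := lcomb_submodule s; apply: LZ.
by apply: lcomb_mem; apply: mem_nth.
Qed.

Definition fin_gen (M : set V) : Prop :=
  exists s, (forall v, v \in s -> M v) /\ M `<=` lcomb s.

End LinearCombinations.

Section Hilbert.
Variables (k : fieldType) (n : nat).
Local Notation S := {mpoly k[n]}.

(* Successively choosing elements of minimal leading monomial outside the ideal
   generated so far gives leading monomials none of which divides a later one. *)
Lemma hilbert_basis (M : set S^o) : is_submodule M -> fin_gen M.
Proof.
move=> sM; have [M0 MD MZ] := sM; apply: contrapT => nfg.
(* The condition on s stands inside the existential so that the choice function [ch] is total. *)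
have H (s : seq S^o) : exists f : S, (forall v, v \in s -> M v) ->
    [/\ M f, ~ lcomb s f & forall g : S, M g -> ~ lcomb s g -> ~ (mlead g < mlead f)%O].
  have [sM'|nsM] := pselect (forall v, v \in s -> M v); last by exists 0 => /nsM.
  have [f0 [Mf0 nf0]] : exists f, M f /\ ~ lcomb s f.
    apply: contrapT => nf; apply: nfg; exists s; split=> // v Mv.
    by apply: contrapT => nv; apply: nf; exists v.
  apply: contrapT => nex.
  suff A (m : 'X_{1..n}) (f : S) : mlead f = m -> M f -> ~ lcomb s f -> False by apply: (A _ f0 erefl).
  elim/(@ltmwf n): m f => m IH f mf Mf nf; apply: nex; exists f => _; split=> // g Mg ng lt.
  by apply: (IH (mlead g) _ g erefl Mg ng); rewrite -mf.
pose ch s := projT1 (cid (H s)).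
pose sq := fix sq i := if i is i'.+1 then ch (sq i') :: sq i' else [::].
have chE s : (forall v, v \in s -> M v) ->
    [/\ M (ch s), ~ lcomb s (ch s) &
        forall g : S, M g -> ~ lcomb s g -> ~ (mlead g < mlead (ch s : S))%O].
  by rewrite /ch; case: cid.
have chP i : (forall v, v \in sq i -> M v) /\ M (ch (sq i)).
  elim: i => [|i [IH1 IH2]].
    have s0 v : v \in sq 0 -> M v by rewrite in_nil.
    by split=> //; have [] := chE _ s0.
  have s1 v : v \in sq i.+1 -> M v.
    by rewrite /= inE => /orP[/eqP ->|/IH1].
  by split=> //; have [] := chE _ s1.
have ch1 i : ~ lcomb (sq i) (ch (sq i)).
  by have [Hs _] := chP i; have [] := chE _ Hs.
have ch2 i g : M g -> ~ lcomb (sq i) g -> ~ (mlead (g : S) < mlead (ch (sq i) : S))%O.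
  by have [Hs _] := chP i; have [_ _] := chE _ Hs; apply.
have sq_sub i j : (i < j)%N -> ch (sq i) \in sq j.
  elim: j => [//|j IH]; rewrite ltnS leq_eqVlt /= inE => /orP[/eqP ->|/IH ->].
    by rewrite eqxx.
  by rewrite orbT.
have [i [j [ij le_ij]]] := dickson (fun i => mlead (ch (sq i) : S)).
set f := ch (sq j) in le_ij; set g := ch (sq i) in le_ij.
have nz l : ch (sq l) != 0.
  apply/eqP => z; apply: (ch1 l); rewrite z.
  by case: (lcomb_submodule (sq l)).
(* Subtracting [c * g] cancels the leading term of [f]. The remainder is still outside the ideal
   generated before [f], yet its leading monomial is smaller, against the choice of [f]. *)
pose c : S := (mleadc f / mleadc g) *: 'X_[mlead f - mlead g].
have [L0 LD LZ] := lcomb_submodule (sq j).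
have sg : lcomb (sq j) (c * g) by apply: LZ; apply: lcomb_mem; apply: sq_sub.
pose h : S := f - c * g.
have nh : ~ lcomb (sq j) h.
  move=> sh; apply: (ch1 j); rewrite -/f -[f](subrK (c * g)).
  exact: LD.
have Mh : M h.
  apply: MD; first exact: (chP j).2.
  by rewrite -mulNr; apply: MZ; exact: (chP i).2.
apply: (ch2 j h Mh nh); rewrite -/f.
have h0 : h != 0 by apply/eqP => z; apply: nh; rewrite z.
have lg : mleadc g != 0 by rewrite mleadc_eq0 nz.
have lf : mleadc f != 0 by rewrite mleadc_eq0 nz.
have c0 : mleadc f / mleadc g != 0 by rewrite mulf_neq0 ?invr_neq0.
have lcg : mlead (c * g) = mlead f.
  by rewrite /c -scalerAl mleadZ // mleadM ?nz ?mleadXm ?submK // -msize_poly_eq0 msizeX.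
have hf : h@_(mlead f) = 0.
  have E : ('X_[mlead f - mlead g] * g)@_(mlead f) = mleadc g.
    by rewrite mulrC -[X in mcoeff X _](submK le_ij) mcoeffMX.
  by rewrite /h mcoeffB /c -scalerAl mcoeffZ E divfK ?subrr.
rewrite lt_neqAle; apply/andP; split.
  by apply/eqP => E; move: h0; rewrite -mleadc_eq0 E hf eqxx.
by apply: le_trans (mleadB_le _ _) _; rewrite lcg joinxx.
Qed.

(** Induction on the number c of coordinates allowed to be nonzero. The last allowed coordinates
    form a finitely generated ideal; lifts of its generators reduce a vector to one with fewer
    coordinates. *)
Lemma submodule_rV_fin_gen r (M : set 'rV[S]_r) : is_submodule M -> fin_gen M.
Proof.
move=> sM; have [M0 MD MZ] := sM.
have H c : (c <= r)%N ->
    fin_gen (M `&` [set v | forall i : 'I_r, (c <= i)%N -> v 0 i = 0]).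
  elim: c => [_|c IH cr].
    exists [::]; split=> // v [_ v0] /=.
    by apply/rowP => i; rewrite mxE; apply: v0.
  have [s [sM' sG]] := IH (ltnW cr); pose ic := Ordinal cr.
  set Mc := M `&` _; pose J : set S^o := [set v 0 ic | v in Mc].
  have sJ : is_submodule J.
    split.
    - exists 0; rewrite ?mxE //; split=> // i _; by rewrite mxE.
    - move=> _ _ [u [Mu u0] <-] [v [Mv v0] <-]; exists (u + v); rewrite ?mxE //.
      by split=> [|i ci]; [apply: MD|rewrite mxE u0 ?v0 ?addr0].
    - move=> a _ [u [Mu u0] <-]; exists (a *: u); rewrite ?mxE //.
      by split=> [|i ci]; [apply: MZ|rewrite mxE u0 ?mulr0].
  have [t [tJ tG]] := hilbert_basis sJ.
  have lift (x : S^o) : exists v, x \in t -> Mc v /\ v 0 ic = x.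
    have [xt|nt] := boolP (x \in t); last by exists 0.
    by have [v Mv <-] := tJ x xt; exists v.
  pose l x := projT1 (cid (lift x)).
  have lP x : x \in t -> Mc (l x) /\ l x 0 ic = x by rewrite /l; case: cid.
  have lG t' x : {subset t' <= t} -> lcomb t' x ->
      exists v, lcomb (map l t') v /\ v 0 ic = x.
    elim: t' x => [|y t' IHt] x st' /=; first by move=> ->; exists 0; rewrite mxE.
    case=> c0 [w [tw ->]]; have [|v [lv <-]] := IHt w _ tw.
      by move=> z zt; apply: st'; rewrite inE zt orbT.
    exists (c0 *: l y + v); split; first by exists c0, v.
    by rewrite !mxE (lP y _).2 // st' // inE eqxx.
  have Mcl v : lcomb (map l t) v -> M v /\ forall i : 'I_r, (c.+1 <= i)%N -> v 0 i = 0.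
    apply: (@lcomb_min _ _ Mc); first split.
    - by split=> // i _; rewrite mxE.
    - move=> u w [Mu u0] [Mw w0]; split; first exact: MD.
      by move=> i ci; rewrite mxE u0 ?w0 ?addr0.
    - move=> a u [Mu u0]; split; first exact: MZ.
      by move=> i ci; rewrite mxE u0 ?mulr0.
    - by move=> w /mapP[x xt ->]; have [] := lP x xt.
  exists (s ++ map l t); split.
    move=> v; rewrite mem_cat => /orP[/sM'[Mv v0]|/lcomb_mem/Mcl //].
    by split=> // i ci; apply: v0; apply: ltnW.
  move=> v Mv; have tv : lcomb t (v 0 ic) by apply: tG; exists v.
  have [w [lw wc]] := lG t _ (fun x xt => xt) tv.
  have sub1 : lcomb s `<=` lcomb (s ++ map l t).
    apply: lcomb_min; first exact: lcomb_submodule.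
    by move=> x xs; apply: lcomb_mem; rewrite mem_cat xs.
  have sub2 : lcomb (map l t) `<=` lcomb (s ++ map l t).
    apply: lcomb_min; first exact: lcomb_submodule.
    by move=> x xs; apply: lcomb_mem; rewrite mem_cat xs orbT.
  have [_ LD _] := lcomb_submodule (s ++ map l t).
  rewrite -[v](subrK w); apply: LD; last exact: sub2.
  apply/sub1/sG; have [Mw w0] := Mcl w lw; case: Mv => Mv v0; split.
    by apply: MD => //; rewrite -scaleN1r; apply: MZ.
  move=> i; rewrite leq_eqVlt => /orP[/eqP ci|ci]; last first.
    by rewrite !mxE v0 ?w0 ?subrr.
  have -> : i = ic by apply: val_inj.
  by rewrite !mxE wc subrr.
have [s [sM' sG]] := H r (leqnn r).
exists s; split=> [v /sM'[] //|v Mv]; apply: sG; split=> // i.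
by rewrite leqNgt ltn_ord.
Qed.

End Hilbert.

(** * Graded free modules and minimal generators *)

Section GradedFree.
Variables (k : fieldType) (n : nat).
Local Notation S := {mpoly k[n]}.

Lemma pihomogM_homog a b (p q : S) : pihomog mdeg b q = q ->
  pihomog mdeg a (p * q) = if (b <= a)%N then pihomog mdeg (a - b) p * q else 0.
Proof.
move=> bq; have qh : q \is b.-homog by rewrite homog_piE bq.
rewrite [p]mpolyE mulr_suml !linear_sum mulr_suml.
transitivity (\sum_(m <- msupp p) if (b <= a)%N then
    pihomog mdeg (a - b) (p@_m *: 'X_[m]) * q else 0); last first.
  by case: ifP => _ //; rewrite big1.
apply: eq_bigr => m _; rewrite -scalerAl !linearZ /= -scalerAl pihomogX /=.
have mq : 'X_[m] * q \is (mdeg m + b).-homog by apply: dhomogM; rewrite ?dhomogX.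
case: (eqVneq (mdeg m + b)%N a) => [<-|ne].
  by rewrite leq_addl addnK eqxx pihomog_dE.
rewrite (pihomog_ne0 ne mq) scaler0.
case: ifP => // ba; rewrite (_ : (mdeg m == a - b)%N = false) ?mul0r ?scaler0 //.
by apply/eqP => E; move/eqP: ne; apply; rewrite E subnK.
Qed.

Section FreeModule.
Variables (r : nat) (sh : 'I_r -> nat).
Implicit Types (v w : 'rV[S]_r).

(** The degree a part of the direct sum of the S(- sh c). *)
Definition vgr (a : nat) v : 'rV[S]_r :=
  \row_c (if (sh c <= a)%N then pihomog mdeg (a - sh c) (v 0 c) else 0).

Lemma vgr_additive a : additive (vgr a).
Proof.
by move=> u v; apply/rowP => c; rewrite !mxE; case: ifP; rewrite ?subrr // raddfB.
Qed.
HB.instance Definition _ a := GRing.isAdditive.Build _ _ (vgr a) (vgr_additive a).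

Definition vmulX (i : 'I_n) v : 'rV[S]_r := 'X_i *: v.

Lemma vmulX_additive i : additive (vmulX i).
Proof. by move=> u v; rewrite /vmulX scalerBr. Qed.
HB.instance Definition _ i := GRing.isAdditive.Build _ _ (vmulX i) (vmulX_additive i).

Definition freeg : gmod n.
refine (@GMod n 'rV[S]_r (fun i => vmulX i) (fun a => vgr a) _ _ _ _ _).
- by move=> i j v; rewrite /= /vmulX !scalerA mulrC.
- move=> a i v; apply/rowP => c; rewrite !mxE.
  case: (ltngtP (sh c) a.+1) => [|lt|->]; last 1 first.
  + by rewrite subnn pihomogX0 ltnn mulr0.
  + by rewrite ltnS => le; rewrite le subSn // pihomogXS.
  + by rewrite leqNgt (ltn_trans _ lt) // mulr0.
- move=> i v; apply/rowP => c; rewrite !mxE.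
  by case: ifP => //; rewrite leqn0 => /eqP ->; rewrite pihomogX0.
- move=> a v; apply/rowP => c; rewrite !mxE.
  by case: (_ <= _)%N; rewrite ?pihomog_id.
- move=> v; exists (\max_c (sh c + msize (v 0%R c)))%N => N leN; apply/rowP => c.
  rewrite summxE; have leN' : (sh c + msize (v 0%R c) <= N)%N.
    by apply: leq_trans leN; apply: (leq_bigmax (F := fun c => sh c + msize (v 0%R c))%N).
  rewrite (@pihomog_sumE k n (v 0 c) (N - sh c)%N); last by lia.
  rewrite -(big_mkord xpredT (fun a => vgr a v 0 c)).
  have lcN : (sh c <= N)%N by lia.
  rewrite (big_cat_nat (leq0n _) lcN) /= big_nat [X in X + _]big1 => [|l /andP[_ lT]]; last first.
    by rewrite mxE leqNgt lT.
  rewrite add0r -[in X in _ = X](add0n (sh c)) big_addn big_mkord; apply: eq_bigr => a _.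
  by rewrite mxE leq_addl addnK.
Defined.

Lemma freeg_sum (u : 'I_n -> freeg) c :
  (\sum_i gx freeg i (u i)) 0 c = \sum_i 'X_i * (u i 0 c).
Proof. by rewrite summxE; apply: eq_bigr => i _; rewrite mxE. Qed.

Lemma freeg_in_max v : (forall c, irrelevant_ideal (v 0 c)) <->
  exists u : 'I_n -> freeg, v = \sum_i gx freeg i (u i).
Proof.
split=> [H|[u ->] c].
  have H' c : exists u : 'I_n -> S, v 0 c = \sum_i 'X_i * u i by apply: const0_sum; apply: H.
  exists (fun i => \row_c projT1 (cid (H' c)) i); apply/rowP => c.
  rewrite freeg_sum; under eq_bigr do rewrite mxE.
  by case: cid.
rewrite /irrelevant_ideal /= freeg_sum raddf_sum big1 // => i _ /=.
have /mpolyP/(_ 0%MM) := @pihomogX0 k n i (u i 0 c).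
by rewrite mcoeff_pihomog mdeg0 eqxx mcoeff0.
Qed.

Lemma freeg_acyclic (q : nat) (c : {ffun {set 'I_n} -> freeg}) :
  kpr q.+1 c = c -> koszul c = 0 -> exists b : {ffun {set 'I_n} -> freeg}, c = koszul b.
Proof.
move=> pc cc; pose col l : {ffun {set 'I_n} -> S} := [ffun T => c T 0 l].
have H l : exists b : {ffun {set 'I_n} -> S}, col l = kos b.
  apply: (@kos_acyclic _ _ q).
    by apply/ffunP=> T; rewrite !ffunE -[in RHS]pc ffunE; case: (_ == _); rewrite // mxE.
  apply/ffunP=> T.
  have := @koszulE n freeg c T; rewrite cc ffunE => /esym E0.
  have := congr1 (fun v : 'rV[S]_r => v 0 l) E0.
  rewrite summxE mxE => E; rewrite ffunE -[RHS]E /kos (@koszulE n (polg k n)).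
  apply: eq_bigr => i _; case: ifP => _; first by rewrite mxE.
  rewrite ffunE mxE; case: osign => //=; by rewrite /mulX mxE.
exists [ffun T => \row_l projT1 (cid (H l)) T].
apply/ffunP=> T; apply/rowP => l; rewrite (@koszulE n freeg) summxE.
transitivity (kos (projT1 (cid (H l))) T); first by case: cid => b /= <-; rewrite ffunE.
rewrite /kos (@koszulE n (polg k n)); apply: eq_bigr => i _; case: ifP => _; first by rewrite mxE.
by rewrite ffunE mxE; case: osign; rewrite /= /mulX ?mxE.
Qed.

End FreeModule.

Section GradedMaps.
Variables (r r' : nat) (sh : 'I_r -> nat) (sh' : 'I_r' -> nat).
Variable D : 'M[S]_(r', r).
Hypothesis Dh : forall i, vgr sh (sh' i) (row i D) = row i D.

Definition rmulmx (v : freeg sh') : freeg sh := v *m D.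

Lemma rmulmx_additive : additive rmulmx.
Proof. by move=> u v; rewrite /rmulmx mulmxBl. Qed.
HB.instance Definition _ := GRing.isAdditive.Build _ _ rmulmx rmulmx_additive.

Lemma rmulmx_x i v : rmulmx (gx (freeg sh') i v) = gx (freeg sh) i (rmulmx v).
Proof. by rewrite /rmulmx /= /vmulX scalemxAl. Qed.

Lemma rmulmx_pi a v : rmulmx (gpi (freeg sh') a v) = gpi (freeg sh) a (rmulmx v).
Proof.
rewrite /rmulmx !mulmx_sum_row raddf_sum; apply: eq_bigr => i _.
apply/rowP => c; rewrite !mxE.
have /rowP/(_ c) := Dh i; rewrite !mxE; case: ifP => ci Ec; last first.
  rewrite -Ec !mulr0; case: ifP => // _; by rewrite raddf0.
rewrite (pihomogM_homog _ _ Ec).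
case: (leqP (sh c) a) => ca; last first.
  case: leqP => ia; rewrite ?mul0r //.
  by have := leq_trans ci ia; rewrite leqNgt ca.
rewrite leq_sub2rE //; case: leqP => ia; rewrite ?mul0r //.
by congr (pihomog mdeg _ _ * _); lia.
Qed.

End GradedMaps.

(** Minimality is expressed by the syzygies, whose coefficients lie in the irrelevant ideal: this is
    the property [ss_min] required of the next syzygy module. *)
Record min_gens (r : nat) (sh : 'I_r -> nat) (M : set 'rV[S]_r) := MinGens {
  mg_rank : nat;
  mg_shift : 'I_mg_rank -> nat;
  mg_mx : 'M[S]_(mg_rank, r);
  mg_homog : forall i, vgr sh (mg_shift i) (row i mg_mx) = row i mg_mx;
  mg_image : forall v, M v <-> exists w, v = w *m mg_mx;
  mg_min : forall w : 'rV_mg_rank, w *m mg_mx = 0 -> forall c, irrelevant_ideal (w 0 c)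
}.

Lemma min_gens_exist (r : nat) (sh : 'I_r -> nat) (M : set 'rV[S]_r) :
  is_submodule M -> graded_sub (M : set (freeg sh)) -> inhabited (min_gens sh M).
Proof.
move=> sM gM; have [M0 MD MZ] := sM.
pose good (t : seq 'rV[S]_r) := [/\ forall v, v \in t -> exists a, vgr sh a v = v,
  forall v, v \in t -> M v & M `<=` lcomb t].
have ex0 : exists t, good t.
  have [s [sM' sG]] := submodule_rV_fin_gen sM.
  have H v : exists N, forall N', (N <= N')%N -> v = \sum_(a < N') gpi (freeg sh) a v := gpi_sum (v : freeg sh).
  pose N v := projT1 (cid (H v)).
  have NE v : v = \sum_(a < N v) vgr sh a v by rewrite /N; case: cid => m /= Hm; apply: Hm.
  exists (flatten [seq [seq vgr sh a v | a <- iota 0 (N v)] | v <- s]); split.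
  - by move=> v /flattenP[_ /mapP[u us ->] /mapP[a _ ->]]; exists a; apply: (@gpi_id _ (freeg sh)).
  - by move=> v /flattenP[_ /mapP[u us ->] /mapP[a _ ->]]; apply: gM; apply: sM'.
  - apply: subset_trans sG _; apply: lcomb_min; first exact: lcomb_submodule.
    move=> v vs; rewrite (NE v); apply: submodule_sum; first exact: lcomb_submodule.
    move=> a _; apply: lcomb_mem; apply/flattenP.
    exists [seq vgr sh a v | a <- iota 0 (N v)]; first by apply/mapP; exists v.
    by apply/mapP; exists (a : nat); rewrite // mem_iota add0n ltn_ord.
have exl : exists l, `[< exists2 t, good t & size t = l >].
  by have [t gt] := ex0; exists (size t); apply/asboolP; exists t.
have [l /asboolP[t [th tM tG] tl] minl] := ex_minnP exl.
have hd (c : 'I_l) : exists a, vgr sh a t`_c = t`_c by apply: th; apply: mem_nth; rewrite tl.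
pose D : 'M[S]_(l, r) := \matrix_(i < l) t`_i.
have DE w : w *m D = \sum_i w 0 i *: t`_i.
  by rewrite mulmx_sum_row; apply: eq_bigr => i _; rewrite rowK.
constructor; apply: (@MinGens r sh M l (fun c => projT1 (cid (hd c))) D).
- by move=> i; rewrite rowK; case: cid.
- move=> v; split.
    move=> /tG/lcombP[c ->]; rewrite tl; exists (\row_i c i); rewrite DE.
    by apply: eq_bigr => i _; rewrite mxE.
  case=> w ->; rewrite DE; apply: submodule_sum => // i _; apply: MZ.
  by apply: tM; apply: mem_nth; rewrite tl.
move=> w w0 c; apply: contrapT => nw; pose u := (w 0 c)@_0%MM.
have u0 : u != 0 by apply/eqP.
pose deg i := projT1 (cid (hd i)).
have dh i : vgr sh (deg i) (row i D) = row i D by rewrite rowK /deg; case: cid.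
(* In the component of degree [deg c] of the syzygy, the coefficient at c is exactly the constant u,
   which can be inverted. *)
have := @rmulmx_pi _ _ sh deg D dh (deg c) w.
rewrite /rmulmx w0 raddf0 DE (bigD1 c) //= => /eqP; rewrite addr_eq0 mxE leqnn subnn.
have -> : pihomog mdeg 0 (w 0 c) = u%:MP.
  apply/mpolyP => m; rewrite mcoeff_pihomog mcoeffC mdeg_eq0.
  by case: eqP => [->|_]; rewrite ?mulr1 ?mulr0.
move=> /eqP Etc; pose t' : seq 'rV[S]_r := [seq t`_(val i) | i <- enum (predC1 c)].
have [_ _ LZ] := lcomb_submodule t'.
have key i : i != c -> lcomb t' t`_i.
  by move=> ic; apply: lcomb_mem; apply/mapP; exists i; rewrite // mem_enum.
have keyc : lcomb t' t`_c.
  have -> : t`_c = u^-1%:MP *: (u%:MP *: t`_c).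
    by rewrite scalerA -mpolyCM mulVf // scale1r.
  apply: (LZ u^-1%:MP); rewrite Etc -scaleN1r; apply: (LZ (-1)).
  apply: submodule_sum => [|i ic]; first exact: lcomb_submodule.
  by apply: LZ; apply: key.
have sz' : (size t' < l)%N.
  by rewrite size_map -cardE cardC1 card_ord prednK // (leq_ltn_trans (leq0n c)).
suff : (l <= size t')%N by rewrite leqNgt sz'.
apply: minl; apply/asboolP; exists t' => //; split.
- by move=> v /mapP[i _ ->]; apply: hd.
- by move=> v /mapP[i _ ->]; apply: tM; apply: mem_nth; rewrite tl; exact: (ltn_ord i).
- apply: subset_trans tG _; apply: lcomb_min; first exact: lcomb_submodule.
  move=> v /(nthP 0)[i]; rewrite tl => il <-.
  have [ic|ic] := eqVneq (Ordinal il) c; last exact: (key (Ordinal il)).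
  by move: keyc; rewrite -ic.
Qed.

End GradedFree.

(** * Existence and uniqueness properties of minimal resolutions *)

Section Resolutions.
Variables (k : fieldType) (n : nat).
Local Notation S := {mpoly k[n]}.
Local Notation freeg := (@freeg k n _).
Implicit Type I : set S.

(** One stage of the resolution; bundling the rank with the data that depend on it allows plain
    iteration. *)
Record syzygy_state := SyzygyState {
  ss_rank : nat;
  ss_shift : 'I_ss_rank -> nat;
  ss_mod : set 'rV[S]_ss_rank;
  ss_submod : is_submodule ss_mod;
  ss_graded : graded_sub (ss_mod : set (freeg ss_shift));
  ss_min : forall v, ss_mod v -> forall c, irrelevant_ideal (v 0 c)
}.

Definition ss_gens (X : syzygy_state) : min_gens (@ss_shift X) (@ss_mod X) :=
  projT1 (cid (let: inhabits g := min_gens_exist (@ss_submod X) (@ss_graded X) in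
               ex_intro (fun=> True) g Logic.I)).

Lemma ker_submodule r r' (D : 'M[S]_(r', r)) : is_submodule [set w : 'rV[S]_r' | w *m D = 0].
Proof.
split=> /=; first by rewrite mul0mx.
- by move=> u v u0 v0; rewrite mulmxDl u0 v0 addr0.
- by move=> c u u0; rewrite -scalemxAl u0 scaler0.
Qed.

Lemma ker_graded r r' (sh : 'I_r -> nat) (sh' : 'I_r' -> nat) (D : 'M[S]_(r', r)) :
  (forall i, vgr sh (sh' i) (row i D) = row i D) ->
  graded_sub ([set w : 'rV[S]_r' | w *m D = 0] : set (freeg sh')).
Proof.
move=> Dh a u u0; have := rmulmx_pi Dh a u.
by rewrite /rmulmx u0 raddf0.
Qed.

Definition ss_next (X : syzygy_state) : syzygy_state :=
  let g := ss_gens X in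
  SyzygyState (ker_submodule (mg_mx g)) (ker_graded (@mg_homog _ _ _ _ _ g))
    (@mg_min _ _ _ _ _ g).

Lemma resolution_exists I : is_ideal I -> (forall f j, I f -> I (pihomog mdeg j f)) ->
  ~ I 1 -> inhabited (min_free_resolution I).
Proof.
move=> idI gI nI1; have [I0 ID IM] := idI.
pose sh0 (i : 'I_1) := 0%N.
have sM0 : is_submodule [set v : 'rV[S]_1 | I (v 0 0)].
  split=> /= [|u v Iu Iv|c u Iu]; rewrite mxE //; [exact: ID|exact: IM].
have gM0 : graded_sub ([set v : 'rV[S]_1 | I (v 0 0)] : set (freeg sh0)).
  by move=> a v Iv /=; rewrite mxE subn0; apply: gI.
(* A nonzero constant term is the degree 0 component of an element of [I], hence a unit in [I],
   which is proper. *)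
have mM0 v : [set v : 'rV[S]_1 | I (v 0 0)] v -> forall c, irrelevant_ideal (v 0 c).
  move=> /= Iv c; rewrite ord1 {c}; apply: contrapT => nz; apply: nI1.
  set f := v 0 0 in Iv nz; have z : f@_0%MM != 0 by apply/eqP.
  have -> : 1 = (f@_0%MM)^-1%:MP * pihomog mdeg 0 f :> S.
    rewrite mul_mpolyC; apply/mpolyP => m; rewrite mcoeff1 mcoeffZ mcoeff_pihomog mdeg_eq0.
    by case: eqP => [->|_]; rewrite ?mulVf ?mulr0.
  exact/IM/gI.
pose X0 := SyzygyState sM0 gM0 mM0.
pose X i := iter i ss_next X0.
constructor.
apply: (@MinFreeResolution k n I (fun i => ss_rank (X i)) (fun i => @ss_shift (X i))
  (fun i => mg_mx (ss_gens (X i))) (const_mx 1)).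
- move=> i r c m mD; have /rowP/(_ c) := @mg_homog _ _ _ _ _ (ss_gens (X i)) r.
  rewrite !mxE; case: leqP => [le E|lt E]; last first.
    by move: mD; rewrite -E msupp0.
  have := congr1 (mcoeff m) E; rewrite mcoeff_pihomog.
  case: eqP => [->|_ /esym/eqP]; first by rewrite subnKC.
  by rewrite mcoeff_eq0 mD.
- move=> r m; rewrite mxE msupp1 inE => /eqP ->; by rewrite mdeg0.
- exists (const_mx 1); rewrite !mxE big_ord1 !mxE mulr1 subrr; exact: I0.
- move=> v; rewrite !mxE big_ord1 !mxE mulr1.
  exact: (mg_image (ss_gens X0) v).
- by move=> i v; apply: (mg_image (ss_gens (X i.+1)) v).
- move=> i r c; have : ss_mod (row r (mg_mx (ss_gens (X i)))).
    apply/(mg_image (ss_gens (X i))); exists (delta_mx 0 r); by rewrite rowE.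
  by move=> /ss_min/(_ c); rewrite mxE.
Qed.

Lemma ideal_subgmod I : is_ideal I -> subgmod (I : set (polg k n)).
Proof.
move=> [I0 ID IM]; split=> // [u v Iu Iv|i u Iu]; last exact: IM.
by apply: ID => //; rewrite -mulN1r; apply: IM.
Qed.

Section Invariance.
Variables (I : set S) (F : min_free_resolution I).
Hypotheses (idI : is_ideal I) (gI : graded_sub (I : set (polg k n))).

Lemma mfr_row_homog i r :
  vgr (@mfr_shift _ _ _ F i) (mfr_shift r) (row r (mfr_diff F i)) = row r (mfr_diff F i).
Proof.
apply/rowP => c; rewrite !mxE; apply/mpolyP => m.
have H := @mfr_diff_homog _ _ _ F i r c m.
case: leqP => [le|lt].
  rewrite mcoeff_pihomog; case: eqP => // ne; apply/esym/memN_msupp_eq0.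
  by apply/negP => /H E; apply: ne; rewrite -E addKn.
rewrite mcoeff0; apply/esym/memN_msupp_eq0; apply/negP => /H E.
by move: lt; rewrite -E ltnNge leq_addr.
Qed.

Local Notation Fr i := (freeg (@mfr_shift _ _ _ F i)).

Definition aug_map (v : Fr 0) : polg k n := (v *m mfr_aug F) 0 0.

Lemma aug_map_additive : additive aug_map.
Proof. by move=> u v; rewrite /aug_map mulmxBl !mxE. Qed.
HB.instance Definition _ := GRing.isAdditive.Build (Fr 0) (polg k n) aug_map aug_map_additive.

Lemma aug_map_x i v : aug_map (gx (Fr 0) i v) = gx (polg k n) i (aug_map v).
Proof. by rewrite /aug_map /= /vmulX -scalemxAl mxE. Qed.

Lemma aug_map_pi a v : aug_map (gpi (Fr 0) a v) = gpi (polg k n) a (aug_map v).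
Proof.
rewrite /aug_map !mxE raddf_sum; apply: eq_bigr => r _ /=.
have Er : pihomog mdeg (mfr_shift r) (mfr_aug F r 0) = mfr_aug F r 0.
  apply/mpolyP => m; rewrite mcoeff_pihomog; case: eqP => // ne.
  by apply/esym/memN_msupp_eq0; apply/negP => /mfr_aug_homog.
rewrite (pihomogM_homog _ _ Er) mxE; case: ifP => //; by rewrite mul0r.
Qed.

Lemma mfr_in_max i (v : Fr i) : (exists w, v = w *m mfr_diff F i) ->
  exists u : 'I_n -> Fr i, v = \sum_l gx (Fr i) l (u l).
Proof.
case=> w ->; apply/freeg_in_max => c; rewrite /irrelevant_ideal /= mxE raddf_sum big1 //.
move=> l _ /=; have /const0_sum[u ->] := @mfr_minimal _ _ _ F i l c.
rewrite mulr_sumr raddf_sum big1 // => j _ /=; rewrite mulrCA.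
have /mpolyP/(_ 0%MM) := @pihomogX0 k n j (w 0 l * u j).
by rewrite mcoeff_pihomog mdeg0 eqxx mcoeff0.
Qed.

Local Notation dm i := (@rmulmx k n _ _ (@mfr_shift _ _ _ F i) (@mfr_shift _ _ _ F i.+1) (mfr_diff F i)).

(** By exactness the image in F_(i+1) is the kernel of the map to F_i, so each dimension shift
    trades one homological degree for one step up the resolution. *)
Lemma mfr_knzj i p j :
  knzj (range (dm i) : set (Fr i)) p j <-> knzj (range (dm (i + p)%N) : set (Fr (i + p)%N)) 0 j.
Proof.
elim: p i => [|p IH] i; first by rewrite addn0.
rewrite addnS -addSn -IH.
have -> : (range (dm i.+1) : set (Fr i.+1)) = [set v | dm i v = 0].
  apply/seteqP; split=> v.
    case=> w _ <-; have [_ H] := @mfr_exact _ _ _ F i (w *m mfr_diff F i.+1).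
    by apply: H; exists w.
  move=> v0; have [H _] := @mfr_exact _ _ _ F i v.
  by have [w ->] := H v0; exists w.
apply: knzj_shift.
- exact: rmulmx_x.
- by apply: rmulmx_pi; apply: mfr_row_homog.
- by move=> q c; apply: freeg_acyclic.
- by move=> v; apply: mfr_in_max; exists v.
Qed.

(** S/I is F_0 modulo an image; shifting leads to H_0 of F_i modulo an image inside m F_i, which is
    F_i / m F_i, with the basis vectors of F_i in the degrees [mfr_shift]. *)
Lemma mfr_betti i j :
  (exists r : 'I_(mfr_rank F i), mfr_shift r = j) <-> knzj (I : set (polg k n)) i j.
Proof.
have sI := ideal_subgmod idI.
rewrite -(knzj_iso aug_map_x aug_map_pi i j sI gI); last first.
  have [v Iv] := mfr_aug_surj F; have [I0 ID IM] := idI.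
  move=> f; exists (f *: v); rewrite /= /aug_map -scalemxAl mxE.
  have -> : f - f * (v *m mfr_aug F) 0 0 = - f * ((v *m mfr_aug F) 0 0 - 1).
    by rewrite mulrBr mulr1 mulNr opprK addrC.
  exact: IM.
have -> : (aug_map @^-1` I : set (Fr 0)) = range (dm 0).
  apply/seteqP; split=> v.
    move=> Iv; have [H _] := @mfr_exact0 _ _ _ F v.
    by have [w ->] := H Iv; exists w.
  case=> w _ <-; have [_ H] := @mfr_exact0 _ _ _ F (w *m mfr_diff F 0).
  by apply: H; exists w.
rewrite mfr_knzj add0n.
have sM : subgmod (range (dm i) : set (Fr i)).
  split; first by exists 0; rewrite // raddf0.
  - by move=> _ _ [u _ <-] [v _ <-]; exists (u - v); rewrite ?raddfB.
  - by move=> l _ [u _ <-]; exists (gx (Fr i.+1) l u); rewrite ?rmulmx_x.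
rewrite knzj0 //; last by move=> v [w _ <-]; apply: mfr_in_max; exists w.
split=> [[r <-]|[v [jv nv]]].
  exists (delta_mx 0 r); split.
    apply/rowP => c; rewrite !mxE eqxx /=; case: (eqVneq c r) => [->|_].
      by rewrite leqnn subnn -mpolyX0 pihomogX /= mdeg0.
    by rewrite raddf0 if_same.
  move=> /freeg_in_max/(_ r); rewrite /irrelevant_ideal /= mxE !eqxx /= mcoeff1 eqxx => /eqP.
  by rewrite oner_eq0.
apply: contrapT => nr; apply: nv; apply/freeg_in_max => c.
apply: contrapT => nz; apply: nr; exists c.
move: nz; rewrite -jv /irrelevant_ideal /= mxE; case: leqP => [le|]; last by rewrite mcoeff0.
rewrite mcoeff_pihomog mdeg0; case: eqP => [E _|_ /(_ erefl) //].
by apply/eqP; rewrite eqn_leq le /= -subn_eq0 -E.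
Qed.

End Invariance.

(** The right side mentions no resolution, so all minimal resolutions have the same shifts. The unit
    ideal is settled separately: it has no Koszul homology. *)
Theorem betti_supportP I (i j : nat) : homogeneous_ideal I ->
  betti_support I (i, j) <-> knzj (I : set (polg k n)) i j.
Proof.
case=> idI gI; have gI' : graded_sub (I : set (polg k n)) by move=> a u; apply: gI.
split=> [[F]|H]; first by move=> HF; apply/(mfr_betti F idI gI').
have [I1|nI1] := pselect (I 1).
  case: H => a [_ _ _]; case; exists 0 => T.
  have [_ _ IM] := idI; by rewrite -[X in I X]mulr1; apply: IM.
have [F] := resolution_exists idI gI nI1.
by exists F; apply/(mfr_betti F idI gI').
Qed.

(** Finitely many modules of finite rank matter, as p is at most n. Hence the supremum defining the
    regularity will be a maximum. *)
Lemma betti_support_finite I : homogeneous_ideal I ->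
  exists N, forall p j, knzj (I : set (polg k n)) p j -> (j <= N)%N.
Proof.
case=> idI gI; have gI' : graded_sub (I : set (polg k n)) by move=> a u; apply: gI.
have sI := ideal_subgmod idI.
have [I1|nI1] := pselect (I 1).
  exists 0 => p j [a [_ _ _]]; case; exists 0 => T.
  have [_ _ IM] := idI; by rewrite -[X in I X]mulr1; apply: IM.
have [F] := resolution_exists idI gI nI1.
exists (\max_(p < n.+1) \max_(r < mfr_rank F p) @mfr_shift _ _ _ F p r)%N => p j H.
have pn : (p <= n)%N by apply: (knz_le sI); apply/(knz_knzj sI) => //; exists j.
have /(mfr_betti F idI gI')[r <-] := H.
apply: leq_trans (leq_bigmax (F := fun p : 'I_n.+1 => \max_(r < mfr_rank F p) @mfr_shift _ _ _ F p r)%N (inord p)).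
have E : (inord p : 'I_n.+1) = p :> nat by rewrite inordK.
by rewrite /= E; apply: leq_bigmax.
Qed.

End Resolutions.

(** * Depth and regularity *)

Lemma supremum_max (disp : Order.disp_t) (T : porderType disp) (x0 : T) (A : set T) (x : T) :
  A x -> ubound A x -> supremum x0 A = x.
Proof.
move=> Ax ubx; rewrite /supremum; case: eqP => [A0|_]; first by rewrite A0 in Ax.
have sx : supremums A x by split=> // y; apply.
by apply: (@is_subset1_supremums _ _ A) => //; apply: xgetPex; exists x.
Qed.

Section IdealGen.
Variable S : comNzRingType.
Implicit Types (N E : set S).

Lemma ideal_gen_ideal E : is_ideal (ideal_gen E).
Proof.
split=> [|f g If Ig|r f If] W [iW EW]; have [W0 WD WM] := iW => //.
- by apply: WD; [apply: If|apply: Ig].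
- by apply: WM; apply: If.
Qed.

Lemma sub_ideal_gen E : E `<=` ideal_gen E.
Proof. exact: sub_gen_smallest. Qed.

Lemma ideal_gen_min N E : is_ideal N -> E `<=` N -> ideal_gen E `<=` N.
Proof. exact: smallest_sub. Qed.

Lemma ideal_gen_id N : is_ideal N -> ideal_gen N = N.
Proof. exact: smallest_id. Qed.

Lemma ideal_genU N E : ideal_gen (ideal_gen N `|` E) = ideal_gen (N `|` E).
Proof.
apply/seteqP; split; apply: ideal_gen_min; try exact: ideal_gen_ideal.
- move=> u [Nu|Eu]; last by apply: sub_ideal_gen; right.
  by apply: (ideal_gen_min _ _ Nu); [exact: ideal_gen_ideal|move=> v Nv; apply: sub_ideal_gen; left].
- move=> u [Nu|Eu]; apply: sub_ideal_gen; [left|by right].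
  exact: sub_ideal_gen.
Qed.

Lemma ideal_genU1 N f u : is_ideal N ->
  ideal_gen (N `|` [set f]) u <-> exists v w, N v /\ u = v + f * w.
Proof.
move=> [N0 ND NM]; split.
  have : (ideal_gen (N `|` [set f]) `<=` [set u | exists v w, N v /\ u = v + f * w]).
    apply: ideal_gen_min; first split.
    - by exists 0, 0; rewrite mulr0 addr0.
    - move=> _ _ [v [w [Nv ->]]] [v' [w' [Nv' ->]]].
      by exists (v + v'), (w + w'); split; [apply: ND|rewrite mulrDr addrACA].
    - move=> r _ [v [w [Nv ->]]].
      by exists (r * v), (r * w); split; [apply: NM|rewrite mulrDr mulrCA].
    - move=> v [Nv|->]; first by exists v, 0; rewrite mulr0 addr0.
      by exists 0, 1; rewrite mulr1 add0r.
  by apply.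
case=> v [w [Nv ->]]; have [_ D M] := ideal_gen_ideal (N `|` [set f]).
apply: D; first by apply: sub_ideal_gen; left.
by rewrite mulrC; apply: M; apply: sub_ideal_gen; right.
Qed.

End IdealGen.

(** * Koszul homology modulo a regular element *)

Section RegularElements.
Variables (k : fieldType) (n : nat).
Local Notation S := {mpoly k[n]}.
Local Notation KS := {ffun {set 'I_n} -> S}.
Local Notation m := (@irrelevant_ideal k n).
Local Notation knz := (@knz n (polg k n)).
Implicit Types (N : set S) (a b c : KS) (f g : S).

Definition kmul f a : KS := kmap (fun p => f * p) a.

Lemma kmul_additive f : additive (kmul f).
Proof. by move=> a b; apply/ffunP=> T; rewrite !ffunE mulrBr. Qed.
HB.instance Definition _ f := GRing.isAdditive.Build _ _ (kmul f) (kmul_additive f).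

Lemma kos_kmul f a : kos (kmul f a) = kmul f (kos a).
Proof.
apply/ffunP=> T; rewrite ffunE /kos !(@koszulE n (polg k n)) mulr_sumr.
apply: eq_bigr => i _; rewrite /= /mulX; case: ifP => _; first by rewrite mulr0.
by rewrite ffunE [RHS]mulrCA; case: osign; rewrite /= ?mulrN.
Qed.

(** Writing f as the sum of x_i u_i, the sum of the u_i e_i contracts multiplication by f, so f acts
    as zero on Koszul homology. *)
Lemma kmul_homotopy f : m f -> exists G : {additive KS -> KS},
  [/\ forall a, kos (G a) + G (kos a) = kmul f a,
      forall p a, kpr p.+1 (G a) = G (kpr p a) &
      forall N a, is_ideal N -> kin N a -> kin N (G a)].
Proof.
move=> /const0_sum[u fE].
pose G a := \sum_i kmul (u i) (cre i a).
have GB : additive G.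
  by move=> a b; rewrite /G -sumrB; apply: eq_bigr => i _; rewrite !raddfB.
pose lG := GRing.isAdditive.Build _ _ G GB.
pose G' : {additive KS -> KS} := HB.pack G lG.
exists G'; split=> [a|p a|N a idN Na] /=; rewrite /G; last first.
  have [_ _ NM] := idN; apply: (kin_sum (ideal_subgmod idN)) => i _ T.
  by rewrite ffunE; apply: NM; apply: (kin_cre (ideal_subgmod idN)).
- rewrite raddf_sum; apply: eq_bigr => i _ /=; rewrite -kpr_cre.
  by apply/ffunP=> T; rewrite !ffunE; case: (_ == _); rewrite ?mulr0.
- rewrite raddf_sum -big_split /=; apply/ffunP=> T.
  rewrite sum_ffunE ffunE fE mulr_suml; apply: eq_bigr => i _.
  rewrite kos_kmul -raddfD /= (@koszul_cre n (polg k n)) !ffunE /= /mulX.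
  by rewrite mulrA [u i * _]mulrC.
Qed.

Section Step.
Variables (N N' : set S) (f : S).
Hypotheses (idN : is_ideal N) (mf : m f) (nzd : forall g, N (f * g) -> N g).
Hypothesis N'E : forall u, N' u <-> exists v w, N v /\ u = v + f * w.

Let sN : subgmod (N : set (polg k n)) := ideal_subgmod idN.

Lemma kin_nzd a : kin N (kmul f a) -> kin N a.
Proof. by move=> H T; apply: nzd; move: (H T); rewrite ffunE. Qed.

Lemma kin_ext a : kin N' a <-> exists b c, kin N b /\ a = b + kmul f c.
Proof.
split=> [H|[b [c [Nb ->]]] T]; last first.
  by rewrite !ffunE; apply/N'E; exists (b T), (c T).
have H' T : exists vw : S * S, N vw.1 /\ a T = vw.1 + f * vw.2.
  by have /N'E[v [w [Nv E]]] := H T; exists (v, w).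
exists [ffun T => (projT1 (cid (H' T))).1], [ffun T => (projT1 (cid (H' T))).2].
split=> [T|]; first by rewrite ffunE; case: cid => -[v w] [].
by apply/ffunP=> T; rewrite !ffunE; case: cid => -[v w] [].
Qed.

(** Since f acts as zero on homology, the connecting map from H_(p+1)(S/N') to H_p(S/N) is onto;
    [G a] is an explicit preimage of the class of [a]. *)
Lemma knz_regularS p : knz N p -> knz N' p.+1.
Proof.
case=> a [pa Na na]; have [G [GE Gp GN]] := kmul_homotopy mf.
have Ga : kos (G a) = kmul f a - G (kos a) by rewrite -GE addrK.
exists (G a); split; first by rewrite Gp pa.
  apply/kin_ext; exists (- G (kos a)), a; split; last by rewrite addrC -Ga.
  by apply: (kinN sN); apply: GN.
case=> b /kin_ext[b' [w [Nb' E]]]; apply: na; exists w; apply: kin_nzd.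
have -> : kmul f (a - kos w) = kos b' + G (kos a).
  have kb : kos (koszul b) = 0 by exact: (@koszul_koszul n (polg k n)).
  have Ew : kmul f w = - b' + (G a - koszul b) by rewrite E addKr.
  rewrite [LHS]raddfB /= -kos_kmul Ew [kos (- b' + _)]raddfD /= [kos (G a - _)]raddfB /=.
  rewrite kb subr0 Ga raddfN /= opprD opprK opprB addrCA; congr (_ + _).
  by rewrite addrC subrK.
by apply: (kinD sN); [apply: (kin_koszul sN)|apply: GN].
Qed.

(** Exactness at H_(p+1)(S/N'): either the connecting map detects the class, or a correction by a
    multiple of f lifts it to H_(p+1)(S/N). *)
Lemma knz_regular_inv p : knz N' p.+1 -> knz N p.+1 \/ knz N p.
Proof.
case=> c [pc /kin_ext[b [a0 [Nb E]]] nc].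
pose a := kpr p a0; have Ea : kos c = kpr p b + kmul f a.
  have -> : kos c = kpr p (kos c).
    by rewrite -[in LHS]pc; apply: (@koszul_kprS n (polg k n)).
  rewrite [kos c]E raddfD /=; congr (_ + _).
  by apply/ffunP=> T; rewrite !ffunE; case: (_ == _); rewrite ?mulr0.
have Npb : kin N (kpr p b) by apply: (kin_kpr sN).
have Na : kin N (kos a).
  apply: kin_nzd; rewrite -kos_kmul.
  have -> : kmul f a = kos c - kpr p b by rewrite Ea addrC addKr.
  rewrite raddfB /=; have -> : kos (kos c) = 0 by apply: (@koszul_koszul n (polg k n)).
  by rewrite sub0r; apply: (kinN sN); apply: (kin_koszul sN).
have [[w Nw]|nw] := pselect (exists w, kin N (a - kos w)); last first.
  by right; exists a; split=> //; rewrite kpr_id.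
left; exists (c - kmul f (kpr p.+1 w)); split.
- rewrite raddfB /= pc; congr (_ - _).
  by apply/ffunP=> T; rewrite !ffunE; case: (_ == _); rewrite ?mulr0.
- have -> : koszul (V := polg k n) (c - kmul f (kpr p.+1 w)) =
      kpr p b + kmul f (a - kpr p (kos w)).
    rewrite -/(kos _) raddfB /= kos_kmul Ea [kmul f (a - _)]raddfB /= addrA.
    by congr (_ - kmul f _); apply: (@koszul_kprS n (polg k n)).
  apply: (kinD sN) => //.
  have -> : a - kpr p (kos w) = kpr p (a - kos w) by rewrite raddfB /= kpr_id.
  move=> T; rewrite ffunE; have [_ _ NM] := idN; apply: NM.
  exact: (kin_kpr sN).
- case=> u Nu; apply: nc; exists u; apply/kin_ext.
  exists (c - kmul f (kpr p.+1 w) - koszul u), (kpr p.+1 w); split=> //.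
  by rewrite addrAC subrK.
Qed.

Lemma knz_regular_le t : (forall p, knz N p -> (p <= t)%N) ->
  forall p, knz N' p -> (p <= t.+1)%N.
Proof.
move=> H [//|p] /knz_regular_inv[/H|/H]; last by rewrite ltnS.
by move/leqW.
Qed.

End Step.

(** H_n is the socle of S/N: an element killed by all variables becomes a cycle on the full set,
    where no boundary arrives. *)
Lemma knz_top N : is_ideal N -> ~ knz N n ->
  forall g, (forall i, N ('X_i * g)) -> N g.
Proof.
move=> idN nz g Ng; have [N0 ND NM] := idN; apply: contrapT => nNg; apply: nz.
have full (T : {set 'I_n}) : (#|T| == n) = (T == finset.setT).
  have Tn : (#|T| <= n)%N by have := max_card (mem T); rewrite card_ord.
  by rewrite eqEcard finset.subsetT /= cardsT card_ord eqn_leq Tn.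
exists [ffun T : {set 'I_n} => if #|T| == n then g else 0]; split.
- by apply/ffunP=> T; rewrite !ffunE; case: (_ == n).
- move=> T; rewrite (@koszulE n (polg k n)); apply: (subgmod_sum (ideal_subgmod idN)) => i _.
  case: ifP => _ //; rewrite ffunE /= /mulX; case: (_ == n); last by rewrite csign0 mulr0.
  case: osign => /=; last exact: Ng.
  by rewrite mulrN -mulN1r; apply: NM.
- case=> b /(_ finset.setT); rewrite !ffunE cardsT card_ord eqxx.
  by rewrite (@koszulE n (polg k n)) big1 ?subr0 // => i _; rewrite finset.in_setT.
Qed.

End RegularElements.

(** * Existence of regular elements *)

Section PrimeAvoidance.
Variables (k : fieldType) (n : nat).
Local Notation S := {mpoly k[n]}.
Local Notation m := (@irrelevant_ideal k n).
Local Notation knz := (@knz n (polg k n)).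
Implicit Type N : set S.

(** Without a maximal member there is a strictly increasing chain, whose union is finitely generated
    and hence already equals a member of the chain. *)
Lemma acc_ideal (F : set (set S)) : (forall P, F P -> is_ideal P) -> F !=set0 ->
  exists P, F P /\ forall P', F P' -> P `<=` P' -> P' = P.
Proof.
move=> Fid [P0 FP0]; apply: contrapT => nmax.
have H (P : {P | F P}) : exists Pf : {P | F P} * S, [/\ sval P `<=` sval Pf.1, sval Pf.1 Pf.2 & ~ sval P Pf.2].
  case: P => P FP; apply: contrapT => nex; apply: nmax; exists P; split=> // P' FP' PP'.
  apply/seteqP; split=> // f P'f; apply: contrapT => nPf; apply: nex.
  by exists (exist _ P' FP', f).
pose nx P := projT1 (cid (H P)).
have nxP P : [/\ sval P `<=` sval (nx P).1, sval (nx P).1 (nx P).2 & ~ sval P (nx P).2].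
  by rewrite /nx; case: cid.
pose sq i := iter i (fun P => (nx P).1) (exist _ P0 FP0 : {P | F P}).
have sqm i j : (i <= j)%N -> sval (sq i) `<=` sval (sq j).
  elim: j => [|j IH]; first by rewrite leqn0 => /eqP ->.
  rewrite leq_eqVlt => /orP[/eqP -> //|/IH sij].
  by apply: subset_trans sij _; have [] := nxP (sq j).
pose U : set S^o := \bigcup_i sval (sq i).
have sU : is_submodule U.
  have sid i : is_ideal (sval (sq i)) by apply: Fid; case: (sq i).
  split.
  - by exists 0 => //; have [] := sid 0.
  - move=> u v [i _ iu] [j _ jv]; exists (maxn i j) => //; have [_ D _] := sid (maxn i j).
    by apply: D; [apply: (sqm i)|apply: (sqm j)]; rewrite ?leq_maxl ?leq_maxr.
  - by move=> c u [i _ iu]; exists i => //; have [_ _ M] := sid i; apply: M.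
have [s [sU' sG]] := hilbert_basis sU.
have [i si] : exists i, forall v, v \in s -> sval (sq i) v.
  elim: s sU' {sG} => [_|x s IH sU']; first by exists 0.
  have [i si] : exists i, forall v, v \in s -> sval (sq i) v.
    by apply: IH => v vs; apply: sU'; rewrite inE vs orbT.
  have [j _ jx] := sU' x (mem_head _ _).
  exists (maxn i j) => v; rewrite inE => /orP[/eqP ->|/si]; last by apply: sqm; apply: leq_maxl.
  by apply: (sqm j) => //; apply: leq_maxr.
have [_ h1 h2] := nxP (sq i); apply: h2.
have : lcomb s (nx (sq i)).2 by apply: sG; exists i.+1.
apply: lcomb_min => //; apply: Fid; by case: (sq i).
Qed.

(* The zero divisors modulo N are the elements of the maximal annihilators
   N : g, which are finitely many primes; prime avoidance applies to them. *)
Lemma regular_element N : is_ideal N -> ~ knz N n ->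
  exists f, m f /\ forall g, N (f * g) -> N g.
Proof.
move=> idN nz; have top := knz_top idN nz; have [N0 ND NM] := idN.
pose ann g : set S := [set f | N (f * g)].
have ann_id g : is_ideal (ann g).
  split; rewrite /ann /=; first by rewrite mul0r.
  - by move=> u v Nu Nv; rewrite mulrDl; apply: ND.
  - by move=> r u Nu; rewrite -mulrA; apply: NM.
pose A g := ~ N g /\ forall h, ~ N h -> ann g `<=` ann h -> ann h = ann g.
have A1 g : A g -> ~ ann g 1 by case=> ng _; rewrite /ann /= mul1r.
(* Primality: the annihilator of b g contains that of g, and equals it by maximality when b g is not
   in [N]. *)
have Apr g a b : A g -> ann g (a * b) -> ~ ann g b -> ann g a.
  move=> [ng mg] ab nb; rewrite -(mg (b * g)) ?/ann /= ?mulrA //.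
  by move=> f /= Nf; rewrite mulrCA; apply: NM.
have Aex g : ~ N g -> exists h, A h /\ ann g `<=` ann h.
  move=> ng; have [||P [[h [nh gh] <-] maxh]] :=
    @acc_ideal [set ann h | h in [set h | ~ N h /\ ann g `<=` ann h]].
  - by move=> _ [h _ <-].
  - by exists (ann g); exists g => //; split.
  exists h; split=> //; split=> // h' nh' hh'; apply: maxh => //.
  by exists h' => //; split=> //; apply: subset_trans hh'.
(* The ideal generated by all g with maximal annihilator. It has a finite generating sequence [gs]
   of such elements. *)
pose J : set S^o := [set g | exists s : seq S^o, (forall x, x \in s -> A x) /\ lcomb s g].
have sJ : is_submodule J.
  split.
  - by exists [::].
  - move=> u v [s [As su]] [t [At tv]]; exists (s ++ t); split.
      by move=> x; rewrite mem_cat => /orP[/As|/At].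
    have [_ D _] := lcomb_submodule (s ++ t); apply: D.
      apply: (lcomb_min _ _ su); first exact: lcomb_submodule.
      by move=> x xs; apply: lcomb_mem; rewrite mem_cat xs.
    apply: (lcomb_min _ _ tv); first exact: lcomb_submodule.
    by move=> x xs; apply: lcomb_mem; rewrite mem_cat xs orbT.
  - move=> c u [s [As su]]; exists s; split=> //.
    by have [_ _ Z] := lcomb_submodule s; apply: Z.
have [gs [Ags Ggs]] : exists gs : seq S^o, (forall x, x \in gs -> A x) /\ J `<=` lcomb gs.
  have [s [sJ' sG]] := hilbert_basis sJ.
  suff [gs [Ags Ggs]] : exists gs : seq S^o, (forall x, x \in gs -> A x) /\ (forall v : S^o, v \in s -> lcomb gs v).
    exists gs; split=> //; apply: subset_trans sG _.
    by apply: lcomb_min => //; apply: lcomb_submodule.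
  elim: s sJ' {sG} => [_|x s IH sJ']; first by exists [::].
  have [gs [Ags Ggs]] : exists gs : seq S^o, (forall x, x \in gs -> A x) /\ (forall v : S^o, v \in s -> lcomb gs v).
    by apply: IH => v vs; apply: sJ'; rewrite inE vs orbT.
  have [t [At tx]] := sJ' x (mem_head _ _); exists (t ++ gs); split.
    by move=> y; rewrite mem_cat => /orP[/At|/Ags].
  have sub1 : lcomb t `<=` lcomb (t ++ gs).
    apply: lcomb_min; first exact: lcomb_submodule.
    by move=> y ys; apply: lcomb_mem; rewrite mem_cat ys.
  have sub2 : lcomb gs `<=` lcomb (t ++ gs).
    apply: lcomb_min; first exact: lcomb_submodule.
    by move=> y ys; apply: lcomb_mem; rewrite mem_cat ys orbT.
  by move=> v; rewrite inE => /orP[/eqP ->|/Ggs/sub2]; first exact: sub1.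
(* Otherwise each [ann h], h in [gs], has an element outside the prime [ann g]. Their product is
   outside too, but it kills all generators of [J] modulo [N], and g is in [J]. *)
have Afin g : A g -> exists2 h, h \in gs & ann h = ann g.
  move=> Ag; apply: contrapT => nh.
  have nsub h : h \in gs -> exists a, ann h a /\ ~ ann g a.
    move=> hgs; apply: contrapT => na; apply: nh; exists h => //.
    have [nNh mh] := Ags h hgs; apply/esym/mh; first by case: Ag.
    by move=> a ha; apply: contrapT => nga; apply: na; exists a.
  have [a [aall na]] : exists a, (forall h, h \in gs -> ann h a) /\ ~ ann g a.
    elim: (gs) nsub => [_|h s IH nsub]; first by exists 1; split=> //; apply: A1.
    have [a [aall na]] : exists a, (forall h, h \in s -> ann h a) /\ ~ ann g a.
      by apply: IH => h' hs; apply: nsub; rewrite inE hs orbT.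
    have [b [hb nb]] := nsub h (mem_head _ _).
    exists (a * b); split; last by move=> /(Apr _ _ _ Ag)/(_ nb).
    move=> h'; rewrite inE => /orP[/eqP ->|/aall h'a].
      by have [_ _ M] := ann_id h; apply: M.
    by have [_ _ M] := ann_id h'; rewrite mulrC; apply: M.
  apply: na; rewrite /ann /=.
  have : lcomb gs (g : S^o) by apply: Ggs; exists [:: (g : S^o)]; split;
    [move=> x; rewrite inE => /eqP ->|apply: lcomb_mem; rewrite inE].
  move=> Hg; apply: (@lcomb_min S S^o [set g | N (a * g)] gs _ _ g Hg).
    split=> /=; first by rewrite mulr0.
    - by move=> u v Nu Nv; rewrite mulrDr; apply: ND.
    - by move=> c u Nu; rewrite [_ *: _]/GRing.scale /= mulrCA; apply: NM.
  by move=> h /aall.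
suff [f [mf Hf]] : exists f, m f /\ forall h, h \in gs -> ~ ann h f.
  exists f; split=> // g Nfg; apply: contrapT => ng.
  have [h [Ah gh]] := Aex g ng; have [h' h'gs Eh] := Afin h Ah.
  by apply: (Hf h' h'gs); rewrite Eh; apply: gh.
elim: gs Ags {Ggs Afin} => [_|h gs IH Ags]; first by exists 0; rewrite /irrelevant_ideal /= mcoeff0.
have [f [mf Hf]] : exists f, m f /\ forall h, h \in gs -> ~ ann h f.
  by apply: IH => x xgs; apply: Ags; rewrite inE xgs orbT.
have Ah := Ags h (mem_head _ _).
have [hf|nhf] := pselect (ann h f); last first.
  by exists f; split=> // x; rewrite inE => /orP[/eqP ->|/Hf].
(* Adding such a [c] moves [f] out of [ann h] without putting it into any other prime. *)
suff [c [mc nc Hc]] : exists c, [/\ m c, ~ ann h c & forall x, x \in gs -> ann x c].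
  exists (f + c); split.
    by rewrite /irrelevant_ideal /= mcoeffD mf mc addr0.
  move=> x; rewrite inE => /orP[/eqP ->|xgs] H.
    apply: nc; have [_ D M] := ann_id h.
    by rewrite -[c](addKr f) -mulN1r; apply: D => //; apply: M.
  apply: (Hf x xgs); have [_ D M] := ann_id x.
  by rewrite -[f](addrK c) -mulN1r; apply: D => //; apply: M; apply: Hc.
(* An inclusion of [ann x] in [ann h] would be an equality by maximality, but [f] lies only in the
   second. *)
have diff x : x \in gs -> exists b, ann x b /\ ~ ann h b.
  move=> xgs; apply: contrapT => nb; apply: (Hf x xgs).
  have [_ mx] := Ags x (mem_behead (s := h :: gs) xgs).
  rewrite -(mx h) //; first by case: Ah.
  by move=> b xb; apply: contrapT => nhb; apply: nb; exists b.
(* Here the vanishing of H_n enters: otherwise h would be a nonzero socle element. This variable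
   starts the product [c] and puts it into the irrelevant ideal. *)
have [i nhi] : exists i, ~ ann h 'X_i.
  apply: contrapT => ni; have [nh _] := Ah; apply: nh; apply: top => i.
  by apply: contrapT => nhi; apply: ni; exists i.
elim: gs {IH Ags Hf} diff => [_|x gs IH diff].
  by exists 'X_i; split=> //; rewrite /irrelevant_ideal /= mcoeffX mnm1_eq0.
have [c [mc nc Hc]] : exists c, [/\ m c, ~ ann h c & forall x, x \in gs -> ann x c].
  by apply: IH => y ygs; apply: diff; rewrite inE ygs orbT.
have [b [xb nb]] := diff x (mem_head _ _).
exists (c * b); split.
- by rewrite /irrelevant_ideal /= mcoeffM big1 // => -[m1 m2] /=; rewrite eq_sym mnmD_eq0 => /andP[/eqP -> _]; rewrite mc mul0r.
- by move=> /(Apr _ _ _ Ah)/(_ nb).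
- move=> y; rewrite inE => /orP[/eqP ->|/Hc yc].
    by have [_ _ M] := ann_id x; apply: M.
  by have [_ _ M] := ann_id y; rewrite mulrC; apply: M.
Qed.

End PrimeAvoidance.

Section Depth.
Variables (k : fieldType) (n : nat).
Local Notation S := {mpoly k[n]}.
Local Notation m := (@irrelevant_ideal k n).
Local Notation knz := (@knz n (polg k n)).
Implicit Types (N I : set S) (rs : seq S).

Lemma irrelevant_is_ideal : is_ideal m.
Proof.
rewrite /irrelevant_ideal; split=> /= [|f g f0 g0|r f f0]; first by rewrite mcoeff0.
- by rewrite mcoeffD f0 g0 addr0.
- rewrite mcoeffM big1 // => -[m1 m2] /=; rewrite eq_sym mnmD_eq0 => /andP[_ /eqP ->].
  by rewrite f0 mulr0.
Qed.

Lemma ideal_gen_rcons N rs f :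
  ideal_gen (N `|` [set` rcons rs f]) = ideal_gen (ideal_gen (N `|` [set` rs]) `|` [set f]).
Proof.
rewrite ideal_genU -classical_sets.setUA; congr (ideal_gen (_ `|` _)).
apply/seteqP; split=> x /=; rewrite mem_rcons inE.
  by move=> /orP[/eqP ->|xs]; [right|left].
by move=> [xs|->]; rewrite ?eqxx // xs orbT.
Qed.

Lemma ideal_gen_cons N rs f :
  ideal_gen (N `|` [set` f :: rs]) = ideal_gen (ideal_gen (N `|` [set f]) `|` [set` rs]).
Proof.
rewrite ideal_genU -classical_sets.setUA; congr (ideal_gen (_ `|` _)).
apply/seteqP; split=> x /=; rewrite inE.
  by move=> /orP[/eqP ->|xs]; [left|right].
by move=> [->|xs]; rewrite ?eqxx // xs orbT.
Qed.

Lemma ideal_gen_nil N : is_ideal N -> ideal_gen (N `|` [set` [::] : seq S]) = N.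
Proof.
move=> idN; rewrite -[RHS](ideal_gen_id idN); congr ideal_gen.
by apply/seteqP; split=> x /=; [case|left].
Qed.

(** Nonzero homology climbs by the length of the sequence and cannot pass degree n; this bounds the
    length. *)
Lemma regular_seq_knz N rs p : is_ideal N -> regular_seq m N rs -> knz N p ->
  knz (ideal_gen (N `|` [set` rs])) (p + size rs).
Proof.
move=> idN [mrs reg _] Np.
suff H j : (j <= size rs)%N -> knz (ideal_gen (N `|` [set` take j rs])) (p + j).
  by have := H (size rs) (leqnn _); rewrite take_size.
elim: j => [_|j IH js]; first by rewrite take0 addn0 ideal_gen_nil.
rewrite addnS (take_nth 0 js) ideal_gen_rcons.
apply: (knz_regularS (N := ideal_gen (N `|` [set` take j rs])) (f := rs`_j)).
- exact: ideal_gen_ideal.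
- exact: mrs.
- by move=> g; apply: reg.
- by move=> u; apply: ideal_genU1; apply: ideal_gen_ideal.
- by apply: IH; apply: ltnW.
Qed.

(** As long as t < n, H_n vanishes and a regular element exists; dividing by it raises the bound t
    by at most one. *)
Lemma regular_seq_exists r N t : is_ideal N -> N `<=` m ->
  (forall p, knz N p -> (p <= t)%N) -> (t + r)%N = n ->
  exists rs, size rs = r /\ regular_seq m N rs.
Proof.
have n1 I : I `<=` m -> ~ I 1.
  by move=> Im /Im; rewrite /irrelevant_ideal /= mcoeff1 eqxx => /eqP; rewrite oner_eq0.
elim: r N t => [|r IH] N t idN Nm Nt tr.
  by exists [::]; split=> //; split=> //; rewrite ideal_gen_nil //; apply: n1.
have [|f [mf nzd]] := regular_element idN.
  by move=> /Nt; rewrite -tr -{2}[t]addn0 leq_add2l.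
pose N' := ideal_gen (N `|` [set f]).
have N'm : N' `<=` m.
  apply: ideal_gen_min; first exact: irrelevant_is_ideal.
  by move=> u [/Nm|->].
have [||||rs [srs [mrs reg _]]] := IH N' t.+1.
- exact: ideal_gen_ideal.
- exact: N'm.
- apply: (knz_regular_le (N := N) (f := f)) => //.
  by move=> u; apply: ideal_genU1.
- by rewrite addSnnS.
exists (f :: rs); split; first by rewrite /= srs.
split.
- by move=> [|j] //=; rewrite ltnS; apply: mrs.
- case=> [|j]; rewrite ?ltnS => js g.
    by rewrite take0 ideal_gen_nil //=; apply: nzd.
  by rewrite [take _ _]/= ideal_gen_cons; apply: reg.
- apply: n1; apply: ideal_gen_min; first exact: irrelevant_is_ideal.
  move=> u [/Nm //|] /=; rewrite inE => /orP[/eqP -> //|us].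
  have [i ir <-] := nthP 0 us; exact: mrs.
Qed.

Lemma depth_quotE I t : is_ideal I -> I `<=` m -> knz I t ->
  (forall p, knz I p -> (p <= t)%N) -> depth_quot I = EFin (n - t)%N%:Z.
Proof.
move=> idI Im It tmax; rewrite /depth_quot.
have tn : (t <= n)%N by apply: knz_le It; apply: ideal_subgmod.
case: asboolP => [/Im|_].
  by rewrite /irrelevant_ideal /= mcoeff1 eqxx => /eqP; rewrite oner_eq0.
apply: supremum_max.
  have [rs [srs reg]] := regular_seq_exists idI Im tmax (subnKC tn).
  by exists rs => //; rewrite srs.
move=> _ [rs reg <-]; rewrite lee_fin lez_nat -(leq_add2l t) subnKC //.
have := regular_seq_knz idI reg It; apply: knz_le.
exact/ideal_subgmod/ideal_gen_ideal.
Qed.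

Lemma depth_quot_unit I : I 1 -> depth_quot I = EPInf int.
Proof. by move=> I1; rewrite /depth_quot; case: asboolP. Qed.

Lemma reg_quotE I p j : homogeneous_ideal I -> knzj (I : set (polg k n)) p j ->
  (forall p' j', knzj (I : set (polg k n)) p' j' -> (j'%:Z - p'%:Z <= j%:Z - p%:Z)%R) ->
  reg_quot I = EFin (j%:Z - p%:Z).
Proof.
move=> hI Ipj maxI; apply: supremum_max.
  by exists (p, j) => //; apply/betti_supportP.
move=> _ [[p' j'] /(betti_supportP _ _ hI) H <-]; rewrite lee_fin; exact: maxI.
Qed.

Lemma reg_quot_unit I : homogeneous_ideal I -> I 1 -> reg_quot I = ENInf int.
Proof.
move=> hI I1; rewrite /reg_quot.
have -> : [set EFin (ij.2%:Z - ij.1%:Z) | ij in betti_support I] = set0.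
  apply/seteqP; split=> // x [[p j] /(betti_supportP _ _ hI)[a [_ _ _ na]] _].
  case: na; exists 0 => T; have [[_ _ IM] _] := hI; by rewrite -[X in I X]mulr1; apply: IM.
exact: supremum0.
Qed.

End Depth.

(** * Filtered tensor products *)

Section Tensor.
Variable k : fieldType.

(** Kept abstract so that the same lemmas serve the rings, their Koszul complexes and the
    transposes. Uniqueness in the universal property follows from [tmul_span]. *)
Record tensor (X Y Z : lmodType k) := Tensor {
  tmul :> X -> Y -> Z;
  tmul_linl : forall v, linear (tmul^~ v);
  tmul_linr : forall u, linear (tmul u);
  tmul_span : forall z, span_of [set z | exists u v, z = tmul u v] z;
  tmul_univ : forall (W : lmodType k) (B : X -> Y -> W),
    (forall v, linear (B^~ v)) -> (forall u, linear (B u)) ->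
    exists L : {linear Z -> W}, forall u v, L (tmul u v) = B u v
}.

Section TensorTheory.
Variables (X Y Z : lmodType k) (t : tensor X Y Z).

Lemma tmulDl u u' v : t (u + u') v = t u v + t u' v.
Proof. by have := tmul_linl t v 1 u u'; rewrite !scale1r. Qed.

Lemma tmulDr u v v' : t u (v + v') = t u v + t u v'.
Proof. by have := tmul_linr t u 1 v v'; rewrite !scale1r. Qed.

Lemma tmul0l v : t 0 v = 0.
Proof. by apply: (@addrI _ (t 0 v)); rewrite -tmulDl !addr0. Qed.

Lemma tmul0r u : t u 0 = 0.
Proof. by apply: (@addrI _ (t u 0)); rewrite -tmulDr !addr0. Qed.

Lemma tmulZl c u v : t (c *: u) v = c *: t u v.
Proof. by have := tmul_linl t v c u 0; rewrite !addr0 tmul0l addr0. Qed.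

Lemma tmulZr c u v : t u (c *: v) = c *: t u v.
Proof. by have := tmul_linr t u c v 0; rewrite !addr0 tmul0r addr0. Qed.

Lemma tmulNl u v : t (- u) v = - t u v.
Proof. by rewrite -scaleN1r tmulZl scaleN1r. Qed.

Lemma tmulNr u v : t u (- v) = - t u v.
Proof. by rewrite -scaleN1r tmulZr scaleN1r. Qed.

Lemma tmulBl u u' v : t (u - u') v = t u v - t u' v.
Proof. by rewrite tmulDl tmulNl. Qed.

Lemma tmulBr u v v' : t u (v - v') = t u v - t u v'.
Proof. by rewrite tmulDr tmulNr. Qed.

Lemma tmul_ind (W : set Z) : is_subspace W -> (forall u v, W (t u v)) -> forall z, W z.
Proof.
by move=> sW Wt z; have := @tmul_span _ _ _ t z; apply: span_min => // _ [u [v ->]].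
Qed.

Lemma tmul_suml (I : Type) (r : seq I) (P : pred I) (F : I -> X) v :
  t (\sum_(i <- r | P i) F i) v = \sum_(i <- r | P i) t (F i) v.
Proof. by elim/big_rec2: _ => [|i y1 y2 _ <-]; rewrite ?tmul0l ?tmulDl. Qed.

Lemma tmul_sumr (I : Type) (r : seq I) (P : pred I) (F : I -> Y) u :
  t u (\sum_(i <- r | P i) F i) = \sum_(i <- r | P i) t u (F i).
Proof. by elim/big_rec2: _ => [|i y1 y2 _ <-]; rewrite ?tmul0r ?tmulDr. Qed.

Definition tens (U : set X) (W : set Y) : set Z :=
  span_of [set z | exists u v, [/\ U u, W v & z = t u v]].

Lemma tens_subspace U W : is_subspace (tens U W).
Proof. exact: span_is_subspace. Qed.

Lemma tens_mem (U : set X) (W : set Y) u v : U u -> W v -> tens U W (t u v).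
Proof. by move=> Uu Wv; apply: sub_span; exists u, v. Qed.

Lemma tens_min (U : set X) (W : set Y) (E : set Z) : is_subspace E ->
  (forall u v, U u -> W v -> E (t u v)) -> tens U W `<=` E.
Proof. by move=> sE UWE; apply: span_min => // _ [u [v [Uu Wv ->]]]; apply: UWE. Qed.

Definition tfilt (U : nat -> set X) (W : nat -> set Y) (s : nat) : set Z :=
  span_of [set z | exists i u v, [/\ (i <= s)%N, U i u, W (s - i)%N v & z = t u v]].

Lemma tfilt_subspace U W s : is_subspace (tfilt U W s).
Proof. exact: span_is_subspace. Qed.

Lemma tfilt_mem (U : nat -> set X) (W : nat -> set Y) i j u v :
  U i u -> W j v -> tfilt U W (i + j) (t u v).
Proof.
by move=> Uu Wv; apply: sub_span; exists i, u, v; rewrite leq_addr addKn.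
Qed.

Lemma tfilt_min (U : nat -> set X) (W : nat -> set Y) s (E : set Z) : is_subspace E ->
  (forall i j u v, (i + j)%N = s -> U i u -> W j v -> E (t u v)) -> tfilt U W s `<=` E.
Proof.
move=> sE UWE; apply: span_min => // _ [i [u [v [le_is Uu Wv ->]]]].
by apply: (UWE i (s - i)%N) => //; rewrite subnKC.
Qed.

Lemma tmul_left (f : {linear X -> X}) : exists L : {linear Z -> Z},
  forall u v, L (t u v) = t (f u) v.
Proof.
apply: tmul_univ => [v c u u'|u c v v'] /=; last by rewrite tmulDr tmulZr.
by rewrite linearP tmulDl tmulZl.
Qed.

Lemma tmul_right (g : {linear Y -> Y}) : exists L : {linear Z -> Z},
  forall u v, L (t u v) = t u (g v).
Proof.
apply: tmul_univ => [v c u u'|u c v v'] /=; first by rewrite tmulDl tmulZl.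
by rewrite linearP tmulDr tmulZr.
Qed.

Lemma tmul_functional (psi : {linear Y -> k^o}) : exists L : {linear Z -> X},
  forall u v, L (t u v) = psi v *: u.
Proof.
apply: tmul_univ => [v c u u'|u c v v'] /=.
  by rewrite scalerDr !scalerA mulrC.
by rewrite linearP scalerDl scalerA.
Qed.

(** Contractions with functionals on the right factor separate points; for polynomial rings
    coefficient functionals suffice. *)
Definition tsep : Prop := forall z : Z,
  (forall (psi : {linear Y -> k^o}) (L : {linear Z -> X}),
     (forall u v, L (t u v) = psi v *: u) -> L z = 0) -> z = 0.

(** With a projector rho onto [U], no contraction distinguishes z from its image under rho (x) 1,
    which lies in U (x) Y. *)
Lemma tens_sep (U : set X) z : is_subspace U -> tsep ->
  (forall (psi : {linear Y -> k^o}) (L : {linear Z -> X}),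
     (forall u v, L (t u v) = psi v *: u) -> U (L z)) -> tens U setT z.
Proof.
move=> sU sep Uz; have [rho [rho1 rho2]] := exists_projector sU.
have [R RE] := tmul_left rho.
have RU w : tens U setT (R w).
  apply: (@tmul_ind (R @^-1` tens U setT)) => [|u v] /=.
    by apply: preim_subspace; apply: tens_subspace.
  by rewrite RE; apply: tens_mem.
suff -> : z = R z by [].
apply/subr0_eq/sep => psi L LE; rewrite linearB /=.
have -> : L (R z) = rho (L z).
  apply: (@tmul_ind [set w | L (R w) = rho (L w)]) => [|u v] /=; last by rewrite RE !LE linearZ.
  split=> /= [|w w' h h'|c w h]; first by rewrite !linear0.
    by rewrite !linearD h h'.
  by rewrite !linearZ h.
by rewrite rho2 ?subrr //; apply: Uz LE.
Qed.

Section FiltrationDecomposition.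
Variables (U : nat -> set X) (W : nat -> set Y).
Hypotheses (sU : forall i, is_subspace (U i)) (sW : forall j, is_subspace (W j)).
Hypotheses (Um : forall i, U i.+1 `<=` U i) (Wm : forall j, W j.+1 `<=` W j).
Hypotheses (U0 : U 0 = setT) (W0 : W 0 = setT).

Lemma filt_le (V : Type) (F : nat -> set V) : (forall i, F i.+1 `<=` F i) ->
  forall i j, (i <= j)%N -> F j `<=` F i.
Proof.
move=> Fm i; elim=> [|j IH]; first by rewrite leqn0 => /eqP ->.
by rewrite leq_eqVlt => /orP[/eqP -> //|/IH]; apply: subset_trans.
Qed.

(* Linear projectors q l onto W l split an element into its components
   1 (x) (q l - q l.+1). *)
Lemma tfilt_decomposition s : exists (D : nat -> {linear Z -> Z}),
  [/\ forall z, z = \sum_(l < s.+1) D l z,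
      forall l z, (l <= s)%N -> tfilt U W s z -> tens (U (s - l)%N) (W l) (D l z),
      forall l z, tens setT (W l) (D l z),
      forall l (E : set X) z, tens E setT (D l z) -> tens E (W l) (D l z) &
      forall l, exists g : {linear Y -> Y}, forall u v, D l (t u v) = t u (g v)].
Proof.
pose id' : {linear Y -> Y} := idfun.
pose q (j : nat) : {linear Y -> Y} :=
  if j is 0 then id' else projT1 (cid (exists_projector (sW j))).
have qW j v : W j (q j v) by case: j => [|j]; rewrite /q ?W0 //; case: cid => f [].
have qid j v : W j v -> q j v = v.
  by case: j => [//|j]; rewrite /q; case: cid => f /= [_]; apply.
pose dq l : {linear Y -> Y} := q l \- q l.+1.
(* The last component is [q s] itself, so that the telescoping sum ends with the identity. *)
pose g l : {linear Y -> Y} := if (l < s)%N then dq l else q l.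
have gW l v : W l (g l v).
  rewrite /g; case: ifP => _ //=; apply: subspaceB => //; exact: Wm.
have g0 l j v : (l < s)%N -> (l < j)%N -> W j v -> g l v = 0.
  move=> ls lj Wj; rewrite /g ls /= [q l v]qid; last exact: (filt_le Wm (ltnW lj) Wj).
  rewrite [q l.+1 v]qid ?subrr //; exact: (filt_le Wm lj Wj).
have qg l v : q l (g l v) = g l v by rewrite qid.
have H l := tmul_right (g l).
pose D l := projT1 (cid (H l)).
have DE l u v : D l (t u v) = t u (g l v) by rewrite /D; case: cid.
have gsum v : v = \sum_(l < s.+1) g l v.
  have tel m : v = \sum_(l < m) (q l v - q l.+1 v) + q m v.
    elim: m => [|m IH]; first by rewrite big_ord0 add0r.
    by rewrite big_ord_recr /= -addrA subrK.
  rewrite {1}(tel s) big_ord_recr /= {2}/g ltnn; congr (_ + _).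
  by apply: eq_bigr => l _; rewrite /g ltn_ord.
exists D; split.
- apply: tmul_ind => [|u v]; last first.
    by under eq_bigr do rewrite DE; rewrite -tmul_sumr -gsum.
  split=> [|w w' h h'|c w h]; first by rewrite big1 // => l _; rewrite linear0.
    by rewrite {1}h {1}h' -big_split; apply: eq_bigr => l _; rewrite linearD.
  by rewrite {1}h scaler_sumr; apply: eq_bigr => l _; rewrite linearZ.
- move=> l z ls; have : tfilt U W s `<=` D l @^-1` tens (U (s - l)%N) (W l); last by apply.
  apply: tfilt_min => [|i j u v ijs Ui Wj /=].
    by apply: preim_subspace; apply: tens_subspace.
  rewrite DE; have [lj|jl] := ltnP l j.
    have ls' : (l < s)%N by rewrite -ijs (leq_trans lj) // leq_addl.
    by rewrite (g0 _ j) // tmul0r; have [] := tens_subspace (U (s - l)%N) (W l).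
  by apply: tens_mem => //; apply: (filt_le Um _ Ui); lia.
- move=> l z; move: z; apply: (@tmul_ind (D l @^-1` tens setT (W l))) => [|u v] /=.
    by apply: preim_subspace; apply: tens_subspace.
  by rewrite DE; apply: tens_mem.
- move=> l E z Ez; have [R RE] := tmul_right (q l).
  have -> : D l z = R (D l z).
    apply: (@tmul_ind [set z | D l z = R (D l z)]) => [|u v] /=; last by rewrite DE RE qg.
    split=> /= [|w w' h h'|c w h]; first by rewrite !linear0.
      by rewrite !linearD -h -h'.
    by rewrite !linearZ -h.
  have : tens E setT `<=` R @^-1` tens E (W l); last by apply.
  apply: tens_min => [|u v Eu _ /=]; last by rewrite RE; apply: tens_mem.
  by apply: preim_subspace; apply: tens_subspace.
- by move=> l; exists (g l) => u v; rewrite DE.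
Qed.

(** The components [D l] act on the right factor and hence commute with the operators [alpha].
    Within one component only U_(s-l) matters, and functionals on the right factor reduce membership
    to [X]. *)
Lemma tfilt_colon_left (J : Type) (alpha : J -> {linear X -> X}) s z : tsep ->
  (forall a (L : {linear Z -> Z}), (forall u v, L (t u v) = t (alpha a u) v) ->
     tfilt U W s (L z)) ->
  tfilt (fun i => [set u | forall a, U i (alpha a u)]) W s z.
Proof.
move=> sep Hz; have [D [Dsum DU DW DE Dt]] := tfilt_decomposition s.
set U' := fun i : nat => [set u | forall a, U i (alpha a u)].
have sU' i : is_subspace (U' i).
  have [V0 VD VZ] := sU i; split=> [a|u v Uu Uv a|c u Uu a].
  - by rewrite linear0.
  - by rewrite linearD; apply: VD; [apply: Uu|apply: Uv].
  - by rewrite linearZ; apply: VZ; apply: Uu.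
rewrite (Dsum z); apply: subspace_sum => [|l _]; first exact: tfilt_subspace.
have ls : (l <= s)%N by rewrite -ltnS.
have : tens (U' (s - l)%N) (W l) (D l z); last first.
  apply: tens_min => [|u v Uu Wv]; first exact: tfilt_subspace.
  by rewrite -[in tfilt _ _ s](subnK ls); apply: tfilt_mem.
apply: DE; apply: tens_sep => // psi L LE a.
have [A AE] := tmul_left (alpha a); have [g Dg] := Dt l.
have := DU l (A z) ls (Hz a A AE).
have EA : D l (A z) = A (D l z).
  apply: (@tmul_ind [set z | D l (A z) = A (D l z)]) => [|u v] /=; last by rewrite AE !Dg AE.
  split=> /= [|w w' h h'|c w h]; first by rewrite !linear0.
    by rewrite !linearD h h'.
  by rewrite !linearZ h.
rewrite EA; set w := D l z => Hw.
have EL : alpha a (L w) = L (A w).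
  apply: (@tmul_ind [set z | alpha a (L z) = L (A z)]) => [|u v] /=; last by rewrite AE !LE linearZ.
  split=> /= [|x x' h h'|c x h]; first by rewrite !linear0.
    by rewrite !linearD h h'.
  by rewrite !linearZ /= h.
rewrite EL; have : tens (U (s - l)%N) (W l) `<=` L @^-1` U (s - l)%N; last by apply.
apply: tens_min => [|u v Uu Wv /=]; first exact: preim_subspace.
by rewrite LE; have [_ _ VZ] := sU (s - l)%N; apply: VZ.
Qed.

(** Identifies the l-th graded piece of the filtration. A projector onto [W l] on the right fixes z;
    a summand U_i (x) W_j goes to U_(s-l) (x) W_l if j <= l and to X (x) W_(l+1) otherwise. *)
Lemma tfilt_cap l s z : (l <= s)%N -> tens setT (W l) z -> tfilt U W s z ->
  sum_set (tens (U (s - l)%N) (W l)) (tens setT (W l.+1)) z.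
Proof.
move=> ls Wz Uz; have [q [qW qid]] := exists_projector (sW l).
have [R RE] := tmul_right q; set E := sum_set _ _.
have sE : is_subspace E by apply: sum_set_subspace; apply: tens_subspace.
have <- : R z = z.
  have : tens setT (W l) `<=` [set z | R z = z]; last by apply.
  apply: tens_min => [|u v _ Wv /=]; last by rewrite RE qid.
  split=> /= [|x x' h h'|c x h]; first by rewrite linear0.
    by rewrite linearD h h'.
  by rewrite linearZ h.
have : tfilt U W s `<=` R @^-1` E; last by apply.
apply: tfilt_min => [|i j u v ijs Ui Wj /=]; first exact: preim_subspace.
rewrite RE; have [lj|jl] := ltnP l j.
  apply: sum_setr; first by have [] := tens_subspace (U (s - l)%N) (W l).
  rewrite qid; last exact: (filt_le Wm (ltnW lj) Wj).
  by apply: tens_mem => //; apply: (filt_le Wm lj Wj).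
apply: sum_setl; first by have [] := tens_subspace setT (W l.+1).
by apply: tens_mem => //; apply: (filt_le Um _ Ui); lia.
Qed.

End FiltrationDecomposition.
End TensorTheory.

Section Transpose.
Variables (X Y Z : lmodType k) (t : tensor X Y Z).

Definition ttr : tensor Y X Z.
refine (@Tensor Y X Z (fun v u => t u v) _ _ _ _).
- exact: tmul_linr.
- exact: tmul_linl.
- move=> z; have := @tmul_span _ _ _ t z; apply: span_mono => _ [u [v ->]].
  by exists v, u.
- move=> W B B1 B2; have [L LE] := @tmul_univ _ _ _ t W (fun u v => B v u) B2 B1.
  by exists L.
Defined.

Lemma tfilt_ttr (U : nat -> set X) (W : nat -> set Y) s z :
  tfilt t U W s z -> tfilt ttr W U s z.
Proof.
have : tfilt t U W s `<=` tfilt ttr W U s; last by apply.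
apply: tfilt_min => [|i j u v <- Uu Wv]; first exact: tfilt_subspace.
by rewrite addnC; apply: (@tfilt_mem _ _ _ ttr).
Qed.

End Transpose.
End Tensor.

(** * The polynomial ring R as a tensor product *)

Section PolynomialTensor.
Variables (k : fieldType) (d e : nat).
Local Notation A := {mpoly k[d]}.
Local Notation B := {mpoly k[e]}.
Local Notation R := {mpoly k[d + e]}.
Local Notation inl := (@incl_left k d e).
Local Notation inr := (@incl_right k d e).

HB.instance Definition _ := GRing.RMorphism.copy inl
  (comp_mpoly [tuple 'X_(lshift e i) : R | i < d]).
HB.instance Definition _ := GRing.RMorphism.copy inr
  (comp_mpoly [tuple 'X_(rshift d i) : R | i < e]).

Lemma inl_linear : linear inl.
Proof. by move=> c u v; rewrite /incl_left comp_mpolyD comp_mpolyZ. Qed.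
Lemma inr_linear : linear inr.
Proof. by move=> c u v; rewrite /incl_right comp_mpolyD comp_mpolyZ. Qed.
HB.instance Definition _ := GRing.isLinear.Build _ _ _ _ inl inl_linear.
HB.instance Definition _ := GRing.isLinear.Build _ _ _ _ inr inr_linear.

Lemma mpoly_ind_subspace (n : nat) (W : set {mpoly k[n]}) : is_subspace W ->
  (forall m, W 'X_[m]) -> forall p, W p.
Proof.
move=> sW WX p; rewrite [p]mpolyE; apply: subspace_sum => // m _.
by have [_ _ WZ] := sW; apply: WZ.
Qed.

Definition mcat (m1 : 'X_{1..d}) (m2 : 'X_{1..e}) : 'X_{1..d + e} :=
  [multinom match split i with Datatypes.inl a => m1 a | Datatypes.inr b => m2 b end | i < d + e].

Definition mleft (m : 'X_{1..d + e}) : 'X_{1..d} := [multinom m (lshift e i) | i < d].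
Definition mright (m : 'X_{1..d + e}) : 'X_{1..e} := [multinom m (rshift d i) | i < e].

Lemma mcat_lshift m1 m2 i : mcat m1 m2 (lshift e i) = m1 i.
Proof. by rewrite mnmE -[lshift e i]/(unsplit (Datatypes.inl i)) unsplitK. Qed.

Lemma mcat_rshift m1 m2 i : mcat m1 m2 (rshift d i) = m2 i.
Proof. by rewrite mnmE -[rshift d i]/(unsplit (Datatypes.inr i)) unsplitK. Qed.

Lemma mcatK m : mcat (mleft m) (mright m) = m.
Proof.
apply/mnmP => i; rewrite -[i]splitK; case: (split i) => j /=.
  by rewrite mcat_lshift mnmE.
by rewrite mcat_rshift mnmE.
Qed.

Lemma mleft_mcat m1 m2 : mleft (mcat m1 m2) = m1.
Proof. by apply/mnmP => i; rewrite mnmE mcat_lshift. Qed.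

Lemma mright_mcat m1 m2 : mright (mcat m1 m2) = m2.
Proof. by apply/mnmP => i; rewrite mnmE mcat_rshift. Qed.

Lemma inclX m1 m2 : inl 'X_[m1] * inr 'X_[m2] = 'X_[mcat m1 m2].
Proof.
rewrite /incl_left /incl_right !comp_mpolyX [RHS]mpolyXE_id big_split_ord /=.
by congr (_ * _); apply: eq_bigr => i _; rewrite tnth_mktuple ?mcat_lshift ?mcat_rshift.
Qed.

Definition pmul (u : A) (v : B) : R := inl u * inr v.

Definition ptens : tensor A B R.
refine (@Tensor k A B R pmul _ _ _ _).
- by move=> v c u u'; rewrite /pmul inl_linear mulrDl scalerAl.
- by move=> u c v v'; rewrite /pmul inr_linear mulrDr scalerAr.
- apply: mpoly_ind_subspace => [|m]; first exact: span_is_subspace.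
  apply: sub_span; exists 'X_[mleft m], 'X_[mright m].
  by rewrite /pmul inclX mcatK.
- move=> W Bf B1 B2.
  pose L : {linear R -> W} := lext (fun m => Bf 'X_[mleft m] 'X_[mright m]).
  exists L => u v.
  have sub0 (f : A -> W) : linear f -> f 0 = 0.
    by move=> lf; have := lf (-1) 0 0; rewrite !scaleN1r oppr0 addr0 addNr.
  have sub0' (f : B -> W) : linear f -> f 0 = 0.
    by move=> lf; have := lf (-1) 0 0; rewrite !scaleN1r oppr0 addr0 addNr.
  apply: (@mpoly_ind_subspace d [set u | forall v, L (pmul u v) = Bf u v]) => [|m1].
  + split=> [v'|u1 u2 h1 h2 v'|c u1 h1 v'].
    * by rewrite /pmul linear0 mul0r linear0 (sub0 (Bf^~ v')).
    * have := B1 v' 1 u1 u2; rewrite !scale1r => ->.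
      by rewrite /pmul linearD mulrDl linearD /= -/(pmul _ _) -/(pmul _ _) h1 h2.
    * have := B1 v' c u1 0; rewrite !addr0 (sub0 (Bf^~ v')) // addr0 => ->.
      by rewrite /pmul linearZ -scalerAl linearZ /= -/(pmul _ _) h1.
  + apply: mpoly_ind_subspace => [|m2] /=; last first.
      by rewrite /pmul inclX [LHS]lextX mleft_mcat mright_mcat.
    split=> /= [|u1 u2 h1 h2|c u1 h1].
    * by rewrite /pmul linear0 mulr0 linear0 (sub0' (Bf 'X_[m1])).
    * have := B2 'X_[m1] 1 u1 u2; rewrite !scale1r => ->.
      by rewrite /pmul linearD mulrDr linearD /= -/(pmul _ _) -/(pmul _ _) h1 h2.
    * have := B2 'X_[m1] c u1 0; rewrite !addr0 (sub0' (Bf 'X_[m1])) // addr0 => ->.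
      by rewrite /pmul linearZ -scalerAr linearZ /= -/(pmul _ _) h1.
Defined.

Lemma ptensE u v : ptens u v = inl u * inr v.
Proof. by []. Qed.

Lemma ptensM u v u' v' : ptens u v * ptens u' v' = ptens (u * u') (v * v').
Proof. by rewrite !ptensE !rmorphM mulrACA. Qed.

End PolynomialTensor.

(** * Saturated powers of ideals *)

Section SaturatedPowers.
Variable S : comNzRingType.
Implicit Types (I J C N : set S).

Lemma ideal_mul_ideal I J : is_ideal (ideal_mul I J).
Proof. exact: ideal_gen_ideal. Qed.

Lemma ideal_exp_ideal I s : is_ideal (ideal_exp I s).
Proof. by case: s => [|s] //; apply: ideal_mul_ideal. Qed.

Lemma ideal_mul_mem I J f g : I f -> J g -> ideal_mul I J (f * g).
Proof. by move=> If Jg; apply: sub_ideal_gen; exists f => //; exists g. Qed.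

Lemma ideal_mul_min I J N : is_ideal N -> (forall f g, I f -> J g -> N (f * g)) ->
  ideal_mul I J `<=` N.
Proof. by move=> idN H; apply: ideal_gen_min => // _ [f If [g Jg <-]]; apply: H. Qed.

Lemma ideal_exp_anti I i j : (i <= j)%N -> ideal_exp I j `<=` ideal_exp I i.
Proof.
elim: j => [|j IH]; first by rewrite leqn0 => /eqP ->.
rewrite leq_eqVlt => /orP[/eqP -> //|/IH]; apply: subset_trans.
apply: ideal_mul_min; first exact: ideal_exp_ideal.
by move=> f g _ Jg; have [_ _ M] := ideal_exp_ideal I j; apply: M.
Qed.

Lemma ideal_expD I i j f g : ideal_exp I i f -> ideal_exp I j g -> ideal_exp I (i + j) (f * g).
Proof.
elim: i f => [|i IH] f If Jg.
  by have [_ _ M] := ideal_exp_ideal I j; apply: M.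
have idN := ideal_exp_ideal I (i.+1 + j).
suff : ideal_mul I (ideal_exp I i) `<=` [set f | ideal_exp I (i.+1 + j) (f * g)] by apply.
apply: ideal_mul_min.
  have [N0 ND NM] := idN; split=> /= [|u v Nu Nv|r u Nu].
  - by rewrite mul0r.
  - by rewrite mulrDl; apply: ND.
  - by rewrite -mulrA; apply: NM.
move=> a b Ia Ib /=; rewrite -mulrA; apply: ideal_mul_mem => //; exact: IH.
Qed.

Lemma sat_power_ideal I C s : is_ideal (sat_power I C s).
Proof.
have idI := ideal_exp_ideal I s; have [I0 ID IM] := idI; split.
- by exists 1 => // g _; rewrite mul0r.
- move=> f g [i /= i1 fi] [j /= j1 gj]; exists (maxn i j); first by rewrite /= leq_max i1.
  move=> h Ch; rewrite mulrDl; apply: ID; [apply: fi|apply: gj];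
    by apply: ideal_exp_anti Ch; rewrite ?leq_maxl ?leq_maxr.
- by move=> r f [i i1 fi]; exists i => // h Ch; rewrite -mulrA; apply: IM; apply: fi.
Qed.

Lemma sat_power_anti I C s : sat_power I C s.+1 `<=` sat_power I C s.
Proof.
move=> f [i i1 fi]; exists i => // g Cg.
by apply: (@ideal_exp_anti I s s.+1) => //; apply: fi.
Qed.

Lemma sat_power0 I C : sat_power I C 0 = setT.
Proof. by apply/seteqP; split=> // f _; exists 1. Qed.

Lemma sat_power_sub I C s : ideal_exp I s `<=` sat_power I C s.
Proof.
move=> f If; exists 1 => // g _; rewrite mulrC.
by have [_ _ M] := ideal_exp_ideal I s; apply: M.
Qed.

Lemma ideal_unit I : is_ideal I -> I 1 -> I = setT.
Proof. by move=> [_ _ M] I1; apply/seteqP; split=> // f _; rewrite -[f]mulr1; apply: M. Qed.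

(** The hypothesis gives C^t inside I, hence C^(t(s+1)) inside I^(s+1). *)
Lemma sat_power_unit I C : is_ideal I -> sat_power I C 1 1 -> forall s, sat_power I C s 1.
Proof.
move=> idI [t t1 It] s.
have CI : ideal_exp C t `<=` I.
  move=> g /It; rewrite mul1r; apply: ideal_mul_min => // f h If _.
  by rewrite mulrC; have [_ _ M] := idI; apply: M.
(* The factor s + 1 instead of s keeps the exponent positive for s = 0. *)
exists (t * s.+1)%N; first by rewrite /= muln_gt0 t1.
move=> g Cg; rewrite mul1r; apply: (@ideal_exp_anti I s s.+1) => //.
elim: s.+1 g Cg => [//|r IH] g; rewrite mulnS.
have split i j h : ideal_exp C (i + j) h -> ideal_mul (ideal_exp C i) (ideal_exp C j) h.
  elim: i h => [|i IHi] h Ch.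
    by rewrite -[h]mul1r; apply: ideal_mul_mem.
  suff : ideal_mul C (ideal_exp C (i + j)) `<=` ideal_mul (ideal_exp C i.+1) (ideal_exp C j) by apply.
  apply: ideal_mul_min; first exact: ideal_mul_ideal.
  move=> a b Ca /IHi; have idN := ideal_mul_ideal (ideal_exp C i.+1) (ideal_exp C j).
  suff : ideal_mul (ideal_exp C i) (ideal_exp C j) `<=`
    [set b | ideal_mul (ideal_exp C i.+1) (ideal_exp C j) (a * b)] by apply.
  apply: ideal_mul_min => [|u v Cu Cv /=].
    have [N0 ND NM] := idN; split=> /= [|u v Nu Nv|c u Nu].
    - by rewrite mulr0.
    - by rewrite mulrDr; apply: ND.
    - by rewrite mulrCA; apply: NM.
  by rewrite mulrA; apply: ideal_mul_mem => //; apply: ideal_mul_mem.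
move=> /split; apply: ideal_mul_min; first exact: ideal_exp_ideal.
by move=> u v /CI Iu /IH Iv; apply: ideal_mul_mem.
Qed.

End SaturatedPowers.

Lemma ideal_subspace (k : fieldType) (n : nat) (I : set {mpoly k[n]}) :
  is_ideal I -> is_subspace I.
Proof.
by case=> I0 ID IM; split=> // c u Iu; rewrite -mul_mpolyC; apply: IM.
Qed.

(** * The binomial formula for saturated powers *)

Section BinomialFormula.
Variables (k : fieldType) (d e : nat).
Local Notation A := {mpoly k[d]}.
Local Notation B := {mpoly k[e]}.
Local Notation R := {mpoly k[d + e]}.
Local Notation inl := (@incl_left k d e).
Local Notation inr := (@incl_right k d e).
Local Notation pt := (ptens k d e).

Lemma ptens_sep : tsep pt.
Proof.
move=> z Hz; apply/mpolyP => m; rewrite mcoeff0.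
pose psi : {linear B -> k^o} := mcoeff (mright m).
pose L : {linear R -> A} := lext (fun m' => ('X_[mright m'] : B)@_(mright m) *: 'X_[mleft m']).
have LE u v : L (pt u v) = psi v *: u.
  have [P PE] := tmul_functional pt psi; rewrite -PE.
  have : forall w, L w = P w; last by apply.
  apply: mpoly_ind_subspace => [|m'].
    split=> [|w w' h h'|c w h]; first by rewrite !linear0.
      by rewrite !linearD h h'.
    by rewrite !linearZ /= h.
  by rewrite [LHS]lextX -[in RHS](mcatK m') -inclX -[_ * _]/(pt _ _) PE.
have <- : (L z)@_(mleft m) = 0 by rewrite (Hz psi L LE) mcoeff0.
transitivity (z@_(mcat (mleft m) (mright m))); first by rewrite mcatK.
have : forall w : R, w@_(mcat (mleft m) (mright m)) = (L w)@_(mleft m); last by apply.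
apply: mpoly_ind_subspace => [|m'].
  split=> [|w w' h h'|c w h]; first by rewrite /= !linear0.
    by rewrite /= mcoeffD h h' -mcoeffD -linearD.
  by rewrite /= mcoeffZ h -mcoeffZ -linearZ.
rewrite [L _]lextX mcoeffZ !mcoeffX -natrM mulnb mcatK; congr (_%:R : k); congr nat_of_bool.
apply/eqP/andP => [->|[/eqP E1 /eqP E2]]; first by rewrite !eqxx.
by rewrite -[LHS]mcatK E1 E2 mcatK.
Qed.

Lemma ptens_sep_tr : tsep (ttr pt).
Proof.
move=> z Hz; apply/mpolyP => m; rewrite mcoeff0.
pose psi : {linear A -> k^o} := mcoeff (mleft m).
pose L : {linear R -> B} := lext (fun m' => ('X_[mleft m'] : A)@_(mleft m) *: 'X_[mright m']).
have LE u v : L (ttr pt u v) = psi v *: u.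
  have [P PE] := tmul_functional (ttr pt) psi; rewrite -PE.
  have : forall w, L w = P w; last by apply.
  apply: mpoly_ind_subspace => [|m'].
    split=> [|w w' h h'|c w h]; first by rewrite !linear0.
      by rewrite !linearD h h'.
    by rewrite !linearZ /= h.
  by rewrite [LHS]lextX -[in RHS](mcatK m') -inclX -[_ * _]/(ttr pt _ _) PE.
have <- : (L z)@_(mright m) = 0 by rewrite (Hz psi L LE) mcoeff0.
transitivity (z@_(mcat (mleft m) (mright m))); first by rewrite mcatK.
have : forall w : R, w@_(mcat (mleft m) (mright m)) = (L w)@_(mright m); last by apply.
apply: mpoly_ind_subspace => [|m'].
  split=> [|w w' h h'|c w h]; first by rewrite /= !linear0.
    by rewrite /= mcoeffD h h' -mcoeffD -linearD.
  by rewrite /= mcoeffZ h -mcoeffZ -linearZ.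
rewrite [L _]lextX mcoeffZ !mcoeffX -natrM mulnb mcatK; congr (_%:R : k); congr nat_of_bool.
apply/eqP/andP => [->|[/eqP E1 /eqP E2]]; first by rewrite !eqxx.
by rewrite -[LHS]mcatK E1 E2 mcatK.
Qed.

Lemma tfilt_ideal (U : nat -> set A) (W : nat -> set B) s :
  (forall i, is_ideal (U i)) -> (forall j, is_ideal (W j)) -> is_ideal (tfilt pt U W s).
Proof.
move=> idU idW; have [T0 TD TZ] := tfilt_subspace pt U W s; split=> // r f.
have : tfilt pt U W s `<=` [set f | forall r, tfilt pt U W s (r * f)]; last by move=> H /H.
apply: tfilt_min => [|i j u v <- Uu Wv r'].
  split=> [r'|u v Hu Hv r'|c u Hu r'].
  - by rewrite mulr0.
  - by rewrite mulrDr; apply: TD; [apply: Hu|apply: Hv].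
  - by rewrite -scalerAr; apply: TZ; apply: Hu.
apply: (@tmul_ind _ _ _ _ pt [set r | tfilt pt U W (i + j) (r * pt u v)]) => [|u' v'] /=.
  have [S0 SD SZ] := tfilt_subspace pt U W (i + j); split=> /= [|a b Ha Hb|c a Ha].
  - by rewrite mul0r.
  - by rewrite mulrDl; apply: SD.
  - by rewrite -scalerAl; apply: SZ.
rewrite ptensM; apply: tfilt_mem.
  by have [_ _ M] := idU i; apply: M.
by have [_ _ M] := idW j; apply: M.
Qed.

Lemma ext_left_min (I : set A) (N : set R) : is_ideal N ->
  (forall f, I f -> N (inl f)) -> ext_left e I `<=` N.
Proof. by move=> idN H; apply: ideal_gen_min => // _ [f If <-]; apply: H. Qed.

Lemma ext_right_min (J : set B) (N : set R) : is_ideal N ->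
  (forall f, J f -> N (inr f)) -> ext_right d J `<=` N.
Proof. by move=> idN H; apply: ideal_gen_min => // _ [f If <-]; apply: H. Qed.

Lemma colon1_ideal (S : comNzRingType) (N : set S) g : is_ideal N ->
  is_ideal [set f | N (f * g)].
Proof.
move=> [N0 ND NM]; split=> /= [|u v Nu Nv|r u Nu].
- by rewrite mul0r.
- by rewrite mulrDl; apply: ND.
- by rewrite -mulrA; apply: NM.
Qed.

Lemma preim_ideal (S S' : comNzRingType) (f : {rmorphism S -> S'}) (N : set S') :
  is_ideal N -> is_ideal (f @^-1` N).
Proof.
move=> [N0 ND NM]; split=> /= [|u v Nu Nv|r u Nu].
- by rewrite rmorph0.
- by rewrite rmorphD; apply: ND.
- by rewrite rmorphM; apply: NM.
Qed.

Lemma power_sum (I : set A) (J : set B) s :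
  ideal_exp (ideal_add (ext_left e I) (ext_right d J)) s =
  tfilt pt (ideal_exp I) (ideal_exp J) s.
Proof.
set E := ideal_add _ _.
have idF r : is_ideal (tfilt pt (ideal_exp I) (ideal_exp J) r).
  by apply: tfilt_ideal => i; apply: ideal_exp_ideal.
apply/seteqP; split.
  elim: s => [|s IH] f Ef.
    rewrite -[f]mulr1; have [_ _ M] := idF 0; apply: M.
    have -> : 1 = pt 1 1 :> R by rewrite ptensE !rmorph1 mulr1.
    by rewrite -[X in tfilt _ _ _ X](addn0 0); apply: tfilt_mem.
  suff : ideal_mul E (ideal_exp E s) `<=` tfilt pt (ideal_exp I) (ideal_exp J) s.+1 by apply.
  apply: ideal_mul_min => // _ g [f1 If1 [f2 Jf2 <-]] /IH Fg.
  rewrite mulrDl; have [_ D _] := idF s.+1; apply: D.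
    have [_ DD ZZ] := tfilt_subspace pt (ideal_exp I) (ideal_exp J) s.+1.
    move: f1 If1; apply: ext_left_min; first exact: colon1_ideal.
    move=> h If /=; move: g Fg.
    have : tfilt pt (ideal_exp I) (ideal_exp J) s `<=`
      [set g | tfilt pt (ideal_exp I) (ideal_exp J) s.+1 (inl h * g)]; last by apply.
    apply: tfilt_min => [|i j u v <- Iu Jv /=].
      split=> /= [|a b Ha Hb|c a Ha]; first by rewrite mulr0; case: (idF s.+1).
        by rewrite mulrDr; apply: DD.
      by rewrite -scalerAr; apply: ZZ.
    have -> : inl h * (pt u v) = pt (h * u) v by rewrite !ptensE rmorphM mulrA.
    by rewrite -addSn; apply: tfilt_mem => //; apply: ideal_mul_mem.
  have [_ DD ZZ] := tfilt_subspace pt (ideal_exp I) (ideal_exp J) s.+1.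
  move: f2 Jf2; apply: ext_right_min; first exact: colon1_ideal.
  move=> h If /=; move: g Fg.
  have : tfilt pt (ideal_exp I) (ideal_exp J) s `<=`
    [set g | tfilt pt (ideal_exp I) (ideal_exp J) s.+1 (inr h * g)]; last by apply.
  apply: tfilt_min => [|i j u v <- Iu Jv /=].
    split=> /= [|a b Ha Hb|c a Ha]; first by rewrite mulr0; case: (idF s.+1).
      by rewrite mulrDr; apply: DD.
    by rewrite -scalerAr; apply: ZZ.
  have -> : inr h * (pt u v) = pt u (h * v) by rewrite !ptensE rmorphM mulrCA.
  by rewrite -addnS; apply: tfilt_mem => //; apply: ideal_mul_mem.
have EL i u : ideal_exp I i u -> ideal_exp E i (inl u).
  elim: i u => [//|i IH] u Iu.
  suff : ideal_mul I (ideal_exp I i) `<=` inl @^-1` ideal_exp E i.+1 by apply.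
  apply: ideal_mul_min => [|f g If Ig]; first by apply: preim_ideal; apply: ideal_exp_ideal.
  rewrite /= rmorphM; apply: ideal_mul_mem; last exact: IH.
  exists (inl f); first by apply: sub_ideal_gen; exists f.
  by exists 0; rewrite ?addr0 //; case: (ideal_gen_ideal (inr @` J)).
have ER i u : ideal_exp J i u -> ideal_exp E i (inr u).
  elim: i u => [//|i IH] u Iu.
  suff : ideal_mul J (ideal_exp J i) `<=` inr @^-1` ideal_exp E i.+1 by apply.
  apply: ideal_mul_min => [|f g If Ig]; first by apply: preim_ideal; apply: ideal_exp_ideal.
  rewrite /= rmorphM; apply: ideal_mul_mem; last exact: IH.
  exists 0; first by case: (ideal_gen_ideal (inl @` I)).
  by exists (inr f); rewrite ?add0r //; apply: sub_ideal_gen; exists f.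
apply: tfilt_min => [|i j u v <- Iu Jv].
  exact/ideal_subspace/ideal_exp_ideal.
by rewrite ptensE; apply: ideal_expD; [apply: EL|apply: ER].
Qed.

(** Generators that are pure tensors allow the colon to be taken in A and in B separately. *)
Lemma power_prod (K : set A) (L : set B) s :
  ideal_exp (ideal_mul (ext_left e K) (ext_right d L)) s =
  ideal_gen [set z | exists a b, [/\ ideal_exp K s a, ideal_exp L s b & z = pt a b]].
Proof.
set E := ideal_mul _ _.
apply/seteqP; split.
  elim: s => [|s IH] f Ef.
    rewrite -[f]mulr1; have [_ _ M] := ideal_gen_ideal [set z | exists a b, [/\ ideal_exp K 0 a, ideal_exp L 0 b & z = pt a b]].
    apply: M; apply: sub_ideal_gen; exists 1, 1; split=> //.
    by rewrite ptensE !rmorph1 mulr1.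
  have [] := ideal_gen_ideal [set z | exists a b, [/\ ideal_exp K s.+1 a, ideal_exp L s.+1 b & z = pt a b]].
  set N := ideal_gen _ => N0 ND NM; have idN : is_ideal N by [].
  suff : ideal_mul E (ideal_exp E s) `<=` N by apply.
  apply: ideal_mul_min => // h g Eh /IH Gg; move: h Eh.
  suff : E `<=` [set h | N (h * g)] by [].
  apply: ideal_mul_min => [|f1 f2 Kf1 Lf2]; first exact: colon1_ideal.
  move: f1 Kf1 => /=; suff : ext_left e K `<=` [set f1 | N (f1 * (f2 * g))].
    by move=> H f1 /H /=; rewrite mulrA.
  apply: ext_left_min => [|f1 Kf1 /=]; first exact: colon1_ideal.
  rewrite mulrCA; move: f2 Lf2.
  suff : ext_right d L `<=` [set f2 | N (f2 * (inl f1 * g))] by [].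
  apply: ext_right_min => [|f2 Lf2 /=]; first exact: colon1_ideal.
  rewrite mulrC; move: g Gg.
  suff H : ideal_gen [set z | exists a b, [/\ ideal_exp K s a, ideal_exp L s b & z = pt a b]] `<=`
    [set g | N (g * (inl f1 * inr f2))].
    by move=> g /H /=; rewrite mulrCA mulrA mulrC; congr N; ring.
  apply: ideal_gen_min => [|_ [a [b [Ka Lb ->]]]] /=; first exact: colon1_ideal.
  apply: sub_ideal_gen; exists (f1 * a), (f2 * b); split; [exact: ideal_mul_mem..|].
  by rewrite -[inl f1 * _]/(pt f1 f2) mulrC ptensM.
apply: ideal_gen_min; first exact: ideal_exp_ideal.
move=> _ [a [b [Ka Lb ->]]]; elim: s a b Ka Lb => [//|s IH] a b Ka Lb.
have idE := ideal_exp_ideal E s.+1; have [E0 ED EM] := idE.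
rewrite ptensE; move: a Ka.
suff : ideal_mul K (ideal_exp K s) `<=` [set a | ideal_exp E s.+1 (inl a * inr b)] by [].
apply: ideal_mul_min => [|k1 a Kk1 Ka /=].
  have := preim_ideal inl (colon1_ideal (inr b) idE); exact.
move: b Lb.
suff : ideal_mul L (ideal_exp L s) `<=` [set b | ideal_exp E s.+1 (inl (k1 * a) * inr b)] by [].
apply: ideal_mul_min => [|l1 b Ll1 Lb /=].
  have := preim_ideal inr (colon1_ideal (inl (k1 * a)) idE); congr is_ideal.
  by apply/funext => b'; rewrite /= mulrC.
rewrite !rmorphM mulrACA; apply: ideal_mul_mem; last exact: IH.
by apply: ideal_mul_mem; apply: sub_ideal_gen; [exists k1|exists l1].
Qed.

Definition pmull (n : nat) (a : {mpoly k[n]}) (u : {mpoly k[n]}) := a * u.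
Lemma pmull_linear n a : linear (@pmull n a).
Proof. by move=> c u v; rewrite /pmull mulrDr scalerAr. Qed.
HB.instance Definition _ n a := GRing.isLinear.Build _ _ _ _ (@pmull n a) (pmull_linear a).

(* The binomial formula: [tfilt pt _ _ s] is the sum of the I^(i) J^(s - i). *)
Lemma sat_power_sum (I K : set A) (J L : set B) s :
  sat_power (ideal_add (ext_left e I) (ext_right d J))
            (ideal_mul (ext_left e K) (ext_right d L)) s =
  tfilt pt (sat_power I K) (sat_power J L) s.
Proof.
have idF : is_ideal (tfilt pt (ideal_exp I) (ideal_exp J) s).
  by apply: tfilt_ideal => i; apply: ideal_exp_ideal.
apply/seteqP; split.
  move=> f [t /= t1 Hf]; rewrite power_sum power_prod in Hf.
  have H1 a b : ideal_exp K t a -> ideal_exp L t b ->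
      tfilt pt (ideal_exp I) (ideal_exp J) s (pt a b * f).
    by move=> Ka Lb; rewrite mulrC; apply: Hf; apply: sub_ideal_gen; exists a, b.
  pose KT := {a | ideal_exp K t a}; pose LT := {b | ideal_exp L t b}.
  pose al (a : KT) : {linear A -> A} := pmull (sval a).
  pose be (b : LT) : {linear B -> B} := pmull (sval b).
  pose U' i := [set u | forall a, ideal_exp I i (al a u)].
  pose W' j := [set v | forall b, ideal_exp J j (be b v)].
  have sE (n : nat) (N : set {mpoly k[n]}) i : is_subspace (ideal_exp N i).
    exact/ideal_subspace/ideal_exp_ideal.
  have mE (n : nat) (N : set {mpoly k[n]}) i : ideal_exp N i.+1 `<=` ideal_exp N i.
    exact: ideal_exp_anti.
  (* For fixed b the colon by K^t is taken on the left factor; the colon by L^t is then taken on the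
     transposed product. *)
  have H2 (b : LT) : tfilt pt U' (ideal_exp J) s (pt 1 (sval b : B) * f).
    case: b => b Lb /=; apply: tfilt_colon_left.
    - by move=> i; apply: sE.
    - by move=> i; apply: sE.
    - by move=> i; apply: mE.
    - by move=> i; apply: mE.
    - by [].
    - exact: ptens_sep.
    move=> [a Ka] M ME.
    have -> : M (pt 1 b * f) = pt a b * f; last exact: H1.
    have MM : forall z, M z = inl a * z.
      apply: (@tmul_ind _ _ _ _ pt [set z | M z = inl a * z]) => [|u v] /=.
        split=> /= [|w w' h h'|c w h]; first by rewrite linear0 mulr0.
          by rewrite linearD h h' mulrDr.
        by rewrite linearZ /= h scalerAr.
      by rewrite ME !ptensE rmorphM mulrA.
    by rewrite MM !ptensE rmorph1 mul1r mulrA.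
  have H3 : tfilt pt U' W' s f.
    have := @tfilt_ttr _ _ _ _ (ttr pt) W' U' s f.
    suff : tfilt (ttr pt) W' U' s f.
      move=> Hf' H; have := H Hf'; apply: tfilt_min; first exact: tfilt_subspace.
      by move=> i j u v <- Uu Wv; apply: (@tfilt_mem _ _ _ _ pt).
    apply: tfilt_colon_left.
    - by move=> i; apply: sE.
    - move=> i; have [V0 VD VZ] := sE _ I i; split=> [a|u v Uu Uv a|c u Uu a].
      + by rewrite linear0.
      + by rewrite linearD; apply: VD; [apply: Uu|apply: Uv].
      + by rewrite linearZ; apply: VZ; apply: Uu.
    - by move=> i; apply: mE.
    - by move=> i u Uu a; apply: mE; apply: Uu.
    - by apply/seteqP; split.
    - exact: ptens_sep_tr.
    move=> b M ME; have -> : M f = pt 1 (sval b : B) * f.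
      apply: (@tmul_ind _ _ _ _ pt [set z | M z = pt 1 (sval b : B) * z]) => [|u v] /=.
        split=> /= [|w w' h h'|c w h]; first by rewrite linear0 mulr0.
          by rewrite linearD h h' mulrDr.
        by rewrite linearZ /= h scalerAr.
      by rewrite -[pmul u v]/(pt u v) ptensM mul1r; exact: (ME v u).
    exact: tfilt_ttr.
  move: H3; apply: tfilt_min => [|i j u v <- Uu Wv]; first exact: tfilt_subspace.
  apply: tfilt_mem; exists t => // g Kg; rewrite mulrC.
    exact: (Uu (exist _ g Kg)).
  exact: (Wv (exist _ g Kg)).
apply: tfilt_min; first exact/ideal_subspace/sat_power_ideal.
move=> i j u v ijs [t1 /= t1p Hu] [t2 /= t2p Hv]; exists (maxn t1 t2).
  by rewrite /= leq_max t1p.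
rewrite /ideal_colon power_prod power_sum => g Gg; rewrite mulrC; move: g Gg.
apply: ideal_gen_min; first exact: colon1_ideal.
move=> _ [a [b [Ka Lb ->]]] /=; rewrite ptensM -ijs; apply: tfilt_mem; rewrite mulrC.
  by apply: Hu; apply: ideal_exp_anti Ka; apply: leq_maxl.
by apply: Hv; apply: ideal_exp_anti Lb; apply: leq_maxr.
Qed.

End BinomialFormula.

(** * Koszul homology of the binomial filtration *)

Section KoszulTensor.
Local Open Scope set_scope.
Variables (k : fieldType) (d e : nat).
Local Notation A := {mpoly k[d]}.
Local Notation B := {mpoly k[e]}.
Local Notation R := {mpoly k[d + e]}.
Local Notation KA := {ffun {set 'I_d} -> A}.
Local Notation KB := {ffun {set 'I_e} -> B}.
Local Notation KR := {ffun {set 'I_(d + e)} -> R}.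
Local Notation pt := (ptens k d e).
Implicit Types (u : KA) (v : KB).

Definition sleft (T : {set 'I_(d + e)}) : {set 'I_d} := [set i | lshift e i \in T].
Definition sright (T : {set 'I_(d + e)}) : {set 'I_e} := [set i | rshift d i \in T].
Definition scat (T1 : {set 'I_d}) (T2 : {set 'I_e}) : {set 'I_(d + e)} :=
  [set i | match split i with Datatypes.inl a => a \in T1 | Datatypes.inr b => b \in T2 end].

Lemma scat_lshift T1 T2 i : (lshift e i \in scat T1 T2) = (i \in T1).
Proof. by rewrite inE -[lshift e i]/(unsplit (Datatypes.inl i)) unsplitK. Qed.

Lemma scat_rshift T1 T2 i : (rshift d i \in scat T1 T2) = (i \in T2).
Proof. by rewrite inE -[rshift d i]/(unsplit (Datatypes.inr i)) unsplitK. Qed.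

Lemma scatK T : scat (sleft T) (sright T) = T.
Proof.
apply/setP => i; rewrite -[i]splitK; case: (split i) => j /=.
  by rewrite scat_lshift inE.
by rewrite scat_rshift inE.
Qed.

Lemma sleft_scat T1 T2 : sleft (scat T1 T2) = T1.
Proof. by apply/setP => i; rewrite inE scat_lshift. Qed.

Lemma sright_scat T1 T2 : sright (scat T1 T2) = T2.
Proof. by apply/setP => i; rewrite inE scat_rshift. Qed.

Lemma card_split_ord (P : pred 'I_(d + e)) :
  #|[set i | P i]| = (#|[set i | P (lshift e i)]| + #|[set i | P (rshift d i)]|)%N.
Proof.
rewrite -!sum1dep_card big_mkcond big_split_ord /=.
by congr (_ + _)%N; rewrite [RHS]big_mkcond.
Qed.

Lemma card_sleft_sright (T : {set 'I_(d + e)}) : #|T| = (#|sleft T| + #|sright T|)%N.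
Proof.
have {1}-> : T = [set i | i \in T] by apply/setP => i; rewrite inE.
exact: card_split_ord.
Qed.

Definition kptmul u v : KR := [ffun T => pt (u (sleft T)) (v (sright T))].

Definition ksingle (n : nat) (V : zmodType) (T0 : {set 'I_n}) (f : V) : {ffun {set 'I_n} -> V} :=
  [ffun T => if T == T0 then f else 0].

Lemma ksingle_sum (n : nat) (V : zmodType) (u : {ffun {set 'I_n} -> V}) :
  u = \sum_T ksingle T (u T).
Proof.
apply/ffunP => T; rewrite sum_ffunE (bigD1 T) //= big1 ?addr0 ?ffunE ?eqxx // => T' ne.
by rewrite ffunE eq_sym (negbTE ne).
Qed.

Lemma ksingle_linear (n : nat) (V : lmodType k) (T0 : {set 'I_n}) : linear (@ksingle n V T0).
Proof.
move=> c f g; apply/ffunP => T; rewrite !ffunE.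
by case: (T == T0); rewrite ?scaler0 ?addr0.
Qed.
HB.instance Definition _ (n : nat) (V : lmodType k) (T0 : {set 'I_n}) :=
  GRing.isLinear.Build k V {ffun {set 'I_n} -> V} _ (@ksingle n V T0) (ksingle_linear T0).

Lemma kptmul_single T1 T2 f g :
  kptmul (ksingle T1 f) (ksingle T2 g) = ksingle (scat T1 T2) (pt f g).
Proof.
apply/ffunP => T; rewrite !ffunE.
case: (eqVneq T (scat T1 T2)) => [->|ne]; first by rewrite sleft_scat sright_scat !eqxx.
case: (eqVneq (sleft T) T1) => [E1|_]; last by rewrite tmul0l.
case: (eqVneq (sright T) T2) => [E2|_]; last by rewrite tmul0r.
by rewrite -E1 -E2 scatK eqxx in ne.
Qed.

Lemma linear_prop_sum (V W : lmodType k) (f : V -> W) (I : Type) (r : seq I) (F : I -> V) :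
  linear f -> f (\sum_(i <- r) F i) = \sum_(i <- r) f (F i).
Proof.
move=> lf; pose l := GRing.isLinear.Build k V W _ f lf.
pose g : {linear V -> W} := HB.pack f l.
exact: (linear_sum g).
Qed.

(** Splitting each index set into its two halves identifies the Koszul complex of R with the tensor
    product of those of A and B. *)
Definition ktens : tensor KA KB KR.
refine (@Tensor k KA KB KR kptmul _ _ _ _).
- by move=> v c u u'; apply/ffunP => T; rewrite !ffunE tmulDl tmulZl.
- by move=> u c v v'; apply/ffunP => T; rewrite !ffunE tmulDr tmulZr.
- move=> z; rewrite [z]ksingle_sum; apply: subspace_sum => [|T _]; first exact: span_is_subspace.
  apply: (@tmul_ind _ _ _ _ pt (ksingle T @^-1` span_of [set z | exists u v, z = kptmul u v]%classic)%classic).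
    by apply: preim_subspace; apply: span_is_subspace.
  move=> f g; apply: sub_span; exists (ksingle (sleft T) f), (ksingle (sright T) g).
  by rewrite kptmul_single scatK.
- move=> W Bf B1 B2.
  have H T : exists L : {linear R -> W}, forall f g,
      L (pt f g) = Bf (ksingle (sleft T) f) (ksingle (sright T) g).
    apply: tmul_univ => [g c f f'|f c g g'] /=; first by rewrite linearP B1.
    by rewrite linearP B2.
  pose L (z : KR) : W := \sum_T projT1 (cid (H T)) (z T).
  have Llin : linear L.
    move=> c z z'; rewrite /L scaler_sumr -big_split; apply: eq_bigr => T _ /=.
    by rewrite !ffunE linearP.
  pose l := GRing.isLinear.Build k KR W _ L Llin.
  pose L' : {linear KR -> W} := HB.pack L l.
  exists L' => u v; rewrite /= /L.
  transitivity (\sum_T Bf (ksingle (sleft T) (u (sleft T))) (ksingle (sright T) (v (sright T)))).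
    by apply: eq_bigr => T _; rewrite ffunE; case: cid => /= M ->.
  rewrite [u in RHS]ksingle_sum (linear_prop_sum _ _ (B1 _)).
  transitivity (\sum_T1 \sum_T2 Bf (ksingle T1 (u T1)) (ksingle T2 (v T2))); last first.
    by apply: eq_bigr => T1 _; rewrite [v in RHS]ksingle_sum (linear_prop_sum _ _ (B2 _)).
  rewrite pair_big /= (reindex (fun T => (sleft T, sright T))) //=.
  exists (fun p => scat p.1 p.2) => [T _|[T1 T2] _] /=; first exact: scatK.
  by rewrite sleft_scat sright_scat.
Defined.

Lemma ktensE u v T : ktens u v T = pt (u (sleft T)) (v (sright T)).
Proof. by rewrite /= ffunE. Qed.

Local Arguments tmul : simpl never.

Lemma sleftU_lshift i T : sleft (lshift e i |: T) = i |: sleft T.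
Proof. by apply/setP => j; rewrite !inE (inj_eq (@lshift_inj _ _)). Qed.

Lemma sleftU_rshift i T : sleft (rshift d i |: T) = sleft T.
Proof. by apply/setP => j; rewrite !inE eq_lrshift. Qed.

Lemma srightU_lshift i T : sright (lshift e i |: T) = sright T.
Proof. by apply/setP => j; rewrite !inE eq_rlshift. Qed.

Lemma srightU_rshift i T : sright (rshift d i |: T) = i |: sright T.
Proof. by apply/setP => j; rewrite !inE (inj_eq (@rshift_inj _ _)). Qed.

Lemma osign_lshift i T : osign (lshift e i) T = osign i (sleft T).
Proof.
rewrite /osign card_split_ord.
have -> : [set j | (rshift d j \in T) && (rshift d j < lshift e i)%N] = finset.set0.
  apply/setP => j; rewrite !inE /= [(_ < _)%N]negbTE ?andbF //.
  by rewrite -leqNgt; have := ltn_ord i; lia.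
rewrite cards0 addn0; congr (odd #|pred_of_set _|).
by apply/setP => j; rewrite !inE.
Qed.

(** All left basis vectors precede the right ones; the resulting sign is the [kpar] of
    [kos_ktens]. *)
Lemma osign_rshift i T : osign (rshift d i) T = odd #|sleft T| (+) osign i (sright T).
Proof.
rewrite /osign card_split_ord oddD; congr (odd _ (+) odd _); apply: eq_card => j.
  rewrite !inE /=; have := ltn_ord j; case: (_ \in T) => //=; lia.
by rewrite !inE /= ltn_add2l.
Qed.

Lemma csign_pt b f g : csign b (pt f g) = pt (csign b f) g.
Proof. by rewrite /csign; case: b; rewrite ?tmulNl. Qed.

Lemma csign_ptr b f g : csign b (pt f g) = pt f (csign b g).
Proof. by rewrite /csign; case: b; rewrite ?tmulNr. Qed.

Lemma mulX_ptl i f g : 'X_(lshift e i) * pt f g = pt ('X_i * f) g.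
Proof.
rewrite !ptensE rmorphM mulrA; congr (_ * _ * _).
by rewrite /= /incl_left comp_mpolyXU -tnth_nth tnth_mktuple.
Qed.

Lemma mulX_ptr i f g : 'X_(rshift d i) * pt f g = pt f ('X_i * g).
Proof.
rewrite !ptensE rmorphM mulrCA; congr (_ * (_ * _)).
by rewrite /= /incl_right comp_mpolyXU -tnth_nth tnth_mktuple.
Qed.

Lemma kos_ktens u v : kos (ktens u v) = ktens (kos u) v + ktens (kpar u) (kos v).
Proof.
apply/ffunP => T; rewrite [RHS]ffunE !ktensE /kos !(@koszulE _ (polg _ _)) big_split_ord.
rewrite tmul_suml tmul_sumr; congr (_ + _); apply: eq_bigr => i _.
  rewrite inE; case: ifP => _; first by rewrite tmul0l.
  rewrite ktensE sleftU_lshift srightU_lshift osign_lshift csign_pt.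
  exact: mulX_ptl.
rewrite inE; case: ifP => _; first by rewrite tmul0r.
rewrite ktensE sleftU_rshift srightU_rshift osign_rshift ffunE -csignA.
rewrite csign_ptr csign_pt; exact: mulX_ptr.
Qed.

Lemma kin_subspace (n : nat) (N : set {mpoly k[n]}) :
  is_subspace N -> is_subspace (kin N : set {ffun {set 'I_n} -> {mpoly k[n]}}).
Proof.
move=> [N0 ND NZ]; split=> [T|u v Nu Nv T|c u Nu T]; rewrite ffunE //.
- by apply: ND.
- by apply: NZ.
Qed.

(** Turns coefficientwise membership into the filtration of a tensor product of complexes, to which
    the abstract lemmas apply. *)
Lemma kin_tfilt (U : nat -> set A) (W : nat -> set B) s (z : KR) :
  (forall i, is_subspace (U i)) -> (forall j, is_subspace (W j)) ->
  kin (tfilt pt U W s) z <->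
  tfilt ktens (fun i => kin (U i)) (fun j => kin (W j)) s z.
Proof.
move=> sU sW; split=> [Hz|].
  rewrite [z]ksingle_sum; apply: subspace_sum => [|T _]; first exact: tfilt_subspace.
  set E := tfilt ktens _ _ s; have sE : is_subspace E by apply: tfilt_subspace.
  suff : (tfilt pt U W s `<=` ksingle T @^-1` E)%classic by apply; apply: Hz.
  apply: tfilt_min => [|i j f g ijs Uf Wg]; first exact: preim_subspace.
  rewrite /E /preimage /mkset -[T](scatK T) -kptmul_single -[kptmul _ _]/(ktens _ _) -ijs.
  apply: tfilt_mem => T'.
    by rewrite ffunE; case: eqP => // _; case: (sU i).
  by rewrite ffunE; case: eqP => // _; case: (sW j).
suff : (tfilt ktens (fun i => kin (U i)) (fun j => kin (W j)) s `<=` kin (tfilt pt U W s))%classic by apply.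
apply: tfilt_min => [|i j u v <- Uu Wv T]; first exact/kin_subspace/tfilt_subspace.
by rewrite ktensE; apply: tfilt_mem.
Qed.

Lemma mdeg_mcat m1 m2 : mdeg (@mcat d e m1 m2) = (mdeg m1 + mdeg m2)%N.
Proof.
rewrite !mdegE big_split_ord /=; congr (_ + _)%N; apply: eq_bigr => i _.
  exact: mcat_lshift.
exact: mcat_rshift.
Qed.

Lemma pihomog_pt a b c f g :
  pihomog mdeg c (pt (pihomog mdeg a f) (pihomog mdeg b g)) =
  if c == (a + b)%N then pt (pihomog mdeg a f) (pihomog mdeg b g) else 0.
Proof.
move: f; apply: mpoly_ind_subspace => [|m1].
  split=> /= [|u v Hu Hv|r u Hu].
  - by rewrite linear0 tmul0l linear0 if_same.
  - by rewrite !linearD /= !tmulDl linearD /= Hu Hv; case: (c == _); rewrite ?addr0.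
  - by rewrite !linearZ /= !tmulZl linearZ /= Hu; case: (c == _); rewrite ?scaler0.
move: g; apply: mpoly_ind_subspace => [|m2].
  split=> /= [|u v Hu Hv|r u Hu].
  - by rewrite linear0 tmul0r linear0 if_same.
  - by rewrite !linearD /= !tmulDr linearD /= Hu Hv; case: (c == _); rewrite ?addr0.
  - by rewrite !linearZ /= !tmulZr linearZ /= Hu; case: (c == _); rewrite ?scaler0.
rewrite !pihomogX; case: eqP => [<-|_]; last by rewrite tmul0l linear0 if_same.
case: eqP => [<-|_]; last by rewrite tmul0r linear0 if_same.
by rewrite ptensE inclX pihomogX /= mdeg_mcat eq_sym.
Qed.

Lemma kpr_ktens p a b u v : kpr a u = u -> kpr b v = v ->
  kpr p (ktens u v) = if p == (a + b)%N then ktens u v else 0.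
Proof.
move=> <- <-; set w := ktens _ _.
suff E T : kpr p w T = if p == (a + b)%N then w T else 0.
  by case: ifP E => _ E; apply/ffunP => T; rewrite E ?ffunE.
rewrite /w ffunE ktensE !ffunE card_sleft_sright.
case: (eqVneq #|sleft T| a) => [->|_]; last by rewrite tmul0l !if_same.
case: (eqVneq #|sright T| b) => [->|_]; last by rewrite tmul0r !if_same.
by rewrite eq_sym.
Qed.

Lemma kgr_ktens j a b u v : @kgr d (polg k d) a u = u -> @kgr e (polg k e) b v = v ->
  @kgr (d + e) (polg k (d + e)) j (ktens u v) = if j == (a + b)%N then ktens u v else 0.
Proof.
move=> <- <-; set w := ktens _ _.
suff E T : @kgr (d + e) (polg k (d + e)) j w T = if j == (a + b)%N then w T else 0.
  by case: ifP E => _ E; apply/ffunP => T; rewrite E ?ffunE.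
rewrite /w ffunE ktensE !ffunE card_sleft_sright.
case: (leqP #|sleft T| a) => la; last by rewrite tmul0l raddf0 !if_same.
case: (leqP #|sright T| b) => lb; last by rewrite tmul0r raddf0 !if_same.
rewrite [gpi _ _ _]pihomog_pt.
case: (leqP (#|sleft T| + #|sright T|)%N j) => lj.
  by congr (if _ then _ else _); lia.
by case: eqP => // E; lia.
Qed.

End KoszulTensor.

Section KoszulLinear.
Variables (k : fieldType) (n : nat).
Local Notation S := {mpoly k[n]}.
Local Notation KS := {ffun {set 'I_n} -> S}.

Lemma kpr_scalable p : scalable (@kpr n S p : KS -> KS).
Proof. by move=> c u; apply/ffunP => T; rewrite !ffunE; case: (_ == p); rewrite ?scaler0. Qed.
HB.instance Definition _ p := GRing.isScalable.Build k KS KS _ (@kpr n S p) (kpr_scalable p).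

Lemma kpar_scalable : scalable (@kpar n S : KS -> KS).
Proof. by move=> c u; apply/ffunP => T; rewrite !ffunE; case: odd; rewrite //= scalerN. Qed.
HB.instance Definition _ := GRing.isScalable.Build k KS KS _ (@kpar n S) kpar_scalable.

Lemma kos_kos (u : KS) : kos (kos u) = 0.
Proof. exact: (@koszul_koszul n (polg k n)). Qed.

Lemma kos_kprS p (u : KS) : kos (kpr p.+1 u) = kpr p (kos u).
Proof. exact: (@koszul_kprS n (polg k n)). Qed.

Lemma kos_kpar (u : KS) : kos (kpar u) = - kpar (kos u).
Proof. exact: (@koszul_kpar n (polg k n)). Qed.

Lemma kpr_kconst p (u : KS) : kpr p.+1 (kconst u) = 0.
Proof. by apply/ffunP => T; rewrite !ffunE; case: eqP => // ->. Qed.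

(* A contracting homotopy of the Koszul complex that loses at most one step of
   the filtration U; it makes the maps Tor(k, U i.+1) -> Tor(k, U i) vanish. *)
Definition filtered_homotopy (U : nat -> set S) : Prop :=
  exists h : {linear KS -> KS},
    (forall u, kos (h u) + h (kos u) = u - kconst u) /\
    (forall i u, kin (U i.+1) u -> kin (U i) (h u)).

(** The representative is the (p+1, j) component of [h (kos a)]. It is homologous to [a] since
    constants vanish in positive degree, and it lies in [U i] since [kos a] lies in [U i.+1]. *)
Lemma knzj_normalize (U : nat -> set S) i p j (h : {linear KS -> KS}) :
  (forall l, is_ideal (U l)) -> (forall l, graded_sub (U l : set (polg k n))) ->
  (forall u, kos (h u) + h (kos u) = u - kconst u) ->
  (forall l u, kin (U l.+1) u -> kin (U l) (h u)) ->
  knzj (U i.+1 : set (polg k n)) p.+1 j ->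
  exists a : KS, [/\ kpr p.+1 a = a, @kgr n (polg k n) j a = a,
    kin (U i.+1) (kos a), kin (U i) a & ~ exists b, kin (U i.+1) (a - kos b)].
Proof.
move=> idU gU hE hU [a [pa ja Ua na]].
pose a' : KS := kpr p.+1 (@kgr n (polg k n) j (h (kos a))).
have pj (x : KS) : kpr p.+1 (@kgr n (polg k n) j (kos x)) =
    kos (kpr p.+2 (@kgr n (polg k n) j x)).
  by rewrite /kos (@koszul_kprS n (polg k n)) (@koszul_kgr n (polg k n)).
have Ea : a' = a - kos (kpr p.+2 (@kgr n (polg k n) j (h a))).
  have Eh : h (kos a) = a - kconst a - kos (h a) by rewrite -hE addrC addKr.
  pose G (x : KS) : KS := @kgr n (polg k n) j x.
  have GB x y : G (x - y) = G x - G y by exact: (raddfB (@kgr n (polg k n) j)).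
  have GK : kpr p.+1 (G (kconst a)) = 0.
    rewrite /G -(@kgr_kpr n (polg k n)) kpr_kconst; exact: (raddf0 (@kgr n (polg k n) j)).
  rewrite -pj /a' Eh -!/(G _) !GB !raddfB /= GK subr0.
  by rewrite {1}/G ja pa.
exists a'; split.
- by rewrite /a' kpr_id.
- by rewrite /a' (@kgr_kpr n (polg k n)) kgr_id.
- by rewrite Ea raddfB /= kos_kos subr0.
- apply: (kin_kpr (ideal_subgmod (idU i))); apply: (kin_kgr (ideal_subgmod (idU i))) => //.
  exact: hU.
- case=> b Ub; apply: na; exists (b + kpr p.+2 (@kgr n (polg k n) j (h a))).
  have -> : a - koszul (V := polg k n) (b + kpr p.+2 (@kgr n (polg k n) j (h a))) = a' - kos b.
    by rewrite Ea -[koszul _]/(kos _) (raddfD (@kos k n)) /= opprD addrCA addrC.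
  exact: Ub.
Qed.

(** Composition with [kpr p] makes the functional vanish outside degree p, in particular on
    constants when p is positive. *)
Lemma knzj_functional (N : set S) p (a : KS) : is_ideal N -> kpr p a = a ->
  ~ (exists b, kin N (a - kos b)) ->
  exists phi : {linear KS -> k^o}, [/\ forall u, kin N u -> phi u = 0,
    forall u, phi (kos u) = 0, phi a = 1 & forall u, kpr p u = 0 -> phi u = 0].
Proof.
move=> idN pa na; pose W := sum_set (kin N : set KS) (range (@kos k n)).
have sW : is_subspace W.
  apply: sum_set_subspace; first exact/kin_subspace/ideal_subspace.
  by apply: image_subspace.
have nW : ~ W a.
  by case=> u Nu [_ [b _ <-] E]; apply: na; exists b; rewrite -E addrK.
have [phi [phiW phia]] := exists_functional sW nW.
exists (phi \o kpr p : {linear KS -> k^o}); split=> [u Nu|u||u pu] /=.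
- apply: phiW; apply: sum_setl; first by exists 0 => //; rewrite linear0.
  by apply: (kin_kpr (ideal_subgmod idN)).
- rewrite -kos_kprS; apply: phiW; apply: sum_setr; last by exists (kpr p.+1 u).
  by apply: (kin0 (ideal_subgmod idN)).
- by rewrite pa.
- by rewrite pu linear0.
Qed.

End KoszulLinear.

(** * Lower bound: products of classes and the connecting map *)

Section LowerBound.
Variables (k : fieldType) (d e : nat).
Local Notation A := {mpoly k[d]}.
Local Notation B := {mpoly k[e]}.
Local Notation R := {mpoly k[d + e]}.
Local Notation KA := {ffun {set 'I_d} -> A}.
Local Notation KB := {ffun {set 'I_e} -> B}.
Local Notation KR := {ffun {set 'I_(d + e)} -> R}.
Local Notation pt := (ptens k d e).
Local Notation kt := (ktens k d e).
Local Arguments tmul : simpl never.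
Variables (U : nat -> set A) (W : nat -> set B).
Hypotheses (idU : forall i, is_ideal (U i)) (idW : forall j, is_ideal (W j)).
Hypotheses (gU : forall i, graded_sub (U i : set (polg k d))).
Hypotheses (gW : forall j, graded_sub (W j : set (polg k e))).
Hypotheses (Um : forall i, U i.+1 `<=` U i) (Wm : forall j, W j.+1 `<=` W j).
Hypotheses (hU : filtered_homotopy U) (hW : filtered_homotopy W).

Let sU i : is_subspace (U i) := ideal_subspace (idU i).
Let sW j : is_subspace (W j) := ideal_subspace (idW j).

Lemma kin_tfilt_mem i j s (u : KA) (v : KB) : (i + j)%N = s ->
  kin (U i) u -> kin (W j) v -> kin (tfilt pt U W s) (kt u v).
Proof. by move=> <- Uu Wv; apply/kin_tfilt => //; apply: tfilt_mem. Qed.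

Lemma kin_anti (n : nat) (F : nat -> set {mpoly k[n]}) : (forall i, F i.+1 `<=` F i) ->
  forall i j (u : {ffun {set 'I_n} -> {mpoly k[n]}}), (i <= j)%N -> kin (F j) u -> kin (F i) u.
Proof. by move=> Fm i j u ij Fu T; apply: (filt_le Fm ij). Qed.

Lemma knzj_detect (Phi : {linear KR -> k^o}) s p j (z : KR) :
  kpr p z = z -> @kgr (d + e) (polg k (d + e)) j z = z ->
  kin (tfilt pt U W s) (kos z) ->
  (forall u v, Phi (kos (kt u v)) = 0) ->
  (forall l m u v, (l + m)%N = s -> kin (U l) u -> kin (W m) v -> Phi (kt u v) = 0) ->
  Phi z = 1 -> knzj (tfilt pt U W s : set (polg k (d + e))) p j.
Proof.
move=> pz jz Qz Phid Phis Phiz; exists z; split=> // -[b Hb].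
have : Phi (z - kos b) = 0.
  move: Hb; rewrite -/(kos b) => /kin_tfilt -/(_ sU sW).
  suff : tfilt kt (fun i => kin (U i)) (fun j => kin (W j)) s `<=` Phi @^-1` [set 0] by apply.
  apply: tfilt_min => [|l m u v lm Uu Wv]; last exact: Phis lm Uu Wv.
  by apply: preim_subspace; split=> //= [u v -> ->|c u ->]; rewrite ?addr0 ?scaler0.
have Phi0 : Phi (kos b) = 0.
  apply: (@tmul_ind _ _ _ _ kt [set b | Phi (kos b) = 0]) => //.
  split=> /= [|u v Hu Hv|c u Hu]; first by rewrite !linear0.
    by rewrite linearD /= linearD /= Hu Hv addr0.
  by rewrite linearZ /= linearZ /= Hu scaler0.
by rewrite linearB /= Phi0 subr0 Phiz => /eqP; rewrite oner_eq0.
Qed.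

(** For normalized a and b both terms of the boundary of a (x) b have filtration i + t + 1. If l + m
    = i + t + 1 then l > i or m > t, so phi (x) psi kills the filtration. *)
Lemma knzj_tensor i t p1 p2 j1 j2 :
  knzj (U i.+1 : set (polg k d)) p1.+1 j1 -> knzj (W t.+1 : set (polg k e)) p2.+1 j2 ->
  knzj (tfilt pt U W (i + t).+1 : set (polg k (d + e))) (p1.+1 + p2.+1) (j1 + j2).
Proof.
have [h [hE hl]] := hU; have [h' [hE' hl']] := hW.
move=> /(knzj_normalize idU gU hE hl)[a [pa ja Uka Ua na]].
move=> /(knzj_normalize idW gW hE' hl')[b [pb jb Wkb Wb nb]].
have [phi [phiU phik phia phip]] := knzj_functional (idU _) pa na.
have [psi [psiW psik psib psip]] := knzj_functional (idW _) pb nb.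
have [||Phi PhiE] := @tmul_univ _ _ _ _ kt k^o (fun u v => phi u * psi v).
- by move=> v c u u'; rewrite linearP mulrDl -mulrA.
- by move=> u c v v'; rewrite linearP mulrDr mulrCA.
apply: (@knzj_detect Phi _ _ _ (kt a b)).
- by rewrite (kpr_ktens _ pa pb) eqxx.
- by rewrite (kgr_ktens _ ja jb) eqxx.
- rewrite kos_ktens; apply: (kinD (ideal_subgmod (tfilt_ideal _ idU idW))).
    by apply: (@kin_tfilt_mem i.+1 t).
  apply: (@kin_tfilt_mem i t.+1) => //; first by rewrite addnS.
  exact: (kin_kpar (ideal_subgmod (idU i))).
- by move=> u v; rewrite kos_ktens linearD /= !PhiE phik psik mul0r mulr0 addr0.
- move=> l m u v lm Uu Wv; rewrite PhiE; have [il|li] := ltnP i l.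
    by rewrite phiU ?mul0r //; apply: kin_anti Uu.
  by rewrite psiW ?mulr0 //; apply: kin_anti Wv => //; lia.
- by rewrite PhiE phia psib mulr1.
Qed.

(** The class is [kos a] (x) b, whose boundary is, up to sign, the product of the two boundaries, of
    filtration (i+1) + (t+1). Only the homological degree drops by one. *)
Lemma knzj_tensor_connecting i t p1 p2 j1 j2 :
  knzj (U i.+1 : set (polg k d)) p1.+1 j1 -> knzj (W t.+1 : set (polg k e)) p2.+1 j2 ->
  knzj (tfilt pt U W (i.+1 + t.+1) : set (polg k (d + e))) (p1 + p2.+1) (j1 + j2).
Proof.
have [h [hE hl]] := hU; have [h' [hE' hl']] := hW.
move=> /(knzj_normalize idU gU hE hl)[a [pa ja Uka Ua na]].
move=> /(knzj_normalize idW gW hE' hl')[b [pb jb Wkb Wb nb]].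
have [phi [phiU phik phia phip]] := knzj_functional (idU _) pa na.
have [psi [psiW psik psib psip]] := knzj_functional (idW _) pb nb.
(* The homotopies undo the differentials under phi and psi, so on a boundary the two summands
   contribute phi u psi v with opposite signs. As h and h' lose only one step, each summand also
   dies on U_l (x) W_m with l + m = i + t + 2. *)
have [||Phi PhiE] := @tmul_univ _ _ _ _ kt k^o
    (fun u v => phi (h u) * psi v - phi (kpar u) * psi (h' v)).
- move=> v c u u'; rewrite linearP linearP [kpar _]linearP linearP /=.
  by rewrite !mulrDl opprD addrACA scalerBr -!mulrA.
- move=> u c v v'; rewrite linearP [h' _]linearP linearP /=.
  by rewrite !mulrDr opprD addrACA scalerBr !scalerAr.
have phih u : phi (h (kos u)) = phi u.
  have -> : h (kos u) = u - kconst u - kos (h u) by rewrite -hE addrC addKr.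
  by rewrite !linearB /= phik (phip (kconst u)) ?kpr_kconst // !subr0.
have psih v : psi (h' (kos v)) = psi v.
  have -> : h' (kos v) = v - kconst v - kos (h' v) by rewrite -hE' addrC addKr.
  by rewrite !linearB /= psik (psip (kconst v)) ?kpr_kconst // !subr0.
have phikp u : phi (kpar (kos u)) = 0.
  have -> : kpar (kos u) = kos (- kpar u) by rewrite linearN /= kos_kpar opprK.
  exact: phik.
apply: (@knzj_detect Phi _ _ _ (kt (kos a) b)).
- by rewrite (@kpr_ktens _ _ _ _ p1 p2.+1) ?eqxx // -kos_kprS pa.
- rewrite (@kgr_ktens _ _ _ _ j1 j2) ?eqxx //.
  by rewrite -(@koszul_kgr d (polg k d)) ja.
- rewrite kos_ktens kos_kos tmul0l add0r; apply: (@kin_tfilt_mem i.+1 t.+1) => //.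
  exact: (kin_kpar (ideal_subgmod (idU i.+1))).
- move=> u v; rewrite kos_ktens linearD /= !PhiE phih phikp psik psih kpar_id.
  by rewrite mul0r subr0 mulr0 sub0r subrr.
- move=> l m u v lm Uu Wv; rewrite PhiE; have [il|li] := ltnP i.+1 l.
    rewrite phiU ?mul0r; last by apply: hl; apply: kin_anti Uu.
    rewrite phiU ?mul0r ?subr0 //; apply: (kin_kpar (ideal_subgmod (idU i.+1))).
    by apply: kin_anti Uu => //; apply: ltnW.
  rewrite psiW ?mulr0 ?sub0r; last by apply: kin_anti Wv => //; lia.
  have [il|li'] := ltnP i l.
    rewrite phiU ?mul0r ?oppr0 //; apply: (kin_kpar (ideal_subgmod (idU i.+1))).
    exact: kin_anti Uu.
  rewrite [psi _]psiW ?mulr0 ?oppr0 //; apply: hl'.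
  by apply: kin_anti Wv => //; lia.
- by rewrite PhiE phih phikp mul0r subr0 phia psib mulr1.
Qed.

End LowerBound.

(** * Splittings of the Koszul differential *)

Section QuasiInverse.
Variables (k : fieldType) (n : nat).
Local Notation S := {mpoly k[n]}.
Local Notation KS := {ffun {set 'I_n} -> S}.

Definition kcomp (p j : nat) (u : KS) : KS := kpr p (@kgr n (polg k n) j u).

Lemma kgr_scalable j : scalable (@kgr n (polg k n) j : KS -> KS).
Proof.
move=> c u; apply/ffunP => T; rewrite !ffunE; case: ifP => _; last by rewrite scaler0.
by rewrite /= linearZ.
Qed.

Lemma kcomp_linear p j : linear (kcomp p j).
Proof.
move=> c u v; rewrite /kcomp.
have -> : @kgr n (polg k n) j (c *: u + v) = c *: (@kgr n (polg k n) j u : KS) + @kgr n (polg k n) j v.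
  rewrite [LHS](raddfD (@kgr n (polg k n) j)); congr (_ + _); exact: kgr_scalable.
by rewrite linearP.
Qed.
HB.instance Definition _ p j := GRing.isLinear.Build k KS KS _ (kcomp p j) (kcomp_linear p j).

Lemma kcomp_sum (u : KS) : exists N, u = \sum_(b < N) \sum_(a < n.+1) kcomp a b u.
Proof.
have [N EN] := @kgr_sum n (polg k n) u; exists N; rewrite {1}EN.
by apply: eq_bigr => b _; rewrite [LHS]kpr_sum.
Qed.

Lemma kpr_kcomp p j u : kpr p (kcomp p j u) = kcomp p j u.
Proof. by rewrite /kcomp kpr_id. Qed.

Lemma kgr_kcomp p j u : @kgr n (polg k n) j (kcomp p j u) = kcomp p j u.
Proof. by rewrite /kcomp (@kgr_kpr n (polg k n)) kgr_id. Qed.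

Lemma kos_kcompS p j u : kos (kcomp p.+1 j u) = kcomp p j (kos u).
Proof. by rewrite /kcomp kos_kprS /kos (@koszul_kgr n (polg k n)). Qed.

Lemma kos_kcomp0 j u : kos (kcomp 0 j u) = 0.
Proof. exact: (@koszul_kpr0 n (polg k n)). Qed.

Lemma kin_kcomp (M : set S) p j u : is_ideal M -> graded_sub (M : set (polg k n)) ->
  kin M u -> kin M (kcomp p j u).
Proof.
move=> idM gM Mu; apply: (kin_kpr (ideal_subgmod idM)).
exact: (kin_kgr (ideal_subgmod idM)).
Qed.

Lemma kin_kos (M : set S) u : is_ideal M -> kin M u -> kin M (kos u).
Proof. by move=> idM; apply: (kin_koszul (ideal_subgmod idM)). Qed.

Lemma kin_kos_kcomp (M : set S) p j u : is_ideal M -> graded_sub (M : set (polg k n)) ->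
  kin M (kos u) -> kin M (kos (kcomp p j u)).
Proof.
move=> idM gM Mu; case: p => [|p].
  by rewrite kos_kcomp0; apply: (kin0 (ideal_subgmod idM)).
by rewrite kos_kcompS; apply: kin_kcomp.
Qed.

(** A generalized inverse of the differential on M/N, which exists because complexes of vector
    spaces split. *)
Lemma quasi_inverse (M N : set KS) : is_subspace M -> is_subspace N -> N `<=` M ->
  exists g : {linear KS -> KS}, [/\ forall v, M (g v), forall v, N v -> g v = 0 &
    forall v, M v -> N (kos (g (kos v)) - kos v)].
Proof.
move=> sM sN NM; have [M0 MD MZ] := sM; have [N0 ND NZ] := sN.
pose D := sum_set [set kos v | v in M] N.
have sD : is_subspace D by apply: sum_set_subspace => //; apply: image_subspace.
have [rho [rhoD rhoid]] := exists_projector sD.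
have ND' : N `<=` D by apply: sum_setr; exists 0; rewrite // linear0.
(* The relation asks [kos u] to agree with [rho v] modulo [N]. The value 0 on [N] is admissible,
   since [rho] fixes [N]. *)
have [||||v|g [Gg Hg]] := @linear_selection k KS KS
    [set p | M p.2 /\ N (kos p.2 - rho p.1)] [set p | N p.1 /\ p.2 = 0].
- split=> /=; first by rewrite !linear0 ?subrr ?oppr0 ?addr0.
  + move=> [b1 u1] [b2 u2] /= [Mu1 N1] [Mu2 N2]; split; first exact: MD.
    have -> : kos (u1 + u2) - rho (b1 + b2) = (kos u1 - rho b1) + (kos u2 - rho b2).
      by rewrite (linearD (@kos k n)) (linearD rho) opprD addrACA.
    exact: ND.
  + move=> c [b1 u1] /= [Mu1 N1]; split; first exact: MZ.
    have -> : kos (c *: u1) - rho (c *: b1) = c *: (kos u1 - rho b1).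
      by rewrite linearZ [rho _]linearZ /= -scalerBr.
    exact: NZ.
- split=> //=.
  + move=> [b1 u1] [b2 u2] /= [N1 ->] [N2 ->]; split; [exact: ND|exact: addr0].
  + by move=> c [b1 u1] /= [N1 ->]; split; [apply: NZ|rewrite scaler0].
- move=> [b u] /= [Nb ->]; split=> //; rewrite linear0 sub0r rhoid; last exact: ND'.
  exact: subspaceN.
- by move=> w /= [].
- have [_ [u Mu <-] [y Ny Ey]] := rhoD v; exists u; split=> //=.
  by rewrite -Ey opprD addrA subrr sub0r; apply: subspaceN.
exists g; split=> [v|v Nv|v Mv]; first by case: (Gg v).
  by apply: (Hg (v, 0)).
have [_] := Gg (kos v); rewrite /= rhoid //.
by apply: sum_setl => //; exists v.
Qed.

Lemma kpar_kpr p (u : KS) : kpar (kpr p u) = csign (odd p) (kpr p u).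
Proof.
apply/ffunP => T; rewrite /csign; case: ifP => op; rewrite !ffunE; case: eqP => [->|_] //;
  by rewrite ?op ?csign0 ?oppr0.
Qed.

Lemma kpr_kpar p (u : KS) : kpr p (kpar u) = csign (odd p) (kpr p u).
Proof.
apply/ffunP => T; rewrite /csign; case: ifP => op; rewrite !ffunE; case: eqP => [->|_] //;
  by rewrite ?op ?csign0 ?oppr0.
Qed.

(** Keeping only the parts that raise the exterior degree by one makes the inverse anticommute with
    [kpar], as the signs in the Kuenneth argument require. *)
Lemma quasi_inverse_odd (N : set S) : is_ideal N ->
  exists h : {linear KS -> KS}, [/\ forall v, kin N v -> kin N (h v),
    forall v, kpar (h v) = - h (kpar v) & forall v, kin N (kos (h (kos v)) - kos v)].
Proof.
move=> idN; have sN : is_subspace (kin N : set KS) by apply/kin_subspace/ideal_subspace.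
have [g [_ g0 gE]] := quasi_inverse (subspaceT KS) sN (@subsetT _ _).
pose h (v : KS) : KS := \sum_(p < n.+1) kpr p.+1 (g (kpr p v)).
have hlin : linear h.
  move=> c u v; rewrite /h scaler_sumr -big_split; apply: eq_bigr => p _ /=.
  by rewrite linearP linearP linearP.
pose hl := GRing.isLinear.Build k KS KS _ h hlin.
pose h' : {linear KS -> KS} := HB.pack h hl.
exists h'; split=> [v Nv|v|v] /=.
- rewrite /h; apply: (kin_sum (ideal_subgmod idN)) => p _; rewrite g0 ?linear0; first by case: sN.
  exact: (kin_kpr (ideal_subgmod idN)).
- rewrite /h linear_sum -sumrN; apply: eq_bigr => p _ /=.
  rewrite kpar_kpr kpr_kpar /csign /=; case: odd => /=; by rewrite ?linearN ?opprK.
- rewrite {2}(kpr_sum (kos v)) /h linear_sum -sumrB; apply: (kin_sum (ideal_subgmod idN)) => p _ /=.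
  have Ep : kpr p (kos v) = kos (kpr p.+1 v) by rewrite kos_kprS.
  rewrite kos_kprS !Ep.
  have := gE (kpr p.+1 v) I; set x := kos (g _) - _ => Nx.
  have -> : kpr p (kos (g (kos (kpr p.+1 v)))) - kos (kpr p.+1 v) = kpr p x.
    by rewrite /x linearB /= kos_kprS kpr_id.
  exact: (kin_kpr (ideal_subgmod idN)).
Qed.

End QuasiInverse.

(** * Kuenneth formula and upper bound *)

Section UpperBound.
Variables (k : fieldType) (d e : nat).
Local Notation A := {mpoly k[d]}.
Local Notation B := {mpoly k[e]}.
Local Notation R := {mpoly k[d + e]}.
Local Notation KA := {ffun {set 'I_d} -> A}.
Local Notation KB := {ffun {set 'I_e} -> B}.
Local Notation KR := {ffun {set 'I_(d + e)} -> R}.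
Local Notation pt := (ptens k d e).
Local Notation kt := (ktens k d e).
Local Arguments tmul : simpl never.

Lemma kcomp_ktens p j a b a' b' (u : KA) (v : KB) :
  kcomp p j (kt (kcomp a b u) (kcomp a' b' v)) =
  if (p == a + a')%N && (j == b + b')%N then kt (kcomp a b u) (kcomp a' b' v) else 0.
Proof.
rewrite /kcomp -(@kgr_kpr _ (polg k (d + e))).
rewrite (@kpr_ktens _ _ _ _ a a') ?kpr_id //; case: eqP => _ /=; last exact: (raddf0 (@kgr _ (polg k (d + e)) j)).
by rewrite (@kgr_ktens _ _ _ _ b b') // (@kgr_kpr _ (polg k _)) kgr_id.
Qed.

Definition kclosed (n : nat) (X : set {ffun {set 'I_n} -> {mpoly k[n]}}) : Prop :=
  forall p j u, X u -> X (kcomp p j u).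

Lemma kcomp_pure (X : set KA) (Y : set KB) (E : set KR) p j u v :
  is_subspace E -> kclosed X -> kclosed Y -> X u -> Y v ->
  (forall a b a' b' u v, X (kcomp a b u) -> Y (kcomp a' b' v) ->
    (a + a')%N = p -> (b + b')%N = j -> E (kt (kcomp a b u) (kcomp a' b' v))) ->
  E (kcomp p j (kt u v)).
Proof.
move=> sE cX cY Xu Yv H; have [E0 _ _] := sE.
have [N EN] := kcomp_sum u; have [N' EN'] := kcomp_sum v.
rewrite EN tmul_suml linear_sum; apply: subspace_sum => // b _ /=.
rewrite tmul_suml linear_sum; apply: subspace_sum => // a _ /=.
rewrite EN' tmul_sumr linear_sum; apply: subspace_sum => // b' _ /=.
rewrite tmul_sumr linear_sum; apply: subspace_sum => // a' _ /=.
rewrite kcomp_ktens; case: andP => // -[/eqP Ep /eqP Ej].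
by apply: H => //; [apply: cX|apply: cY].
Qed.

Lemma tens_kclosed (X : set KA) (Y : set KB) : kclosed X -> kclosed Y -> kclosed (tens kt X Y).
Proof.
move=> cX cY p j z; suff : tens kt X Y `<=` kcomp p j @^-1` tens kt X Y by apply.
apply: tens_min => [|u v Xu Yv /=]; first by apply: preim_subspace; apply: tens_subspace.
apply: (kcomp_pure (X := X) (Y := Y)) => //; first exact: tens_subspace.
by move=> *; apply: tens_mem.
Qed.

Lemma tfilt_kclosed (X : nat -> set KA) (Y : nat -> set KB) s :
  (forall i, kclosed (X i)) -> (forall j, kclosed (Y j)) -> kclosed (tfilt kt X Y s).
Proof.
move=> cX cY p j z; suff : tfilt kt X Y s `<=` kcomp p j @^-1` tfilt kt X Y s by apply.
apply: tfilt_min => [|i l u v <- Xu Yv /=]; first by apply: preim_subspace; apply: tfilt_subspace.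
apply: (kcomp_pure (X := X i) (Y := Y l)) => //; first exact: tfilt_subspace.
by move=> *; apply: tfilt_mem.
Qed.

Lemma zmod_cancel3 (V : zmodType) (x y c w : V) : x - (y - c) - (w + c) = x - y - w.
Proof.
rewrite opprB [w + c]addrC opprD -!addrA; congr (_ + _).
by rewrite addrCA; congr (_ + _); rewrite addrA subrr add0r.
Qed.

Lemma zmod_split3 (V : zmodType) (x y w : V) : x = x - y - w + (y + w).
Proof. by rewrite -[x - y - w]addrA -opprD subrK. Qed.

Lemma zmod_shuffle5 (V : zmodType) (q x y z w : V) :
  q + (x + y) + (z + w) = z + x + q + (w + y).
Proof.
rewrite -!addrA addrCA [RHS]addrCA; congr (_ + _); rewrite [RHS]addrCA; congr (_ + _).
by rewrite addrC -addrA.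
Qed.

Section Kunneth.
Variables (X0 : set A) (Y0 Y1 : set B).
Hypotheses (idX : is_ideal X0) (idY0 : is_ideal Y0) (idY1 : is_ideal Y1) (Y10 : Y1 `<=` Y0).
(** A (x) Y0 modulo this subspace is the Koszul complex of (A/X0) (x) (Y0/Y1). *)
Let T := sum_set (tens kt (kin X0) (kin Y0)) (tens kt setT (kin Y1)).

Let sT : is_subspace T.
Proof. by apply: sum_set_subspace; apply: tens_subspace. Qed.

Let T1 u v : kin X0 u -> kin Y0 v -> T (kt u v).
Proof.
move=> Xu Yv; apply: sum_setl; last exact: tens_mem.
by have [] := tens_subspace kt setT (kin Y1 : set KB).
Qed.

Let T2 u v : kin Y1 v -> T (kt u v).
Proof.
move=> Yv; apply: sum_setr; last exact: tens_mem.
by have [] := tens_subspace kt (kin X0 : set KA) (kin Y0 : set KB).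
Qed.

Let Tmin (E : set KR) : is_subspace E -> (forall u v, kin X0 u -> kin Y0 v -> E (kt u v)) ->
  (forall u v, kin Y1 v -> E (kt u v)) -> T `<=` E.
Proof.
move=> sE E1 E2 _ [x Tx [y Ty <-]]; have [_ ED _] := sE; apply: ED.
  exact: (tens_min sE _ Tx).
by apply: (tens_min sE _ Ty) => u v _; apply: E2.
Qed.

Let T_kos z : T z -> T (kos z).
Proof.
suff : T `<=` @kos k (d + e) @^-1` T by apply.
have [_ TD _] := sT.
apply: Tmin => [|u v Xu Yv|u v Yv] /=; first exact: preim_subspace.
- rewrite kos_ktens; apply: TD; apply: T1 => //; try exact: kin_kos.
  exact: (kin_kpar (ideal_subgmod idX)).
- rewrite kos_ktens; apply: TD; apply: T2 => //; exact: kin_kos.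
Qed.

(** The operators [P] and [P'], identity minus the commutator of the differential with a splitting,
    are homotopic to the identity. One turns left factors into cycles modulo X0, the other right
    factors into cycles modulo Y1. *)
Lemma kunneth z : tens kt setT (kin Y0) z -> T (kos z) -> exists w c t,
  [/\ z = kos w + c + t, T t &
      tens kt [set u | kin X0 (kos u)] [set v | kin Y0 v /\ kin Y1 (kos v)] c].
Proof.
move=> Yz Tz.
have [h [hX hpar hE]] := quasi_inverse_odd idX.
have sY0 : is_subspace (kin Y0 : set KB) by apply/kin_subspace/ideal_subspace.
have sY1 : is_subspace (kin Y1 : set KB) by apply/kin_subspace/ideal_subspace.
have [g [gY0 gY1 gE]] : exists g : {linear KB -> KB}, [/\ forall v, kin Y0 (g v),
    forall v, kin Y1 v -> g v = 0 & forall v, kin Y0 v -> kin Y1 (kos (g (kos v)) - kos v)].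
  by apply: quasi_inverse => // v Yv x; apply: Y10.
have [H HE] := tmul_left kt h.
have [||G GE] := @tmul_univ _ _ _ _ kt KR (fun u v => kt (kpar u) (g v)).
- by move=> v c u u'; rewrite linearP tmulDl tmulZl.
- by move=> u c v v'; rewrite linearP tmulDr tmulZr.
have HT w : T w -> T (H w).
  suff : T `<=` H @^-1` T by apply.
  apply: Tmin => [|u v Xu Yv|u v Yv] /=; first exact: preim_subspace.
    by rewrite HE; apply: T1 => //; apply: hX.
  by rewrite HE; apply: T2.
have GT w : T w -> T (G w).
  suff : T `<=` G @^-1` T by apply.
  apply: Tmin => [|u v Xu Yv|u v Yv] /=; first exact: preim_subspace.
    by rewrite GE; apply: T1 => //; apply: (kin_kpar (ideal_subgmod idX)).
  by rewrite GE gY1 // tmul0r; case: sT.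
pose P (z : KR) := z - kos (H z) - H (kos z).
pose P' (z : KR) := z - kos (G z) - G (kos z).
pose Pl : {linear KR -> KR} := (idfun \- (@kos k (d + e) \o H)) \- (H \o @kos k (d + e)).
pose P'l : {linear KR -> KR} := (idfun \- (@kos k (d + e) \o G)) \- (G \o @kos k (d + e)).
have PE u v : P (kt u v) = kt (u - kos (h u) - h (kos u)) v.
  rewrite /P HE !kos_ktens (linearD H) !HE hpar !tmulBl tmulNl.
  exact: zmod_cancel3.
have P'E u v : P' (kt u v) = kt u (v - kos (g v) - g (kos v)).
  rewrite /P' GE !kos_ktens (linearD G) !GE kpar_id kos_kpar !tmulBr tmulNl.
  by rewrite [- _ + _]addrC [X in _ - X = _]addrC zmod_cancel3.
set Zc := [set u : KA | kin X0 (kos u)].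
set Zc' := [set v : KB | kin Y0 v /\ kin Y1 (kos v)].
have P1 : tens kt Zc (kin Y0) (P z).
  suff : tens kt setT (kin Y0) `<=` Pl @^-1` tens kt Zc (kin Y0) by apply.
  apply: tens_min => [|u v _ Yv]; first by apply: preim_subspace; apply: tens_subspace.
  rewrite /preimage /mkset [Pl _]PE; apply: tens_mem => //; rewrite /Zc /mkset.
  have -> : kos (u - kos (h u) - h (kos u)) = - (kos (h (kos u)) - kos u).
    by rewrite !(linearB (@kos k d)) /= kos_kos subr0 opprB.
  by apply: (kinN (ideal_subgmod idX)); apply: hE.
have TP : T (kos (P z)).
  rewrite /P !(linearB (@kos k (d + e))) /= kos_kos subr0; apply: subspaceB => //.
  by apply: T_kos; apply: HT.
have P2 : tens kt Zc Zc' (P' (P z)).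
  suff : tens kt Zc (kin Y0) `<=` P'l @^-1` tens kt Zc Zc' by apply.
  apply: tens_min => [|u v Zu Yv]; first by apply: preim_subspace; apply: tens_subspace.
  rewrite /preimage /mkset [P'l _]P'E; apply: tens_mem => //; rewrite /Zc' /mkset; split.
    apply: (kinB (ideal_subgmod idY0)); last exact: gY0.
    apply: (kinB (ideal_subgmod idY0)) => //; apply: kin_kos => //; exact: gY0.
  have -> : kos (v - kos (g v) - g (kos v)) = - (kos (g (kos v)) - kos v).
    by rewrite !(linearB (@kos k e)) /= kos_kos subr0 opprB.
  by apply: (kinN (ideal_subgmod idY1)); apply: gE.
exists (H z + G (P z)), (P' (P z)), (H (kos z) + G (kos (P z))); split=> //.
- have E1 : z = P z + (kos (H z) + H (kos z)) by exact: zmod_split3.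
  have E2 : P z = P' (P z) + (kos (G (P z)) + G (kos (P z))).
    exact: zmod_split3.
  transitivity (P' (P z) + (kos (G (P z)) + G (kos (P z))) + (kos (H z) + H (kos z))).
    by rewrite -E2.
  have -> : kos (H z + G (P z)) = kos (H z) + kos (G (P z)) by exact: linearD.
  exact: zmod_shuffle5.
- by have [_ TD _] := sT; apply: TD; [apply: HT|apply: GT].
Qed.

End Kunneth.

End UpperBound.

Section FiltrationUpperBound.
Variables (k : fieldType) (d e : nat).
Local Notation A := {mpoly k[d]}.
Local Notation B := {mpoly k[e]}.
Local Notation R := {mpoly k[d + e]}.
Local Notation KA := {ffun {set 'I_d} -> A}.
Local Notation KB := {ffun {set 'I_e} -> B}.
Local Notation KR := {ffun {set 'I_(d + e)} -> R}.
Local Notation pt := (ptens k d e).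
Local Notation kt := (ktens k d e).
Local Arguments tmul : simpl never.

Section FiltrationInduction.
Variables (U : nat -> set A) (W : nat -> set B).
Hypotheses (idU : forall i, is_ideal (U i)) (idW : forall j, is_ideal (W j)).
Hypotheses (gU : forall i, graded_sub (U i : set (polg k d))).
Hypotheses (gW : forall j, graded_sub (W j : set (polg k e))).
Hypotheses (Um : forall i, U i.+1 `<=` U i) (Wm : forall j, W j.+1 `<=` W j).
Hypotheses (U0 : U 0 = setT) (W0 : W 0 = setT).

Let sU i : is_subspace (U i) := ideal_subspace (idU i).
Let sW j : is_subspace (W j) := ideal_subspace (idW j).
Local Notation X := (fun i => kin (U i) : set KA).
Local Notation Y := (fun j => kin (W j) : set KB).
Local Notation F := (tfilt kt X Y).

Let cX i : kclosed (X i).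
Proof. by move=> p j u; apply: kin_kcomp. Qed.

Let cY i : kclosed (Y i).
Proof. by move=> p j u; apply: kin_kcomp. Qed.

(* Nonvanishing of the Koszul homology of W l / W l.+1. *)
Definition knz_gr l p j : Prop := exists v : KB, [/\ kcomp p j v = v, kin (W l) v,
  kin (W l.+1) (kos v) & ~ exists w, kin (W l) w /\ kin (W l.+1) (v - kos w)].

(** Long exact sequence of 0 -> W_l/W_(l+1) -> B/W_(l+1) -> B/W_l -> 0: a class that dies in the
    middle comes from H_(p+1) of B/W_l. *)
Lemma knz_gr_cases l p j : knz_gr l p j ->
  knzj (W l.+1 : set (polg k e)) p j \/ knzj (W l : set (polg k e)) p.+1 j.
Proof.
case=> v [cv Wv Wkv nv].
have pv : kpr p v = v by rewrite -cv kpr_kcomp.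
have jv : @kgr e (polg k e) j v = v by rewrite -cv kgr_kcomp.
have [[w Ww]|nw] := pselect (exists w, kin (W l.+1) (v - kos w)); last by left; exists v.
have Ww' : kin (W l.+1) (v - kos (kcomp p.+1 j w)).
  rewrite kos_kcompS -{1}cv -linearB /=; exact: kin_kcomp.
have Wle (x : KB) : kin (W l.+1) x -> kin (W l) x by move=> H T; apply/Wm/H.
right; exists (kcomp p.+1 j w); split.
- by rewrite kpr_kcomp.
- by rewrite kgr_kcomp.
- rewrite -/(kos _); have -> : kos (kcomp p.+1 j w) = v - (v - kos (kcomp p.+1 j w)).
    by rewrite opprB addrC subrK.
  by apply: (kinB (ideal_subgmod (idW l))) => //; apply: Wle.
- case=> w' Ww2; apply: nv; exists (kcomp p.+1 j w - kos w'); split=> //.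
  by rewrite linearB /= kos_kos subr0.
Qed.

(** If no such pair exists, the cycle is moved by boundaries into F_s + A (x) W_l for growing l: the
    Kuenneth formula expresses the obstruction at step l by products of classes, and one factor
    always bounds. *)
Lemma knzj_tfilt_inv s p j : knzj (tfilt pt U W s : set (polg k (d + e))) p j ->
  exists l p1 p2 j1 j2, [/\ (l < s)%N, (p1 + p2)%N = p, (j1 + j2)%N = j,
    knzj (U (s - l)%N : set (polg k d)) p1 j1 & knz_gr l p2 j2].
Proof.
case=> z [pz jz Qz nz]; apply: contrapT => nex; apply: nz.
have kz : kcomp p j z = z by rewrite /kcomp jz pz.
have sF : is_subspace (F s) by apply: tfilt_subspace.
have Fz : F s (kos z) by apply/(kin_tfilt s (kos z) sU sW).
have sX i : is_subspace (X i) by apply: kin_subspace.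
have sY i : is_subspace (Y i) by apply: kin_subspace.
have Xm i : X i.+1 `<=` X i by move=> u Xu T; apply/Um/Xu.
have Ym i : Y i.+1 `<=` Y i by move=> u Yu T; apply/Wm/Yu.
have sFY l : is_subspace (sum_set (F s) (tens kt setT (Y l))).
  by apply: sum_set_subspace => //; apply: tens_subspace.
have F_kos l : forall y, tens kt setT (Y l) y -> tens kt setT (Y l) (kos y).
  move=> y; suff : tens kt setT (Y l) `<=` @kos k (d + e) @^-1` tens kt setT (Y l) by apply.
  apply: tens_min => [|u v _ Yv] /=; first by apply: preim_subspace; apply: tens_subspace.
  rewrite kos_ktens; have [_ TD _] := tens_subspace kt setT (Y l).
  by apply: TD; apply: tens_mem => //; apply: kin_kos.
have F_kosF : forall y, F s y -> F s (kos y).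
  move=> y /(kin_tfilt s y sU sW) H; apply/(kin_tfilt s _ sU sW).
  by apply: kin_kos => //; apply: tfilt_ideal.
(* At l = s the second summand already lies in [F s], because [U 0] is everything. *)
suff H l : (l <= s)%N -> exists w, sum_set (F s) (tens kt setT (Y l)) (z - kos w).
  have [w Hw] := H s (leqnn s); exists w; apply/(kin_tfilt s (z - kos w) sU sW).
  case: Hw => f Ff [y Yy E]; rewrite -E; have [_ FD _] := sF; apply: FD => //.
  move: Yy; apply: tens_min => // u v _ Yv; rewrite -[s]add0n; apply: tfilt_mem => //.
  by move=> T; rewrite U0.
elim: l => [_|l IH ls].
  exists 0; apply: sum_setr; first by case: sF.
  by apply: (@tmul_ind _ _ _ _ kt (tens kt setT (Y 0))) => [|u v]; [apply: tens_subspace|apply: tens_mem => // T; rewrite W0].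
have [w0 [f Ff [y Yy Ey]]] := IH (ltnW ls).
set i := (s - l)%N.
have Ek : kos y = kos z - kos f.
  have -> : y = z - kos w0 - f by rewrite -Ey addrC addKr.
  by rewrite !linearB /= kos_kos subr0.
have Fk : F s (kos y) by rewrite Ek; exact: (subspaceB sF Fz (F_kosF f Ff)).
have Tk := tfilt_cap sY Xm Ym (ltnW ls) (F_kos l y Yy) Fk.
have [w1 [c [t [Ec Tt Cc]]]] := kunneth (idU i) (idW l) (idW l.+1) (Wm (j := l)) Yy Tk.
have FT : sum_set (tens kt (X i) (Y l)) (tens kt setT (Y l.+1)) `<=`
    sum_set (F s) (tens kt setT (Y l.+1)).
  move=> _ [a Ta [b Tb <-]]; exists a; last by exists b.
  move: a Ta; apply: tens_min => // u v Xu Yv.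
  by rewrite -(subnK (ltnW ls)); apply: tfilt_mem.
pose G := sum_set (range (@kos k (d + e))) (sum_set (F s) (tens kt setT (Y l.+1))).
have sG : is_subspace G by apply: sum_set_subspace; [apply: image_subspace|apply: sFY].
have G1 w : G (kos w) by apply: sum_setl; [by have [] := sFY l.+1|exists w].
have G2 x : sum_set (F s) (tens kt setT (Y l.+1)) x -> G x.
  by move=> Fx; apply: sum_setr => //; exists 0; rewrite // linear0.
have [_ GD _] := sG.
have cF x : sum_set (F s) (tens kt setT (Y l.+1)) x ->
    sum_set (F s) (tens kt setT (Y l.+1)) (kcomp p j x).
  case=> a Fa [b Yb <-]; exists (kcomp p j a); first exact: tfilt_kclosed.
  by exists (kcomp p j b); [apply: tens_kclosed|rewrite linearD].
suff Gz : G z.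
  case: Gz => _ [w _ <-] [x Fx E]; exists w.
  by rewrite -E addrC addKr.
rewrite -kz -[z](subrK (kos w0)) -Ey Ec.
have kD x y' : kcomp p j (x + y') = kcomp p j x + kcomp p j y' by rewrite linearD.
have Gk w : G (kcomp p j (kos w)) by rewrite -kos_kcompS.
rewrite !kD; apply: (GD) => //; apply: (GD).
  by apply: G2; apply: cF; apply: sum_setl => //; have [] := tens_subspace kt setT (Y l.+1).
apply: (GD); last by apply: G2; apply: cF; apply: FT.
apply: (GD) => //.
suff : tens kt [set u | kin (U i) (kos u)] [set v | kin (W l) v /\ kin (W l.+1) (kos v)] `<=`
  kcomp p j @^-1` G by apply.
apply: tens_min => [|u v Zu Zv]; first exact: preim_subspace.
apply: (kcomp_pure (X := [set u | kin (U i) (kos u)])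
  (Y := [set v | kin (W l) v /\ kin (W l.+1) (kos v)])) => //.
- by move=> p' j' u' /=; apply: kin_kos_kcomp.
- by move=> p' j' v' [v1 v2]; split; [apply: kin_kcomp|apply: kin_kos_kcomp].
move=> {u v Zu Zv} a b a' b' u v /= Zu [Yv Zv] pE jE.
(* If the left factor bounds, so does the product: u1 (x) v has the right boundary up to a term in A
   (x) W_(l+1). A bounding right factor is treated symmetrically. *)
have [[u1 Hu1]|nu] := pselect (exists u1, kin (U i) (kcomp a b u - kos u1)).
  rewrite -[kcomp a b u](subrK (kos u1)) tmulDl; apply: (GD).
    apply/G2/FT; apply: sum_setl; last exact: tens_mem.
    by have [] := tens_subspace kt setT (Y l.+1).
  have -> : kt (kos u1) (kcomp a' b' v) =
      kos (kt u1 (kcomp a' b' v)) - kt (kpar u1) (kos (kcomp a' b' v)).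
    by rewrite kos_ktens addrK.
  apply: subspaceB => //; apply: G2; apply: sum_setr; first by case: sF.
  exact: tens_mem.
have [[v1 [Yv1 Hv1]]|nv] := pselect (exists v1, kin (W l) v1 /\ kin (W l.+1) (kcomp a' b' v - kos v1)).
  rewrite -[kcomp a' b' v](subrK (kos v1)) tmulDr; apply: (GD).
    by apply: G2; apply: sum_setr; [case: sF|exact: tens_mem].
  have -> : kt (kcomp a b u) (kos v1) =
      kos (kt (kpar (kcomp a b u)) v1) - kt (kos (kpar (kcomp a b u))) v1.
    by rewrite kos_ktens kpar_id addrAC subrr add0r.
  apply: subspaceB => //; apply/G2/FT; apply: sum_setl.
    by have [] := tens_subspace kt setT (Y l.+1).
  apply: tens_mem => //; rewrite kos_kpar; apply: (kinN (ideal_subgmod (idU i))).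
  exact: (kin_kpar (ideal_subgmod (idU i))).
case: nex; exists l, a, a', b, b'; split=> //.
  exists (kcomp a b u); split=> //; first exact: kpr_kcomp.
  exact: kgr_kcomp.
exists (kcomp a' b' v); split=> //.
by rewrite {1}/kcomp kgr_kcomp kpr_kcomp.
Qed.

End FiltrationInduction.
End FiltrationUpperBound.

(** * Homotopies compatible with saturated powers *)

Section GradedIdeals.
Variables (k : fieldType) (n : nat).
Local Notation S := {mpoly k[n]}.
Implicit Types (I J K N : set S).

Definition graded_ideal N : Prop := forall f j, N f -> N (pihomog mdeg j f).

(** Allows gradedness to be checked on generators. *)
Lemma graded_part_ideal N : is_ideal N -> is_ideal [set f | forall j, N (pihomog mdeg j f)].
Proof.
move=> idN; have [N0 ND NM] := idN; split=> /= [j|f g Nf Ng j|r f Nf].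
- by rewrite linear0.
- by rewrite linearD; apply: ND; [apply: Nf|apply: Ng].
- move: r; apply: mpoly_ind_subspace => [|m j].
    have [S0 SD SZ] := ideal_subspace idN; split=> [j|u v Hu Hv j|c u Hu j].
    + by rewrite mul0r linear0.
    + by rewrite mulrDl linearD; apply: ND; [apply: Hu|apply: Hv].
    + by rewrite -scalerAl linearZ; apply: SZ; apply: Hu.
  have Em : pihomog mdeg (mdeg m) 'X_[m] = 'X_[m] :> S by rewrite pihomogX eqxx.
  rewrite mulrC (pihomogM_homog _ _ Em); case: ifP => // _.
  by rewrite mulrC; apply: NM; apply: Nf.
Qed.

Lemma pihomog_ind N f : is_subspace N -> (forall j, N (pihomog mdeg j f)) -> N f.
Proof.
by move=> sN H; rewrite (pihomog_sumE (leqnn (msize f))); apply: subspace_sum.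
Qed.

Lemma ideal_mul_graded I J : is_ideal I -> graded_ideal I -> graded_ideal J ->
  graded_ideal (ideal_mul I J).
Proof.
move=> idI gI gJ f j If; have idN := ideal_mul_ideal I J.
suff : ideal_mul I J `<=` [set f | forall j, ideal_mul I J (pihomog mdeg j f)] by apply.
apply: ideal_mul_min => [|g h Ig Jh {}j]; first exact: graded_part_ideal.
apply: (@pihomog_ind [set g | ideal_mul I J (pihomog mdeg j (g * h))]) => [|a] /=.
  have [S0 SD SZ] := ideal_subspace idN; split=> /= [|u v Hu Hv|c u Hu].
  - by rewrite mul0r linear0.
  - by rewrite mulrDl linearD; apply: SD.
  - by rewrite -scalerAl linearZ; apply: SZ.
rewrite mulrC (pihomogM_homog j h (pihomog_id mdeg a g)); case: ifP => _.
  by rewrite mulrC; apply: ideal_mul_mem; [apply: gI|apply: gJ].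
by have [] := idN.
Qed.

Lemma ideal_exp_graded I s : is_ideal I -> graded_ideal I -> graded_ideal (ideal_exp I s).
Proof. by move=> idI gI; elim: s => [//|s IH]; apply: ideal_mul_graded. Qed.

Lemma sat_power_graded I K s : is_ideal I -> is_ideal K -> graded_ideal I ->
  graded_ideal K -> graded_ideal (sat_power I K s).
Proof.
move=> idI idK gI gK f j [t t1 Hf]; exists t => // g Kg.
have sI := ideal_subspace (ideal_exp_ideal I s).
apply: (@pihomog_ind [set g | ideal_exp I s (pihomog mdeg j f * g)]) => [|b] /=.
  have [S0 SD SZ] := sI; split=> /= [|u v Hu Hv|c u Hu].
  - by rewrite mulr0.
  - by rewrite mulrDr; apply: SD.
  - by rewrite -scalerAr; apply: SZ.
have := pihomogM_homog (j + b) f (pihomog_id mdeg b g).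
rewrite leq_addl addnK => <-; apply: ideal_exp_graded => //.
by apply: Hf; apply: ideal_exp_graded.
Qed.

End GradedIdeals.

(** * Characteristic 0: the de Rham homotopy *)

Section DeRham.
Variables (k : fieldType) (n : nat).
Local Notation S := {mpoly k[n]}.
Local Notation KS := {ffun {set 'I_n} -> S}.
Implicit Types (I K : set S).

Lemma ideal_exp_deriv I s i f : ideal_exp I s.+1 f -> ideal_exp I s (mderiv i f).
Proof.
elim: s f => [//|s IH] f.
have idN := ideal_exp_ideal I s.+1; have [N0 ND NM] := idN.
(* The derivative of r u involves u itself; recording both memberships makes this set an ideal. *)
suff : ideal_mul I (ideal_exp I s.+1) `<=`
  [set f | ideal_exp I s.+1 f /\ ideal_exp I s.+1 (mderiv i f)] by move=> H /H[].
apply: ideal_mul_min => [|g h Ig Jh /=].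
  split=> /= [|u v [u0 u1] [v0 v1]|r u [u0 u1]]; split.
  - by [].
  - by rewrite linear0.
  - exact: ND.
  - by rewrite linearD; apply: ND.
  - exact: NM.
  - by rewrite mderivM; apply: ND; apply: NM.
split; first exact: NM.
rewrite mderivM; apply: ND; first exact: NM.
by apply: ideal_mul_mem => //; apply: IH.
Qed.

Lemma sat_power_deriv I K s i f : sat_power I K s.+1 f -> sat_power I K s (mderiv i f).
Proof.
(* One more factor of K is needed because the derivative of g also appears and must lie in K^t. *)
move=> [t /= t1 Hf]; exists t.+1 => // g Kg.
have Kg' : ideal_exp K t g by apply: ideal_exp_anti Kg.
have [N0 ND NM] := ideal_exp_ideal I s.
have -> : mderiv i f * g = mderiv i (f * g) - f * mderiv i g by rewrite mderivM addrK.
rewrite -mulN1r; apply: ND; first by apply: ideal_exp_deriv; apply: Hf.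
apply: NM; apply: (@ideal_exp_anti _ I s s.+1) => //; apply: Hf.
exact: ideal_exp_deriv.
Qed.

Definition dweight (c : nat -> k) : S -> S := lext (fun m => c (mdeg m) *: 'X_[m]).
HB.instance Definition _ c := GRing.Linear.on (dweight c).

Lemma dweightX c m : dweight c 'X_[m] = c (mdeg m) *: 'X_[m].
Proof. exact: lextX. Qed.

Lemma dweight_homog c j p : dweight c (pihomog mdeg j p) = c j *: pihomog mdeg j p.
Proof.
have H := @linear_mpoly_eq k n _ (dweight c \o pihomog mdeg j)
  ((fun q => c j *: q) \o pihomog mdeg j).
apply: H => m /=; rewrite pihomogX /=; case: eqP => [<-|_]; first exact: dweightX.
by rewrite linear0 scaler0.
Qed.

Lemma dweight_mem c (N : set S) p : is_subspace N -> graded_ideal N -> N p -> N (dweight c p).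
Proof.
move=> sN gN Np; have [_ _ NZ] := sN.
rewrite (pihomog_sumE (leqnn (msize p))) linear_sum; apply: subspace_sum => // j _ /=.
by rewrite dweight_homog; apply: NZ; apply: gN.
Qed.

Lemma dweight_mulX c c' i p : (forall a, c a.+1 = c' a) ->
  dweight c ('X_i * p) = 'X_i * dweight c' p.
Proof.
move=> cc'; have H := @linear_mpoly_eq k n _ (dweight c \o mulX i) (mulX i \o dweight c').
apply: H => m; rewrite /= /mulX -mpolyXD !dweightX mdegD mdeg1 cc' -scalerAr.
by rewrite -mpolyXD.
Qed.

(** The weight depends on the total degree, which the Koszul differential preserves. *)
Definition kdweight (c : nat -> k) (a : KS) : KS :=
  [ffun T : {set 'I_n} => dweight (fun j => c (j + #|T|)%N) (a T)].

Lemma kos_kdweight c a : kos (kdweight c a) = kdweight c (kos a).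
Proof.
apply/ffunP => T; rewrite ffunE /kos !(@koszulE n (polg k n)) linear_sum.
apply: eq_bigr => i _ /=; case: (boolP (i \in T)) => iT; first by rewrite linear0.
rewrite ffunE /mulX (@dweight_mulX _ (fun j => c (j + #|i |: T|)%N)); last first.
  by move=> b; rewrite cardsU1 iT add1n addnS addSn.
by congr (_ * _); rewrite /csign; case: osign; rewrite ?linearN.
Qed.

Definition dderiv (a : KS) : KS := \sum_i cre i (kmap (mderiv i) a).

Lemma dderiv_linear : linear dderiv.
Proof.
move=> c a b; rewrite /dderiv scaler_sumr -big_split; apply: eq_bigr => i _ /=.
apply/ffunP => T; rewrite !ffunE; case: ifP => _; last by rewrite scaler0 addr0.
by rewrite linearP /csign; case: osign; rewrite // opprD scalerN.
Qed.
HB.instance Definition _ := GRing.isLinear.Build _ _ _ _ dderiv dderiv_linear.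

Lemma kdweight_linear c : linear (kdweight c).
Proof. by move=> r a b; apply/ffunP => T; rewrite !ffunE linearP. Qed.
HB.instance Definition _ c := GRing.isLinear.Build _ _ _ _ (kdweight c) (kdweight_linear c).

(* Cartan's formula: the Koszul differential is the contraction with the Euler
   vector field, whose Lie derivative multiplies by the total degree. *)
Lemma cartan (a : KS) : kos (dderiv a) + dderiv (kos a) = kdweight (fun j => j%:R) a.
Proof.
have mdX i j (p : S) : mderiv i (mulX j p) = mulX j (mderiv i p) + (if i == j then p else 0).
  rewrite /mulX mderivM mderivX mnm1E addrC eq_sym; congr (_ + _); case: eqP => [->|_].
    have -> : (U_(j) - U_(j))%MM = 0%MM by apply/mnmP => l; rewrite mnmBE subnn mnm0E.
    by rewrite mpolyX0 scale1r mul1r.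
  by rewrite scale0r mul0r.
have E1 : kos (dderiv a) = \sum_i \sum_j kmap (mulX j) (ann j (cre i (kmap (mderiv i) a))).
  rewrite /dderiv linear_sum; apply: eq_bigr => i _; exact: kosE.
have E2 : dderiv (kos a) = \sum_i \sum_j (kmap (mulX j) (cre i (ann j (kmap (mderiv i) a)))
    + (if i == j then cre i (ann j a) else 0)).
  rewrite /dderiv; apply: eq_bigr => i _; rewrite kosE !raddf_sum; apply: eq_bigr => j _ /=.
  rewrite kmap_comp ann_kmap -!cre_kmap kmap_comp.
  have -> (f : KS) : kmap (mderiv i \o mulX j) f =
      kmap (mulX j \o mderiv i) f + (if i == j then f else 0).
    apply/ffunP => T; rewrite !ffunE /= mdX; congr (_ + _).
    by case: eqP => _ //; rewrite ffunE.
  by rewrite raddfD /=; case: eqP => //= _; rewrite raddf0.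
have E3 i : \sum_j kmap (mulX j) (ann j (cre i (kmap (mderiv i) a))) +
    \sum_j (kmap (mulX j) (cre i (ann j (kmap (mderiv i) a))) + (if i == j then cre i (ann j a) else 0))
    = kmap (mulX i \o mderiv i) a + cre i (ann i a).
  rewrite -big_split /= (bigD1 i) //= eqxx big1 => [|j ji].
    rewrite addr0 addrA; congr (_ + _).
    by rewrite -[LHS](raddfD (kmap (mulX i))) addrC cre_ann eqxx /= kmap_comp.
  by rewrite eq_sym (negbTE ji) addr0 -[LHS](raddfD (kmap (mulX j))) addrC cre_ann eq_sym (negbTE ji) raddf0.
rewrite E1 E2 -big_split /= (eq_bigr _ (fun i _ => E3 i)).
apply/ffunP => T; rewrite sum_ffunE ffunE.
(* Euler's operator counts the polynomial degree, and the sum of the [cre i] after [ann i] counts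
   the elements of T. *)
have -> : \sum_i (kmap (mulX i \o mderiv i) a + cre i (ann i a)) T =
   (\sum_i mulX i (mderiv i (a T))) + (#|T|%:R *: a T).
  rewrite scaler_nat -sumr_const [X in _ = _ + X]big_mkcond -big_split; apply: eq_bigr => i _.
  by rewrite ffunE cre_annE ffunE.
move: (a T); apply: mpoly_ind_subspace => [|m] /=.
  split=> /= [|u v Hu Hv|c u Hu].
  - by rewrite !linear0 ?scaler0 addr0 big1 // => i _; rewrite !linear0.
  - rewrite [dweight _ _]linearD /= -Hu -Hv scalerDr [RHS]addrACA -big_split; congr (_ + _).
    by apply: eq_bigr => i _; rewrite !linearD.
  - rewrite [dweight _ _]linearZ /= -Hu scalerDr scaler_sumr; congr (_ + _); last by rewrite !scalerA mulrC.
    by apply: eq_bigr => i _; rewrite !linearZ.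
rewrite dweightX natrD scalerDl mdegE natr_sum scaler_suml; congr (_ + _).
apply: eq_bigr => i _; rewrite mderivX linearZ /= /mulX -mpolyXD.
case: (posnP (m i)) => [->|mi]; first by rewrite !scale0r.
by rewrite addmC submK // lep1mP -lt0n.
Qed.

(** Positive total degrees are invertible; total degree 0 is the constant part, which is killed. *)
Lemma kdweight_inv (a : KS) : [pchar k] =i pred0 ->
  kdweight (fun j => j%:R) (kdweight (fun j => j%:R^-1) a) = a - kconst a.
Proof.
move=> char0; apply/ffunP => T; rewrite !ffunE.
have -> : (if #|T| == 0 then ((a finset.set0)@_0%MM)%:MP else 0) =
    (if #|T| == 0 then ((a T)@_0%MM)%:MP else 0) :> S.
  by case: eqP => // /cards0_eq ->.
move: (a T); apply: mpoly_ind_subspace => [|m] /=.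
  split=> /= [|u v Hu Hv|c u Hu].
  - by rewrite !linear0 ?mpolyC0 if_same subr0.
  - rewrite [dweight _ (u + v)]linearD [dweight _ (_ + _)]linearD /= Hu Hv mcoeffD mpolyCD addrACA -opprD; congr (_ - _).
    by case: ifP => _; rewrite ?addr0.
  - rewrite [dweight _ (c *: u)]linearZ [dweight _ (_ *: _)]linearZ /= Hu scalerBr mcoeffZ; congr (_ - _).
    by case: ifP => _; rewrite ?scaler0 // mpolyCM mul_mpolyC.
rewrite dweightX linearZ /= dweightX scalerA mulrC mcoeffX.
case: (eqVneq (mdeg m + #|T|)%N 0) => [/eqP|nz].
  rewrite addn_eq0 mdeg_eq0 => /andP[/eqP -> /eqP ->].
  by rewrite mdeg0 mul0r scale0r eqxx mpolyX0 subrr.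
have nR := (@pcharf0P k).1 char0; rewrite mulfV ?nR // scale1r; case: (eqVneq #|T| 0) nz => [->|_ _].
  by rewrite addn0 mdeg_eq0 => /negbTE ->; rewrite mpolyC0 subr0.
by rewrite subr0.
Qed.

Lemma filtered_homotopy_pchar0 I K : [pchar k] =i pred0 -> homogeneous_ideal I ->
  homogeneous_ideal K -> filtered_homotopy (sat_power I K).
Proof.
move=> char0 [idI gI] [idK gK]; exists (dderiv \o kdweight (fun j => j%:R^-1)).
split=> [u /=|i u Uu]; first by rewrite -kos_kdweight cartan kdweight_inv.
have sM := ideal_subgmod (sat_power_ideal I K i).
apply: (kin_sum sM) => c _; apply: (kin_cre sM) => T.
rewrite !ffunE; apply: sat_power_deriv; apply: dweight_mem => //.
  exact: ideal_subspace (sat_power_ideal _ _ _).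
exact: sat_power_graded.
Qed.

End DeRham.

(** * Monomial ideals: division by variables *)

Section Monomial.
Variables (k : fieldType) (n : nat).
Local Notation S := {mpoly k[n]}.
Local Notation KS := {ffun {set 'I_n} -> S}.
Implicit Types (I J K N : set S) (m : 'X_{1..n}).

(** Monomiality without chosen generators, a form that passes directly to products and
    saturations. *)
Definition supp_closed N : Prop := forall f m, N f -> m \in msupp f -> N 'X_[m].

Lemma msupp_ideal (P : set 'X_{1..n}) : (forall m m', P m -> P (m' + m)%MM) ->
  is_ideal [set f : S | forall m, m \in msupp f -> P m].
Proof.
move=> PD; split=> /= [m|f g Pf Pg m|r f Pf m]; first by rewrite msupp0.
  by move/msuppD_le; rewrite mem_cat => /orP[/Pf|/Pg].
by move/msuppM_le/allpairsP => [[m1 m2] /= [_ /Pf ? ->]]; apply: PD.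
Qed.

Lemma ideal_mulX N m m' : is_ideal N -> N 'X_[m] -> N 'X_[(m' + m)].
Proof. by move=> [_ _ NM] Nm; rewrite mpolyXD; apply: NM. Qed.

Lemma supp_closed_ideal N : is_ideal N -> is_ideal [set f : S | forall m, m \in msupp f -> N 'X_[m]].
Proof.
by move=> idN; exact: (@msupp_ideal [set m | N 'X_[m]] (fun m m' => ideal_mulX m' idN)).
Qed.

Lemma monomial_supp_closed I : monomial_ideal I -> supp_closed I.
Proof.
move=> [G ->] f m; have idI := @ideal_gen_ideal _ [set ('X_[m'] : S) | m' in G].
move=> If; move: f If m; apply: (ideal_gen_min (supp_closed_ideal idI)) => _ [m' Gm' <-] m.
by rewrite msuppX inE => /eqP ->; apply: sub_ideal_gen; exists m'.
Qed.

Lemma ideal_mul_supp I J : supp_closed I -> supp_closed J -> supp_closed (ideal_mul I J).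
Proof.
move=> cI cJ f m If; move: f If m; apply: (ideal_mul_min (supp_closed_ideal (ideal_mul_ideal I J))) => f g If Jg m.
move=> /msuppM_le/allpairsP[[m1 m2] /= [/(cI _ _ If) m1f /(cJ _ _ Jg) m2g ->]].
by rewrite mpolyXD; apply: ideal_mul_mem.
Qed.

Lemma ideal_exp_supp I s : supp_closed I -> supp_closed (ideal_exp I s).
Proof. by move=> cI; elim: s => [//|s IH]; apply: ideal_mul_supp. Qed.

Lemma ideal_colon_monomial I K f : is_ideal I -> supp_closed K ->
  (forall m, K 'X_[m] -> I (f * 'X_[m])) -> ideal_colon I K f.
Proof.
move=> idI cK H g Kg; rewrite [g]mpolyE mulr_sumr.
apply: subspace_sum_seq => [|m mg]; first exact: ideal_subspace.
have [_ _ IZ] := ideal_subspace idI.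
by rewrite -scalerAr; apply: IZ; apply: H; apply: cK mg.
Qed.

Lemma sat_power_supp I K s : supp_closed I -> supp_closed K -> supp_closed (sat_power I K s).
Proof.
move=> cI cK f m [t t1 Hf] mf; exists t => //.
apply: ideal_colon_monomial; [exact: ideal_exp_ideal|exact: ideal_exp_supp|move=> m' Km'].
rewrite -mpolyXD; apply: (ideal_exp_supp cI (Hf _ Km')).
by rewrite (perm_mem (msuppMX _ _)) addmC; apply: map_f.
Qed.

(** A variable divides some factor of a product of s + 1 monomials of I times a cofactor; removing
    it spoils at most one factor. *)
Lemma ideal_exp_drop I s m c : supp_closed I -> ideal_exp I s.+1 'X_[m] -> (0 < m c)%N ->
  ideal_exp I s 'X_[m - U_(c)].
Proof.
move=> cI; elim: s m c => [//|s IH] m c Im mc.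
pose P := [set m' | ideal_exp I s.+2 'X_[m'] /\
  forall c', (0 < m' c')%N -> ideal_exp I s.+1 'X_[m' - U_(c')]].
suff : ideal_exp I s.+2 `<=` [set f : S | forall m, m \in msupp f -> P m].
  by move=> /(_ _ Im m); rewrite msuppX inE eqxx => /(_ isT)[_]; apply.
have idN := ideal_exp_ideal I s.+2; have idN' := ideal_exp_ideal I s.+1.
have subU (m1 m2 : 'X_{1..n}) c' : (0 < m2 c')%N ->
    'X_[m1 + m2 - U_(c')] = 'X_[m1] * 'X_[m2 - U_(c')] :> S.
  by move=> m2c; rewrite -mpolyXD addmBA // lep1mP -lt0n.
apply: ideal_mul_min => [|f g If Ig m'].
  apply: msupp_ideal => m1 m2 [P1 P2]; split=> [|c']; first exact: (@ideal_mulX _ m1 m2 idN P1).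
  rewrite mnmDE addn_gt0 => /orP[m2c|m1c].
    rewrite addmC subU //; have [_ _ NM] := idN'; rewrite mulrC; apply: NM.
    exact: (@ideal_exp_anti _ I s.+1 s.+2).
  by rewrite subU //; have [_ _ NM] := idN'; apply: NM; apply: P2.
move=> /msuppM_le/allpairsP[[m1 m2] /= [/(cI _ _ If) m1f m2g ->]].
have {}m2g := @ideal_exp_supp I s.+1 cI g m2 Ig m2g.
split=> [|c']; first by rewrite mpolyXD; apply: ideal_mul_mem.
rewrite mnmDE addn_gt0 => /orP[m1c|m2c].
  by rewrite addmC subU //; have [_ _ NM] := idN'; rewrite mulrC; apply: NM.
by rewrite subU //; apply: ideal_mul_mem => //; apply: IH.
Qed.

Lemma sat_power_drop I K s m c : supp_closed I -> supp_closed K ->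
  sat_power I K s.+1 'X_[m] -> (0 < m c)%N -> sat_power I K s 'X_[m - U_(c)].
Proof.
move=> cI cK [t t1 Hm] mc; exists t => //.
apply: ideal_colon_monomial; [exact: ideal_exp_ideal|exact: ideal_exp_supp|move=> m' Km'].
rewrite -mpolyXD addmC addmBA ?lep1mP -?lt0n //; apply: ideal_exp_drop => //.
  by rewrite addmC mpolyXD; apply: Hm.
by rewrite mnmDE addn_gt0 mc orbT.
Qed.

Lemma lext_mem N N' (h : {linear S -> S}) f : supp_closed N -> is_subspace N' ->
  (forall m, N 'X_[m] -> N' (h 'X_[m])) -> N f -> N' (h f).
Proof.
move=> cN sN' H Nf; rewrite [f]mpolyE linear_sum; apply: subspace_sum_seq => // m mf.
have [_ _ NZ] := sN'; rewrite linearZ; apply: NZ; apply: H; exact: cN mf.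
Qed.

Lemma filtered_homotopy_monomial I K : monomial_ideal I -> monomial_ideal K ->
  filtered_homotopy (sat_power I K).
Proof.
move=> /monomial_supp_closed cI /monomial_supp_closed cK.
have cU i : supp_closed (sat_power I K i) by apply: sat_power_supp.
have idU := sat_power_ideal I K; have sU i := ideal_subspace (idU i).
exists (mhom (enum 'I_n)); split=> [u|i u Uu]; first by rewrite mhomP kconst_mprojE.
elim: (enum _) u Uu => [|c r IH] u Uu /=; first exact: (kin0 (ideal_subgmod (idU i))).
apply: (kinD (ideal_subgmod (idU i))); last apply: IH => T.
  have := kin_cre (ideal_subgmod (idU i.+1)) c Uu => Hc T; rewrite ffunE.
  apply: lext_mem (Hc T) => // m Um; rewrite /= xdivX; case: ifP => mc.
    exact: sat_power_drop.
  by have [] := idU i.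
rewrite ffunE; case: ifP => _; first by have [] := idU i.+1.
apply: lext_mem (Uu T) => // m Um; rewrite /= xnilX; case: ifP => // _.
by have [] := idU i.+1.
Qed.

End Monomial.

(** * Extremal Koszul classes *)

Section Extremal.
Variables (k : fieldType) (n : nat).
Local Notation S := {mpoly k[n]}.
Local Notation KS := {ffun {set 'I_n} -> S}.
Local Notation knz := (@knz n (polg k n)).
Local Notation knzj := (@knzj n (polg k n)).
Implicit Types (N : set S).

Lemma knzj_deg N p j : is_ideal N -> knzj N p j -> (p <= j)%N.
Proof.
case=> N0 _ _ [a [pa ja _ na]]; rewrite leqNgt; apply/negP => jp; apply: na; exists 0 => T.
rewrite raddf0 subr0 -pa ffunE; case: eqP => // Tp.
by rewrite -ja ffunE Tp leqNgt jp.
Qed.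

(** H_0 is S/N modulo the variables, hence generated by 1: a form of positive degree is a boundary
    by the homotopy. *)
Lemma knzj0_deg N j : is_ideal N -> knzj N 0 j -> j = 0.
Proof.
case=> N0 _ _ [a [pa ja _ na]]; apply/eqP; apply: contrapT => /negP j0; apply: na.
exists (mhom (enum 'I_n) a) => T.
have /eqP := mhomP (enum 'I_n) a; rewrite kconst_mprojE.
have -> : kos a = 0 by rewrite -pa; exact: (@koszul_kpr0 n (polg k n)).
have -> : kconst a = 0.
  apply/ffunP => T'; rewrite !ffunE -ja ffunE cards0 subn0 /= mcoeff_pihomog mdeg0.
  by rewrite [0 == j]eq_sym (negbTE j0) mpolyC0 if_same.
by rewrite raddf0 addr0 subr0 => /eqP; rewrite /kos => ->; rewrite subrr ffunE.
Qed.

Lemma pihomog0E (f : S) : pihomog mdeg 0 f = (f@_0%MM)%:MP.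
Proof.
apply/mpolyP => m; rewrite mcoeff_pihomog mcoeffC mdeg_eq0 eq_sym.
by case: eqP => [->|_]; rewrite ?mulr1 ?mulr0.
Qed.

Lemma proper_sub_irrelevant N : homogeneous_ideal N -> ~ N 1 -> N `<=` @irrelevant_ideal k n.
Proof.
move=> [[N0 ND NM] gN] N1 f Nf; apply/eqP; apply: contrapT => /negP f0; apply: N1.
have := NM ((f@_0%MM)^-1)%:MP _ (gN f 0 Nf).
by rewrite pihomog0E -mpolyCM mulVf.
Qed.

(* A nonzero form of minimal degree in N is a minimal generator, hence gives a
   nonzero class in H_1. *)
Lemma knz1_of_neq0 N f : homogeneous_ideal N -> N `<=` @irrelevant_ideal k n ->
  N f -> f != 0 -> knz N 1.
Proof.
move=> [idN gN] Nm Nf f0.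
pose P j := `[< exists g, N g /\ pihomog mdeg j g != 0 >].
have exP : exists j, P j.
  apply: contrapT => nex; case/eqP: f0; rewrite (pihomog_sumE (leqnn (msize f))).
  apply: big1 => j _; apply/eqP; apply: contrapT => /negP fj.
  by apply: nex; exists j; apply/asboolP; exists f.
case: (ex_minnP exP) => j /asboolP[g [Ng gj]] minj.
set h := pihomog mdeg j g in gj; have Nh : N h by apply: gN.
pose c : KS := [ffun T : {set 'I_n} => if #|T| == 0 then h else 0].
have pc : kpr 0 c = c by apply/ffunP=> T; rewrite !ffunE; case: (_ == _).
have kc : kconst c = 0.
  by apply/ffunP=> T; rewrite !ffunE cards0 eqxx (Nm _ Nh) mpolyC0 if_same.
have Ec : kos (mhom (enum 'I_n) c) = c.
  have := mhomP (enum 'I_n) c; rewrite kconst_mprojE kc subr0 => {2}<-.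
  have -> : kos c = 0 by rewrite -pc; exact: (@koszul_kpr0 n (polg k n)).
  by rewrite raddf0 addr0.
have Ec1 : kos (kpr 1 (mhom (enum 'I_n) c)) = c by rewrite kos_kprS Ec.
exists (kpr 1 (mhom (enum 'I_n) c)); split.
- by rewrite kpr_id.
- by rewrite -/(kos _) Ec1 => T; rewrite ffunE; case: ifP => _ //; have [] := idN.
- case=> b Hb; case/eqP: gj; rewrite -[LHS](pihomog_id mdeg j g) -/h.
  have -> : h = c finset.set0 by rewrite ffunE cards0.
  pose z : KS := kpr 1 (mhom (enum 'I_n) c) - kos b.
  have <- : kos z = c by rewrite linearB /= kos_kos subr0.
  have Nz T : N (z T) by apply: Hb.
  rewrite /kos (@koszulE n (polg k n)) linear_sum big1 // => i _; rewrite finset.in_set0 /= /mulX.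
  move: (z _) (Nz (i |: finset.set0)) => q Nq.
  case: (posnP j) => [->|j0]; first by rewrite pihomogX0.
  rewrite -[j]prednK // pihomogXS.
  (* A bounding chain would write h as the degree j part of a combination of variables with
     coefficients in [N], but by minimality these have no component of degree j - 1. *)
  suff E : pihomog mdeg j.-1 q = 0 by case: osign; rewrite /= ?linearN /= E ?oppr0 mulr0.
  apply/eqP; apply: contrapT => /negP qj; have := minj j.-1.
  rewrite leqNgt prednK // leqnn => H; suff : false by []; apply: H; apply/asboolP; by exists q.
Qed.

(* [t.+1] is the projective dimension and [r] the regularity of S/N. *)
Definition extremal N t (r : int) : Prop :=
  [/\ exists j, knzj N t.+1 j, exists p j, knzj N p.+1 j /\ j%:Z - p.+1%:Z = r &
      forall p j, knzj N p j -> (p <= t.+1)%N /\ j%:Z - p%:Z <= r].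

Lemma extremal_exists N p0 : homogeneous_ideal N -> knz N p0.+1 -> exists t r, extremal N t r.
Proof.
move=> hN Np0; have [idN gN] := hN.
have sN := ideal_subgmod idN; have gN' : graded_sub (N : set (polg k n)) by move=> a u; apply: gN.
have kE p := knz_knzj sN p gN'.
pose P p := `[< knz N p.+1 >]; have exP : exists p, P p by exists p0; apply/asboolP.
have [|t /asboolP Nt tmax] := ex_maxnP exP (m := n); first by move=> p /asboolP /(knz_le sN) /ltnW.
have [jmax Hj] := betti_support_finite hN.
pose Pr q := `[< exists p j, knzj N p.+1 j /\ j = (q + p.+1)%N >].
have exPr : exists q, Pr q.
  have [j Hpj] := (kE t.+1).1 Nt; exists (j - t.+1)%N; apply/asboolP; exists t, j.
  by rewrite subnK // (knzj_deg idN Hpj).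
have [|q /asboolP[p [j [Npj Ej]]] qmax] := ex_maxnP exPr (m := jmax).
  by move=> q /asboolP[p [j [/Hj jN E]]]; lia.
exists t, q%:Z; split.
- exact/kE.
- by exists p, j; split=> //; rewrite Ej; lia.
(* Homological degree 0 only contributes the value 0, while q is a natural number; so the regularity
   is attained in positive degree. *)
- move=> [|p'] j' N'; first by rewrite (knzj0_deg idN N'); split=> //; lia.
  have := knzj_deg idN N' => lej; split.
    by rewrite ltnS; apply: tmax; apply/asboolP/kE; exists j'.
  have : Pr (j' - p'.+1)%N by apply/asboolP; exists p', j'; rewrite subnK.
  by move/qmax; lia.
Qed.

Lemma extremal_quot N t r : homogeneous_ideal N -> extremal N t r ->
  [/\ (t < n)%N, depth_quot N = EFin (n - t.+1)%N%:Z & reg_quot N = EFin r].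
Proof.
move=> hN [exj [p [j [Npj Er]]] Hmax]; have [idN gN] := hN.
have sN := ideal_subgmod idN; have gN' : graded_sub (N : set (polg k n)) by move=> a u; apply: gN.
have kE q := knz_knzj sN q gN'.
have Nt : knz N t.+1 by apply/kE.
have N1 : ~ N 1 by move=> N1; exact: (@knz_full n (polg k n) N t.+1 (ideal_unit idN N1) Nt).
split; first exact: knz_le Nt.
- apply: depth_quotE => //; first exact: proper_sub_irrelevant.
  by move=> q /kE[j' /Hmax[]].
- by rewrite (reg_quotE hN Npj) ?Er // => p' j' /Hmax[].
Qed.

End Extremal.

Section SaturatedPowers.
Variables (k : fieldType) (n : nat) (I K : set {mpoly k[n]}).
Hypotheses (hI : homogeneous_ideal I) (hK : homogeneous_ideal K).
Local Notation U := (sat_power I K).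

Lemma sat_power_homogeneous i : homogeneous_ideal (U i).
Proof.
have [[idI gI] [idK gK]] := (hI, hK).
by split; [exact: sat_power_ideal|exact: sat_power_graded].
Qed.

(** A nonzero element of I has nonzero powers, so a proper I^(i+1) is nonzero and has H_1.
    Properness is decided at exponent 1 for all i. *)
Lemma sat_power_cases : I <> [set 0] ->
  (forall i, U i 1) \/ (forall i, exists t r, extremal (U i.+1) t r).
Proof.
move=> I0; have [[idI gI] [idK gK]] := (hI, hK); have [II0 _ _] := idI.
have [U1|nU1] := pselect (U 1 1); [left; exact: sat_power_unit|right=> i].
have [f If f0] : exists2 f, I f & f != 0.
  apply: contrapT => nex; apply: I0; apply/seteqP; split=> [f If /=|_ -> //].
  by apply/eqP; apply: contrapT => /negP f0; apply: nex; exists f.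
have Ifs : ideal_exp I i.+1 (f ^+ i.+1).
  elim: i.+1 => [|s IH]; first by [].
  by rewrite exprS; apply: ideal_mul_mem.
have hU := sat_power_homogeneous i.+1.
have nUi : ~ U i.+1 1.
  by elim: (i) => [//|l IH] U1; apply: IH; apply: sat_power_anti.
apply: (@extremal_exists _ _ _ 0) => //.
apply: (@knz1_of_neq0 _ _ _ (f ^+ i.+1)) => //.
- exact: proper_sub_irrelevant.
- exact: sat_power_sub.
- exact: expf_neq0.
Qed.

(** In the extended integers -oo absorbs +oo; excluding it keeps sums with an infinite depth equal
    to +oo. *)
Lemma depth_sat_power_neq i : I <> [set 0] -> depth_quot (U i) <> ENInf int.
Proof.
move=> I0; case: (sat_power_cases I0) => [U1|ext]; first by rewrite depth_quot_unit.
case: i => [|i]; first by rewrite sat_power0 depth_quot_unit.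
by have [t [r /(extremal_quot (sat_power_homogeneous _))[_ -> _]]] := ext i.
Qed.

End SaturatedPowers.

Section BigExtremum.
Variables (disp : Order.disp_t) (T : orderType disp) (A : eqType).
Implicit Types (r : seq A) (F : A -> T) (x : T).
Local Open Scope order_scope.

Lemma bigmin_attained r F x0 x : x <= x0 -> (forall i, i \in r -> x <= F i) ->
  (exists2 i, i \in r & F i <= x) -> x = \big[Order.min/x0]_(i <- r) F i.
Proof.
move=> xx0 xF [i ir Fi]; apply: le_anti; rewrite (@bigmin_inf_seq _ _ _ _ _ i _ _ _ ir) // andbT.
by rewrite big_seq; apply: le_bigmin.
Qed.

Lemma bigmax_attained r F x0 x : x0 <= x -> (forall i, i \in r -> F i <= x) ->
  (exists2 i, i \in r & x <= F i) -> x = \big[Order.max/x0]_(i <- r) F i.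
Proof.
move=> xx0 xF [i ir Fi]; apply: le_anti; rewrite (@bigmax_sup_seq _ _ _ _ _ i _ _ _ ir) //=.
by rewrite big_seq; apply: bigmax_le.
Qed.

End BigExtremum.

(** * Extremal classes of the sum of two ideals *)

Section SumOfIdeals.
Local Arguments tmul : simpl never.
Variables (k : fieldType) (d e : nat).
Variables (I K : set {mpoly k[d]}) (J L : set {mpoly k[e]}).
Hypotheses (hI : homogeneous_ideal I) (hK : homogeneous_ideal K).
Hypotheses (hJ : homogeneous_ideal J) (hL : homogeneous_ideal L).
Local Notation pt := (ptens k d e).
Local Notation U := (sat_power I K).
Local Notation W := (sat_power J L).

Let idU i : is_ideal (U i) := sat_power_ideal I K i.
Let idW i : is_ideal (W i) := sat_power_ideal J L i.
Let gU i : graded_sub (U i : set (polg k d)).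
Proof. by move=> a u; have [_] := sat_power_homogeneous hI hK i; apply. Qed.
Let gW i : graded_sub (W i : set (polg k e)).
Proof. by move=> a u; have [_] := sat_power_homogeneous hJ hL i; apply. Qed.
Let Um i : U i.+1 `<=` U i := @sat_power_anti _ I K i.
Let Wm i : W i.+1 `<=` W i := @sat_power_anti _ J L i.

Lemma tfilt_homogeneous s : homogeneous_ideal (tfilt pt U W s).
Proof.
split=> [|f c]; first exact: tfilt_ideal.
suff : tfilt pt U W s `<=` pihomog mdeg c @^-1` tfilt pt U W s by apply.
have sT := tfilt_subspace pt U W s.
apply: tfilt_min => [|i j u v ij Uu Wv /=]; first exact: preim_subspace.
have sX := preim_subspace (pihomog mdeg c) sT.
rewrite (pihomog_sumE (leqnn (msize u))) (pihomog_sumE (leqnn (msize v))).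
rewrite tmul_suml linear_sum; apply: subspace_sum => // a _.
rewrite tmul_sumr linear_sum; apply: subspace_sum => // b _.
rewrite /= pihomog_pt; case: ifP => _; last by case: sT.
by rewrite -ij; apply: tfilt_mem; [apply: gU|apply: gW].
Qed.

Section Extrema.
Hypotheses (hU : filtered_homotopy U) (hW : filtered_homotopy W).
Variables (tU tW : nat -> nat) (rU rW : nat -> int).
Hypotheses (eU : forall i, extremal (U i.+1) (tU i) (rU i)).
Hypotheses (eW : forall i, extremal (W i.+1) (tW i) (rW i)).

Lemma extremal_tfilt s t r : extremal (tfilt pt U W s.+1) t r ->
  [/\ forall i l, (i + l)%N = s -> (tU i + tW l < t)%N /\ rU i + rW l <= r,
      forall i l, (i + l.+1)%N = s -> (tU i + tW l <= t)%N /\ rU i + rW l + 1 <= r,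
      (exists i l, (i + l)%N = s /\ (t <= (tU i + tW l).+1)%N) \/
      (exists i l, (i + l.+1)%N = s /\ (t <= tU i + tW l)%N) &
      (exists i l, (i + l)%N = s /\ r <= rU i + rW l) \/
      (exists i l, (i + l.+1)%N = s /\ r <= rU i + rW l + 1)].
Proof.
move=> [[jt Ht] [pr [jr [Hr Er]]] Hmax].
have inv p j : knzj (tfilt pt U W s.+1 : set (polg k (d + e))) p j ->
    (exists i l, (i + l)%N = s /\ ((p <= (tU i).+1 + (tW l).+1)%N /\ j%:Z - p%:Z <= rU i + rW l)) \/
    (exists i l, (i + l.+1)%N = s /\ ((p <= (tU i + tW l).+1)%N /\ j%:Z - p%:Z <= rU i + rW l + 1)).
  move=> H; have [||l [p1 [p2 [j1 [j2 [ls Ep Ej]]]]]] := knzj_tfilt_inv idU idW gU gW Um Wm _ _ H.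
  - exact: sat_power0.
  - exact: sat_power0.
  rewrite subSn // => H1 /(knz_gr_cases idW gW Wm) [H2|].
    left; exists (s - l)%N, l; split; first by rewrite subnK.
    have [_ _ /(_ _ _ H1)[? ?]] := eU (s - l); have [_ _ /(_ _ _ H2)[? ?]] := eW l.
    by rewrite -Ep -Ej; split; lia.
  (* For l = 0 the second alternative would be a class of B/W_0 = 0. *)
  case: l ls H1 => [|l] ls H1 H2.
    case: (@knz_full e (polg k e) (W 0) p2.+1); first exact: sat_power0.
    by have [a [? _ ? ?]] := H2; exists a.
  right; exists (s - l.+1)%N, l; split; first by rewrite subnK.
  have [_ _ /(_ _ _ H1)[? ?]] := eU (s - l.+1); have [_ _ /(_ _ _ H2)[? ?]] := eW l.
  by rewrite -Ep -Ej; split; lia.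
split.
- move=> i l il; have [[j1 H1] [p1 [j1' [H1' E1]]] _] := eU i.
  have [[j2 H2] [p2 [j2' [H2' E2]]] _] := eW l; split.
    have := knzj_tensor idU idW gU gW Um Wm hU hW H1 H2; rewrite il => /Hmax[]; lia.
  have := knzj_tensor idU idW gU gW Um Wm hU hW H1' H2'; rewrite il => /Hmax[]; lia.
- move=> i l il; have [[j1 H1] [p1 [j1' [H1' E1]]] _] := eU i.
  have [[j2 H2] [p2 [j2' [H2' E2]]] _] := eW l; split.
    have := knzj_tensor_connecting idU idW gU gW Um Wm hU hW H1 H2.
    by rewrite addSn il => /Hmax[]; lia.
  have := knzj_tensor_connecting idU idW gU gW Um Wm hU hW H1' H2'.
  by rewrite addSn il => /Hmax[]; lia.
- by have [[i [l [il []]]]|[i [l [il []]]]] := inv _ _ Ht; [left|right]; exists i, l; split=> //; lia.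
- by have [[i [l [il []]]]|[i [l [il []]]]] := inv _ _ Hr; [left|right]; exists i, l; split=> //; lia.
Qed.

Lemma extremal_tfilt_exists s : exists t r, extremal (tfilt pt U W s.+1) t r.
Proof.
have [[j1 H1] _ _] := eU 0; have [[j2 H2] _ _] := eW s.
have := knzj_tensor idU idW gU gW Um Wm hU hW H1 H2 => [[a [? _ ? ?]]].
apply: (@extremal_exists _ _ _ (tU 0 + (tW s).+1)); first exact: tfilt_homogeneous.
by exists a.
Qed.

End Extrema.
End SumOfIdeals.

Unset Implicit Arguments.

Theorem theorem4p4 (k : fieldType) (d e : nat)
    (I K : set {mpoly k[d]}) (J L : set {mpoly k[e]})
    (homI : homogeneous_ideal I) (homK : homogeneous_ideal K)
    (homJ : homogeneous_ideal J) (homL : homogeneous_ideal L)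
    (I_neq0 : I <> [set 0]) (I_proper : I <> setT)
    (J_neq0 : J <> [set 0]) (J_proper : J <> setT)
    (cond : [pchar k] =i pred0 \/
      [/\ monomial_ideal I, monomial_ideal K,
          monomial_ideal J & monomial_ideal L])
    (s : nat) (s_ge1 : (1 <= s)%N) :
  let Q := sat_power (ideal_add (ext_left e I) (ext_right d J))
                     (ideal_mul (ext_left e K) (ext_right d L)) s in
  depth_quot Q =
    \big[Order.min/EPInf int]_(1 <= i < s.+1)
      Order.min
        (depth_quot (sat_power I K i) + depth_quot (sat_power J L (s - i)%N)
           + EFin 1)
        (depth_quot (sat_power I K i)
           + depth_quot (sat_power J L (s + 1 - i)%N))
  /\
  reg_quot Q =
    \big[Order.max/ENInf int]_(1 <= i < s.+1)
      Order.max
        (reg_quot (sat_power I K i) + reg_quot (sat_power J L (s - i)%N)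
           + EFin 1)
        (reg_quot (sat_power I K i)
           + reg_quot (sat_power J L (s + 1 - i)%N)).
Proof.
move=> Q; have EQ : Q = tfilt (ptens k d e) (sat_power I K) (sat_power J L) s.
  exact: sat_power_sum.
have hU := sat_power_homogeneous homI homK; have hW := sat_power_homogeneous homJ homL.
have hQ : homogeneous_ideal Q by rewrite EQ; apply: tfilt_homogeneous.
have addEE (a b : int) : EFin a + EFin b = EFin (a + b) by [].
have addye (x : extended int) : x <> ENInf int -> EPInf int + x = EPInf int by case: x.
have addey (x : extended int) : x <> ENInf int -> x + EPInf int = EPInf int by case: x.
have addeNy (x : extended int) : x + ENInf int = ENInf int by case: x.
have depthU i := @depth_sat_power_neq _ _ _ _ homI homK i I_neq0.
have depthW i := @depth_sat_power_neq _ _ _ _ homJ homL i J_neq0.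
have trivial_case : Q 1 ->
    (forall i j, depth_quot (sat_power I K i) + depth_quot (sat_power J L j) = EPInf int) ->
    (forall i j, reg_quot (sat_power I K i) + reg_quot (sat_power J L j) = ENInf int) ->
    depth_quot Q = \big[Order.min/EPInf int]_(1 <= i < s.+1)
      Order.min (depth_quot (sat_power I K i) + depth_quot (sat_power J L (s - i)%N) + EFin 1)
        (depth_quot (sat_power I K i) + depth_quot (sat_power J L (s + 1 - i)%N)) /\
    reg_quot Q = \big[Order.max/ENInf int]_(1 <= i < s.+1)
      Order.max (reg_quot (sat_power I K i) + reg_quot (sat_power J L (s - i)%N) + EFin 1)
        (reg_quot (sat_power I K i) + reg_quot (sat_power J L (s + 1 - i)%N)).
  move=> Q1 dE rE; rewrite depth_quot_unit // reg_quot_unit //; split.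
    by rewrite big1_idem ?minxx // => i _; rewrite !dE minxx.
  by rewrite big1_idem ?maxxx // => i _; rewrite !rE maxxx.
(* If I^(1) is the unit ideal, so are all I^(i) and the saturated power of the sum; both sides are
   then infinite. *)
have [U1|extU] := sat_power_cases homI homK I_neq0.
  apply: trivial_case => [|i j|i j].
  - have W1 : sat_power J L 0 1 by rewrite sat_power0.
    have := @tfilt_mem _ _ _ _ (ptens k d e) _ _ _ _ _ _ (U1 s) W1.
    by rewrite EQ addn0 ptensE !rmorph1 mulr1.
  - by rewrite (depth_quot_unit (U1 i)) addye.
  - by rewrite (reg_quot_unit (hU i) (U1 i)).
have [W1|extW] := sat_power_cases homJ homL J_neq0.
  apply: trivial_case => [|i j|i j].
  - have U1 : sat_power I K 0 1 by rewrite sat_power0.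
    have := @tfilt_mem _ _ _ _ (ptens k d e) _ _ _ _ _ _ U1 (W1 s).
    by rewrite EQ ptensE !rmorph1 mulr1.
  - by rewrite (depth_quot_unit (W1 j)) addey.
  - by rewrite (reg_quot_unit (hW j) (W1 j)) addeNy.
have [fU eU] : {f : nat -> nat * int & forall i, extremal (sat_power I K i.+1) (f i).1 (f i).2}.
  apply: (@choice _ _ (fun i y => extremal (sat_power I K i.+1) y.1 y.2)) => i.
  by have [t [r H]] := extU i; exists (t, r).
have [fW eW] : {f : nat -> nat * int & forall i, extremal (sat_power J L i.+1) (f i).1 (f i).2}.
  apply: (@choice _ _ (fun i y => extremal (sat_power J L i.+1) y.1 y.2)) => i.
  by have [t [r H]] := extW i; exists (t, r).
have [fhU fhW] : filtered_homotopy (sat_power I K) /\ filtered_homotopy (sat_power J L).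
  case: cond => [c0|[mI mK mJ mL]]; split; try exact: filtered_homotopy_monomial;
    exact: filtered_homotopy_pchar0.
case: s s_ge1 @Q EQ hQ {trivial_case} => // s _ Q EQ hQ.
have [t [r eQ]] := extremal_tfilt_exists homI homK homJ homL fhU fhW eU eW s.
have [le1 le2 att1 att2] := extremal_tfilt homI homK homJ homL fhU fhW eU eW eQ.
rewrite -EQ in eQ; have [td -> ->] := extremal_quot hQ eQ.
(* The first term for i = s involves J^(0) = B. Its infinite value is neutral for the extremum, in
   accordance with the absence of a connecting class there. *)
have W0 : depth_quot (sat_power J L 0) = EPInf int by rewrite sat_power0 depth_quot_unit.
have W0r : reg_quot (sat_power J L 0) = ENInf int.
  by apply: reg_quot_unit; rewrite ?sat_power0 //; have := hW 0; rewrite sat_power0.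
(* The bound makes the truncated subtraction exact in the depth arithmetic below. *)
have dU i : ((fU i).1 < d)%N /\ depth_quot (sat_power I K i.+1) = EFin (d - (fU i).1.+1)%N%:Z.
  by have [] := extremal_quot (hU i.+1) (eU i).
have dW i : ((fW i).1 < e)%N /\ depth_quot (sat_power J L i.+1) = EFin (e - (fW i).1.+1)%N%:Z.
  by have [] := extremal_quot (hW i.+1) (eW i).
have rU i : reg_quot (sat_power I K i.+1) = EFin (fU i).2.
  by have [] := extremal_quot (hU i.+1) (eU i).
have rW i : reg_quot (sat_power J L i.+1) = EFin (fW i).2.
  by have [] := extremal_quot (hW i.+1) (eW i).
split.
- apply: bigmin_attained => [|i|]; first exact: leey.
  + rewrite mem_index_iota; case: i => // i /andP[_ /ltnSE/ltnSE i_le_s].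
    have -> : (s.+1 + 1 - i.+1)%N = (s - i).+1 by lia.
    rewrite subSS (dU i).2 (dW (s - i)%N).2 addEE le_min; apply/andP; split; last first.
      rewrite lee_fin; have [] := le1 i (s - i)%N (subnKC i_le_s).
      by have := (dU i).1; have := (dW (s - i)%N).1; lia.
    case E : (s - i)%N => [|l]; first by rewrite W0.
    have il : (i + l.+1)%N = s by lia.
    rewrite (dW l).2 !addEE lee_fin; have [] := le2 i l il.
    by have := (dU i).1; have := (dW l).1; lia.
  + case: att1 => [[i [l [il le_t]]]|[i [l [il le_t]]]]; exists i.+1;
      rewrite ?mem_index_iota ?ge_min; try lia.
      apply/orP; right; have -> : (s.+1 + 1 - i.+1)%N = l.+1 by lia.
      rewrite (dU i).2 (dW l).2 addEE lee_fin.
      by have := (dU i).1; have := (dW l).1; lia.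
    apply/orP; left; have -> : (s.+1 - i.+1)%N = l.+1 by lia.
    rewrite (dU i).2 (dW l).2 !addEE lee_fin.
    by have := (dU i).1; have := (dW l).1; lia.
- apply: bigmax_attained => [|i|]; first exact: leNye.
  + rewrite mem_index_iota; case: i => // i /andP[_ /ltnSE/ltnSE i_le_s].
    have -> : (s.+1 + 1 - i.+1)%N = (s - i).+1 by lia.
    rewrite subSS rU rW addEE ge_max; apply/andP; split; last first.
      by rewrite lee_fin; have [_] := le1 i (s - i)%N (subnKC i_le_s).
    case E : (s - i)%N => [|l]; first by rewrite W0r addeNy; exact: leNye.
    have il : (i + l.+1)%N = s by lia.
    by rewrite rW !addEE lee_fin; have [_] := le2 i l il.
  + case: att2 => [[i [l [il le_t]]]|[i [l [il le_t]]]]; exists i.+1;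
      rewrite ?mem_index_iota ?le_max; try lia.
      apply/orP; right; have -> : (s.+1 + 1 - i.+1)%N = l.+1 by lia.
      by rewrite rU rW addEE lee_fin.
    apply/orP; left; have -> : (s.+1 - i.+1)%N = l.+1 by lia.
    by rewrite rU rW !addEE lee_fin.
Qed.
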